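(* Let $f$ satisfy the standing assumptions, let $\beta>\mu^{-1}$, and suppose that $h_\beta$ satisfies the KL property, with exponent in $[1/2,1)$, at each point of $$\mathrm{crit}(h_\beta):=\{(x,y)\in\mathbb{R}^n\times\mathbb{R}^m:\nabla h_\beta(x,y)=0,\ \nabla^2h_\beta(x,y)\succeq0\}.$$ Let $\{z_k\}_k$ be generated by the ACQRN method (described in the context) with $\alpha_1=2\beta\rho$ and $\alpha_2=2(3\beta L+1)\rho$, and suppose $\{z_k\}_k$ has at least one accumulation point $z^*=(x^*,y^* )$. Let $\theta$ be the KL exponent of $h_\beta$ at $z^*$. Then: 1. If $z^*$ satisfies the second-order sufficient condition (SOSC) of $\min_x\max_y f(x,y)$, then $\|z_k-z^*\|$ converges (locally) Q-quadratically to $0$. 2. If $\theta\in[1/2,2/3)$, then $\|z_k-z^*\|$ converges (locally) Q-superlinearly to $0$ at a rate (order) of $\frac{2}{3\theta}$. 3. If $\theta=2/3$, then $\|z_k-z^*\|$ converges (locally) Q-linearly to $0$. 4. If $\theta\in(2/3,1)$, then $\|z_k-z^*\|=O\big(k^{-2(1-\theta)/(3\theta-2)}\big)$.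
   Context: Write $z=(x,y)\in\mathbb{R}^n\times\mathbb{R}^m=\mathbb{R}^{n+m}$. $\|\cdot\|$ is the Euclidean norm for vectors and the spectral norm for matrices. Standing assumptions on $f:\mathbb{R}^n\times\mathbb{R}^m\to\mathbb{R}$: $f$ is thrice continuously differentiable; for each $x$, $f(x,\cdot)$ is $\mu$-strongly concave ($\mu>0$); for each $y$, $f(\cdot,y)$ is possibly nonconvex; for constants $L,\rho>0$, $\|\nabla f(z+\xi)-\nabla f(z)\|\le L\|\xi\|$ and $\|\nabla^2 f(z+\xi)-\nabla^2 f(z)\|\le\rho\|\xi\|$ for all $z,\xi\in\mathbb{R}^{n+m}$; and with $\Phi(x):=\max_{y\in\mathbb{R}^m}f(x,y)$, $\inf_{x}\Phi(x)>-\infty$. ($\Phi$ is twice continuously differentiable.) Regularized function: $h_\beta(z):=f(z)+\frac{\beta}{2}\|\nabla_y f(z)\|^2$. Set $P:=\begin{pmatrix}0&0\\0&I_m\end{pmatrix}$ and $\bar H(z):=\nabla^2 f(z)+\beta\nabla^2 f(z)P\nabla^2 f(z)$. SOSC: $(x^*,y^* )$ satisfies the SOSC of $\min_x\max_yf(x,y)$ if $\nabla f(x^*,y^* )=0$ (equivalently $\nabla\Phi(x^* )=0$ and $y^*$ maximizes $f(x^*,\cdot)$) and $\nabla^2\Phi(x^* )\succ0$. KL property: a differentiable $F:\mathbb{R}^d\to\mathbb{R}$ satisfies the KL property at $\bar x$ with exponent $\theta\in[\frac12,1)$ if there are a neighborhood $U(\bar x)$ of $\bar x$ and a constant $C_F=C_F(\bar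 x)>0$ with $\|\nabla F(x)\|\ge C_F|F(x)-F(\bar x)|^\theta$ for all $x\in U(\bar x)$. ACQRN method: given $z_0$, for $k=0,1,2,\dots$ choose a global minimizer $$\xi_k\in\arg\min_{\xi\in\mathbb{R}^{n+m}}\ \nabla h_\beta(z_k)^\top\xi+\tfrac12\xi^\top\big(\bar H(z_k)+\alpha_1\|\nabla_y f(z_k)\|I_{n+m}\big)\xi+\tfrac{\alpha_2}{6}\|\xi\|^3$$ and set $z_{k+1}=z_k+\xi_k$. *)

(* Defs.v *)
From HB Require Import structures.
From mathcomp Require Import all_boot all_order all_algebra.
From mathcomp Require Import all_classical all_reals all_analysis.

Set Implicit Arguments.
Unset Strict Implicit.
Unset Printing Implicit Defensive.

Import Order.TTheory GRing.Theory Num.Theory.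
Import numFieldNormedType.Exports.

Local Open Scope classical_set_scope.
Local Open Scope ring_scope.

Section EuclideanSpace.
Context {R : realType}.

(* The library norm on matrices is the sup norm; it induces the usual topology,
   so limits, continuity and differentiability below are the library's. *)
Definition enorm d (v : 'cV[R]_d) : R := Num.sqrt (\sum_i v i 0 ^+ 2).

Definition dotp d (u v : 'cV[R]_d) : R := (u^T *m v) 0 0.

Definition spectral_norm p q (A : 'M[R]_(p, q)) : R :=
  sup [set enorm (A *m v) | v in [set v : 'cV[R]_q | enorm v <= 1]].

Definition psd d (A : 'M[R]_d) : Prop := forall v : 'cV[R]_d, 0 <= dotp v (A *m v).

Definition pd d (A : 'M[R]_d) : Prop :=
  forall v : 'cV[R]_d, v != 0 -> 0 < dotp v (A *m v).

Definition basis_vec d (i : 'I_d) : 'cV[R]_d := delta_mx i 0.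

Definition grad d (F : 'cV[R]_d -> R) (x : 'cV[R]_d) : 'cV[R]_d :=
  \col_i 'D_(basis_vec i) F x.

Definition hess d (F : 'cV[R]_d -> R) (x : 'cV[R]_d) : 'M[R]_d :=
  \matrix_(i, j) 'D_(basis_vec j) ('D_(basis_vec i) F) x.

Fixpoint cont_diff d (k : nat) (F : 'cV[R]_d -> R) : Prop :=
  if k is k'.+1 then
    (forall x, differentiable F x) /\ (forall v, cont_diff k' ('D_v F))
  else continuous F.

Definition strongly_concave d (mu : R) (g : 'cV[R]_d -> R) : Prop :=
  forall (u v : 'cV[R]_d) (t : R), 0 <= t <= 1 ->
    t * g u + (1 - t) * g v + mu / 2 * t * (1 - t) * enorm (u - v) ^+ 2
      <= g (t *: u + (1 - t) *: v).

Definition KL_at d (F : 'cV[R]_d -> R) (theta : R) (xbar : 'cV[R]_d) : Prop :=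
  2^-1 <= theta < 1 /\
  exists U : set 'cV[R]_d, nbhs xbar U /\
  exists C : R, 0 < C /\
    forall x, U x -> C * `|F x - F xbar| `^ theta <= enorm (grad F x).

Definition crit d (F : 'cV[R]_d -> R) : set 'cV[R]_d :=
  [set x | grad F x = 0 /\ psd (hess F x)].

End EuclideanSpace.

Section Minimax.
Context {R : realType} {n m : nat}.
Implicit Types (f : 'cV[R]_(n + m) -> R) (z : 'cV[R]_(n + m)).

(* The supremum is a maximum when each f(x, .) is strongly concave. *)
Definition Phi f (x : 'cV[R]_n) : R :=
  sup (range (fun y : 'cV[R]_m => f (col_mx x y))).

Record standing_assumptions f (mu L rho : R) : Prop := StandingAssumptions {
  sa_mu : 0 < mu;
  sa_L : 0 < L;
  sa_rho : 0 < rho;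
  sa_smooth : cont_diff 3 f;
  sa_concave : forall x : 'cV[R]_n,
    strongly_concave mu (fun y : 'cV[R]_m => f (col_mx x y));
  sa_grad_lipschitz : forall z xi,
    enorm (grad f (z + xi) - grad f z) <= L * enorm xi;
  sa_hess_lipschitz : forall z xi,
    spectral_norm (hess f (z + xi) - hess f z) <= rho * enorm xi;
  sa_Phi_bounded : has_lbound (range (Phi f))
}.

Definition grad_y f z : 'cV[R]_m := dsubmx (grad f z).

Definition h_reg (beta : R) f z : R := f z + beta / 2 * enorm (grad_y f z) ^+ 2.

Definition Pmx : 'M[R]_(n + m) := block_mx 0 0 0 1%:M.

Definition Hbar (beta : R) f z : 'M[R]_(n + m) :=
  hess f z + beta *: (hess f z *m Pmx *m hess f z).

Definition SOSC f z : Prop := grad f z = 0 /\ pd (hess (Phi f) (usubmx z)).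

Definition acqrn_model (beta a1 a2 : R) f z (xi : 'cV[R]_(n + m)) : R :=
  dotp (grad (h_reg beta f) z) xi
  + 2^-1 * dotp xi ((Hbar beta f z + (a1 * enorm (grad_y f z))%:M) *m xi)
  + a2 / 6 * enorm xi ^+ 3.

Definition acqrn_sequence (beta a1 a2 : R) f (z : nat -> 'cV[R]_(n + m)) : Prop :=
  exists xi : nat -> 'cV[R]_(n + m), forall k,
    (forall eta, acqrn_model beta a1 a2 f (z k) (xi k)
                   <= acqrn_model beta a1 a2 f (z k) eta)
    /\ z k.+1 = z k + xi k.

End Minimax.

Section Rates.
Context {R : realType}.
Implicit Types u : nat -> R.

(* For a nonnegative u: the rates are local, i.e. the inequalities hold for all large k. *)

Definition Q_linear u : Prop :=
  u @ \oo --> (0 : R) /\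
  exists2 q : R, 0 < q < 1 & \forall k \near \oo, u k.+1 <= q * u k.

Definition Q_superlinear u : Prop :=
  u @ \oo --> (0 : R) /\
  forall e : R, 0 < e -> \forall k \near \oo, u k.+1 <= e * u k.

Definition Q_order (r : R) u : Prop :=
  u @ \oo --> (0 : R) /\
  exists2 C : R, 0 < C & \forall k \near \oo, u k.+1 <= C * u k `^ r.

Definition Q_quadratic u : Prop := Q_order 2 u.

End Rates.

(* Main.v *)
From HB Require Import structures.
From mathcomp Require Import all_boot all_order all_algebra.
From mathcomp Require Import all_classical all_reals all_analysis.
From mathcomp Require Import ring lra.
Require Import Defs.

Set Implicit Arguments.
Unset Strict Implicit.
Unset Printing Implicit Defensive.

Import Order.TTheory GRing.Theory Num.Theory.
Import numFieldNormedType.Exports.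

Local Open Scope classical_set_scope.
Local Open Scope ring_scope.

(** The functional gap [r k = h (z k) - h zs], the step length [eta k] and the distance
    [dist k] of the iterates to the accumulation point [zs], with [h = h_reg beta f],
    are related as follows.

    Since [grad h = (I + beta H P) grad f], and strong concavity in [y] with
    [beta > 1 / mu] makes [I + beta H P] uniformly injective ([coercive_full]), the
    critical points of [h] are those of [f], and the partial gradient of [f] in [y] is
    controlled by the gradient of [h]. The matrix [Hbar] is a substitute for the Hessian
    of [h]; its error is proportional to that partial gradient and is absorbed by the
    term with coefficient [2 * beta * rho] of the model. The model therefore majorizes
    [h], with a margin: [r] decreases by at least a multiple of [eta ^+ 3]
    ([step_decrease]), and optimality of the step makes the gradient of [h] at the next
    iterate of order [eta ^+ 2] ([small_step_bounds]). The accumulation point is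
    critical with [Hbar] positive semidefinite, which gives [eta k = O(dist k)]
    ([step_le_dist]).

    The Kurdyka-Lojasiewicz inequality becomes [r k.+1 `^ theta = O(eta k ^+ 2)]. With
    the decrease of [r], the usual length argument shows that the whole sequence converges
    and that [dist k] is of order [r k `^ 3^-1 + r k `^ (1 - theta)] ([dist_le_gap]). For
    [theta <= 2 / 3] the first power dominates, and
    [dist k.+1 = O(r k.+1 `^ 3^-1) = O(eta k `^ (2 / (3 * theta)))] is the order of
    convergence ([dist_le_order]). For [theta > 2 / 3], eliminating [eta] gives a
    recursive inequality for [r] which is integrated by [sublinear_decay].

    Under the second order sufficient condition [Hbar] is positive definite at [zs],
    because the Hessian of [Phi] is a Schur complement in that of [f] ([hess_Phi],
    [Hbar_pd]). The gradient of [h] then grows linearly, so the inequality holds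
    with exponent [1 / 2], and the gradient bound after a step gives quadratic
    convergence.

    For [theta = 2 / 3] the order is [1] and the constant obtained above need not be below
    [1]. Either the distance is eventually divided by [3] at each step, or eventually no
    two consecutive distances have a ratio below [1 / 3]. In the second case the gradient is
    of second order in the distance, and the rescaled vectors [(z k - zs) / dist k] and
    [xi k / dist k] converge, along an ultrafilter, to a unit vector [w] and a vector
    [z0] in the kernel of the Hessian of [f] at [zs]. There the optimality conditions
    of the step become relations for the third derivative [T] of [f]
    ([limit_first_order], [limit_psd_kernel]), and [dist k ^+ 3 = O(r k)] says that
    [T w w w > 0] ([limit_value]). They imply ([cubic_contraction]) that the ratio of the
    cubic form [T v v v / 6] to the cube of the norm does not increase from [w] to
    [w + z0], and is constant only if [z0] is a negative multiple of [w] and [w] a critical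
    point of the cubic form on the unit sphere of the kernel, in which case the distance
    is multiplied by a factor less than [1]. If the convergence were not linear, there
    would be infinitely many steps whose limit ratio of distances is at least [1]; at these
    the cubic ratio drops by a definite amount, so it has to cross infinitely often, upwards,
    every level of some interval. A limit of such crossings is a critical point of the cubic
    form whose critical value is the given level. This contradicts Sard's theorem, which
    for this cubic form is proved with derivations: a level that is transcendental over
    the coefficients is not a critical value ([exists_noncritical_value]). *)

(** * Euclidean geometry of column vectors *)

Section Euclid.
Context {R : realType}.
Implicit Types d : nat.

Lemma dotpE d (u v : 'cV[R]_d) : dotp u v = \sum_i u i 0 * v i 0.
Proof. by rewrite /dotp mxE; apply: eq_bigr => i _; rewrite mxE. Qed.

Lemma dotpC d (u v : 'cV[R]_d) : dotp u v = dotp v u.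
Proof. by rewrite !dotpE; apply: eq_bigr => i _; rewrite mulrC. Qed.

Lemma dotpDl d (u v w : 'cV[R]_d) : dotp (u + v) w = dotp u w + dotp v w.
Proof. by rewrite /dotp linearD /= mulmxDl mxE. Qed.

Lemma dotpDr d (u v w : 'cV[R]_d) : dotp w (u + v) = dotp w u + dotp w v.
Proof. by rewrite /dotp mulmxDr mxE. Qed.

Lemma dotpZl d a (u w : 'cV[R]_d) : dotp (a *: u) w = a * dotp u w.
Proof. by rewrite /dotp linearZ /= -scalemxAl mxE. Qed.

Lemma dotpZr d a (u w : 'cV[R]_d) : dotp w (a *: u) = a * dotp w u.
Proof. by rewrite /dotp -scalemxAr mxE. Qed.

Lemma dotpNl d (u w : 'cV[R]_d) : dotp (- u) w = - dotp u w.
Proof. by rewrite -scaleN1r dotpZl mulN1r. Qed.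

Lemma dotpNr d (u w : 'cV[R]_d) : dotp w (- u) = - dotp w u.
Proof. by rewrite -scaleN1r dotpZr mulN1r. Qed.

Lemma dotpBl d (u v w : 'cV[R]_d) : dotp (u - v) w = dotp u w - dotp v w.
Proof. by rewrite dotpDl dotpNl. Qed.

Lemma dotpBr d (u v w : 'cV[R]_d) : dotp w (u - v) = dotp w u - dotp w v.
Proof. by rewrite dotpDr dotpNr. Qed.

Lemma dotp0l d (w : 'cV[R]_d) : dotp 0 w = 0.
Proof. by rewrite -(scale0r (0 : 'cV[R]_d)) dotpZl mul0r. Qed.

Lemma dotp0r d (w : 'cV[R]_d) : dotp w 0 = 0.
Proof. by rewrite dotpC dotp0l. Qed.

Definition dotp_lin := (dotpDl, dotpDr, dotpNl, dotpNr, dotpZl, dotpZr, dotp0l, dotp0r).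

Lemma dotp_ge0 d (u : 'cV[R]_d) : 0 <= dotp u u.
Proof. by rewrite dotpE; apply: sumr_ge0 => i _; rewrite -expr2 sqr_ge0. Qed.

Lemma enormE d (u : 'cV[R]_d) : enorm u = Num.sqrt (dotp u u).
Proof. by rewrite /enorm dotpE. Qed.

Lemma enorm_ge0 d (u : 'cV[R]_d) : 0 <= enorm u.
Proof. by rewrite sqrtr_ge0. Qed.
Hint Resolve enorm_ge0 : core.

Lemma enorm_sqr d (u : 'cV[R]_d) : enorm u ^+ 2 = dotp u u.
Proof. by rewrite enormE sqr_sqrtr ?dotp_ge0. Qed.

Lemma enorm0 d : enorm (0 : 'cV[R]_d) = 0.
Proof. by rewrite enormE dotp0l sqrtr0. Qed.

Lemma enorm_eq0 d (u : 'cV[R]_d) : enorm u = 0 -> u = 0.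
Proof.
move=> u0; have := enorm_sqr u; rewrite u0 expr0n /= => /esym/eqP.
rewrite dotpE psumr_eq0 => [/allP h|i _]; last by rewrite -expr2 sqr_ge0.
apply/colP => i; have := h i (mem_index_enum _).
by rewrite -expr2 sqrf_eq0 mxE => /eqP.
Qed.

Lemma enormZ d a (u : 'cV[R]_d) : enorm (a *: u) = `|a| * enorm u.
Proof.
by rewrite !enormE dotpZl dotpZr mulrA -expr2 sqrtrM ?sqr_ge0// sqrtr_sqr.
Qed.

Lemma enormN d (u : 'cV[R]_d) : enorm (- u) = enorm u.
Proof. by rewrite -scaleN1r enormZ normrN1 mul1r. Qed.

Lemma enormBC d (u v : 'cV[R]_d) : enorm (u - v) = enorm (v - u).
Proof. by rewrite -enormN opprB. Qed.

Lemma cauchy_schwarz d (u v : 'cV[R]_d) : `|dotp u v| <= enorm u * enorm v.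
Proof.
have [/enorm_eq0 ->|v0] := eqVneq (enorm v) 0.
  by rewrite dotp0r normr0 mulr_ge0.
have vpos : 0 < enorm v by rewrite lt_neqAle eq_sym v0 enorm_ge0.
rewrite -ler_sqr ?nnegrE ?mulr_ge0// -normrX ger0_norm ?sqr_ge0//.
have := dotp_ge0 (enorm v ^+ 2 *: u - dotp u v *: v).
rewrite exprMn !dotp_lin (dotpC v u) -!enorm_sqr => h.
have v2 : 0 < enorm v ^+ 2 by rewrite exprn_gt0.
rewrite -subr_ge0 -(pmulr_rge0 _ v2).
by apply: le_trans h _; rewrite le_eqVlt; apply/orP; left; apply/eqP; ring.
Qed.

Lemma dotp_le d (u v : 'cV[R]_d) : dotp u v <= enorm u * enorm v.
Proof. exact: le_trans (ler_norm _) (cauchy_schwarz u v). Qed.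

Lemma dotp_ge d (u v : 'cV[R]_d) : - (enorm u * enorm v) <= dotp u v.
Proof. by have := cauchy_schwarz u v; rewrite ler_norml => /andP[]. Qed.

Lemma dotp_dist d (u1 u2 v1 v2 : 'cV[R]_d) : `|dotp u1 v1 - dotp u2 v2|
  <= enorm (u1 - u2) * enorm v1 + enorm u2 * enorm (v1 - v2).
Proof.
have -> : dotp u1 v1 - dotp u2 v2 = dotp (u1 - u2) v1 + dotp u2 (v1 - v2).
  by rewrite !dotp_lin; ring.
by rewrite (le_trans (ler_normD _ _))// lerD// cauchy_schwarz.
Qed.

Lemma enorm_sqrD d (u v : 'cV[R]_d) :
  enorm (u + v) ^+ 2 = enorm u ^+ 2 + 2 * dotp u v + enorm v ^+ 2.
Proof. by rewrite !enorm_sqr !dotp_lin (dotpC v u); ring. Qed.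

Lemma enormD d (u v : 'cV[R]_d) : enorm (u + v) <= enorm u + enorm v.
Proof.
rewrite -ler_sqr ?nnegrE ?addr_ge0// enorm_sqrD sqrrD lerD2r lerD2l.
by rewrite mulr2n; have := dotp_le u v; lra.
Qed.

Lemma enormB d (u v : 'cV[R]_d) : enorm (u - v) <= enorm u + enorm v.
Proof. by rewrite (le_trans (enormD _ _))// enormN. Qed.

Lemma enorm_dist d (u v : 'cV[R]_d) : `|enorm u - enorm v| <= enorm (u - v).
Proof.
rewrite ler_norml; apply/andP; split.
  by have := enormD (v - u) u; rewrite subrK enormBC; lra.
by have := enormD (u - v) v; rewrite subrK; lra.
Qed.

(** Turns an estimate of all scalar products with [u], the form in which the mean value
    theorem yields bounds, into a bound of the norm. *)
Lemma enorm_le_dual d (u : 'cV[R]_d) K : 0 <= K ->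
  (forall v, dotp v u <= K * enorm v) -> enorm u <= K.
Proof.
move=> K0 h; have [->//|u0] := eqVneq (enorm u) 0.
have upos : 0 < enorm u by rewrite lt_neqAle eq_sym u0 enorm_ge0.
by have := h u; rewrite -enorm_sqr expr2 ler_pM2r.
Qed.

Lemma abs_coord_le_enorm d (u : 'cV[R]_d) i : `|u i 0| <= enorm u.
Proof.
rewrite -ler_sqr ?nnegrE// enorm_sqr dotpE (bigD1 i) //= -expr2 real_normK ?num_real//.
by rewrite lerDl; apply: sumr_ge0 => j _; rewrite -expr2 sqr_ge0.
Qed.

Lemma mx_norm_le_enorm d (u : 'cV[R]_d) : `|u| <= enorm u.
Proof.
rewrite [leLHS](_ : _ = mx_norm u)// mx_normrE bigmax_le ?enorm_ge0//=.
by move=> [i j] _ /=; rewrite (ord1 j) abs_coord_le_enorm.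
Qed.

Lemma coord_le_mx_norm d (u : 'cV[R]_d) i : `|u i 0| <= `|u|.
Proof.
rewrite [leRHS](_ : _ = mx_norm u)// mx_normrE.
exact: (@le_bigmax _ _ _ 0 (fun ij : 'I_d * 'I_1 => `|u ij.1 ij.2|) (i, 0)).
Qed.

Lemma enorm_le_mx_norm d (u : 'cV[R]_d) : enorm u <= d%:R * `|u|.
Proof.
rewrite -ler_sqr ?nnegrE ?mulr_ge0 ?ler0n// enorm_sqr dotpE.
rewrite (@le_trans _ _ (\sum_(i < d) `|u| ^+ 2))//.
  apply: ler_sum => i _; rewrite -expr2 -[leLHS]real_normK ?num_real//.
  by rewrite ler_sqr ?nnegrE// coord_le_mx_norm.
rewrite sumr_const card_ord exprMn -[leLHS]mulr_natl.
rewrite ler_wpM2r ?sqr_ge0// -natrX ler_nat.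
by case: (d) => // k; rewrite expnS leq_pmulr// expn1.
Qed.

Lemma mulmx_enorm_le p q (A : 'M[R]_(p, q)) :
  exists2 K, 0 <= K & forall v, enorm (A *m v) <= K * enorm v.
Proof.
exists (\sum_i enorm (col i A)); first exact: sumr_ge0.
move=> v; have -> : A *m v = \sum_i v i 0 *: col i A.
  apply/colP => k; rewrite summxE mxE; apply: eq_bigr => i _.
  by rewrite !mxE mulrC.
rewrite mulr_suml.
elim/big_ind2: _ => [|x1 x2 y1 y2 h1 h2|i _]; first by rewrite enorm0.
  by rewrite (le_trans (enormD _ _))// lerD.
by rewrite enormZ mulrC ler_wpM2l// abs_coord_le_enorm.
Qed.

Lemma spectral_norm_ge p q (A : 'M[R]_(p, q)) v :
  enorm (A *m v) <= spectral_norm A * enorm v.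
Proof.
have [K K0 hK] := mulmx_enorm_le A.
have [v0|v0] := eqVneq (enorm v) 0.
  by rewrite v0 mulr0 (enorm_eq0 v0) mulmx0 enorm0.
have vpos : 0 < enorm v by rewrite lt_neqAle eq_sym v0 enorm_ge0.
rewrite -ler_pdivrMr//; apply: ub_le_sup.
  exists K => _ [w /= w1 <-]; rewrite (le_trans (hK w))//.
  by rewrite -[leRHS]mulr1 ler_wpM2l.
exists ((enorm v)^-1 *: v) => /=.
  by rewrite enormZ ger0_norm ?invr_ge0// mulVf.
by rewrite -scalemxAr enormZ ger0_norm ?invr_ge0// mulrC.
Qed.

End Euclid.
#[global] Hint Extern 0 (is_true (@Order.le _ _ _ (enorm _))) =>
  solve [apply: enorm_ge0] : core.

(** The topology comes from the supremum norm, which [mx_norm_le_enorm] and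
    [enorm_le_mx_norm] compare with the Euclidean norm. *)
Lemma nbhs_enormP {R : realType} d (x : 'cV[R]_d) (U : set 'cV[R]_d) :
  nbhs x U <-> exists2 del : R, 0 < del & forall y, enorm (y - x) < del -> U y.
Proof.
split=> [/nbhs_normP [r /= r0 hr]|[del d0 hd]].
  exists r => // y hy; apply: hr => /=.
  by apply: le_lt_trans (mx_norm_le_enorm _) _; rewrite enormBC.
have D0 : 0 < d%:R + 1 :> R by rewrite ltr_wpDl.
refine ((nbhs_normP x U).2 _); exists (del / (d%:R + 1)) => [|y /= hy]; first exact: divr_gt0.
apply: hd; rewrite enormBC; apply: le_lt_trans (enorm_le_mx_norm _) _.
apply: (@le_lt_trans _ _ ((d%:R + 1) * `|x - y|)).
  by rewrite ler_wpM2r ?lerDl//; exact: (normr_ge0 (x - y)).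
by rewrite mulrC -ltr_pdivlMr.
Qed.

(** * Directional derivatives and Taylor estimates *)

Section Derivatives.
Context {R : realType} {d : nat}.
Implicit Types (F : 'cV[R]_d -> R) (z u v w : 'cV[R]_d).

Lemma is_derive_line F z v t : derivable F (z + t *: v) v ->
  is_derive t 1 (fun s : R => F (z + s *: v)) ('D_v F (z + t *: v)).
Proof.
have E : (fun h => h^-1 *: (((fun s : R => F (z + s *: v)) \o shift t) (h *: 1)
            - F (z + t *: v)))
       = (fun h => h^-1 *: ((F \o shift (z + t *: v)) (h *: v) - F (z + t *: v))).
  apply/funext => h /=; congr (_ *: (F _ - _)).
  by rewrite [h *: 1]mulr1 scalerDl addrCA.
by move=> dF; split; rewrite /derivable /derive E.
Qed.

Lemma derive_lin F z v : differentiable F z -> 'D_v F z = dotp (grad F z) v.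
Proof.
move=> dF; have -> : v = \sum_i v i 0 *: basis_vec i.
  apply/colP => k; rewrite summxE (bigD1 k) //= big1 => [|i ik].
    by rewrite !mxE !eqxx mulr1 addr0.
  by rewrite !mxE eq_sym (negbTE ik) mulr0.
rewrite deriveE // linear_sum; transitivity (\sum_i v i 0 * grad F z i 0).
  by apply: eq_bigr => i _; rewrite linearZ mxE deriveE.
rewrite dotpE; apply: eq_bigr => i _; rewrite mulrC; congr (_ * _).
rewrite summxE (bigD1 i) //= big1 => [|k ki].
  by rewrite !mxE !eqxx mulr1 addr0.
by rewrite !mxE eq_sym (negbTE ki) mulr0.
Qed.

Lemma mvt01 (phi dphi : R -> R) :
  (forall t : R, 0 <= t <= 1 -> is_derive t 1 phi (dphi t)) ->
  exists2 c, 0 < c < 1 & phi 1 - phi 0 = dphi c.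
Proof.
move=> h; have hd (x : R) : x \in `]0, 1[ -> is_derive x 1 phi (dphi x).
  by rewrite in_itv /= => /andP[x0 x1]; apply: h; rewrite !ltW.
have hc : {within `[0, 1], continuous phi}.
  apply: derivable_within_continuous => x; rewrite in_itv /= => xI.
  exact: (@ex_derive _ _ _ _ _ _ _ (h x xI)).
have [c cI E] := MVT ltr01 hd hc.
by exists c; [move: cI; rewrite in_itv|rewrite E subr0 mulr1].
Qed.

(** The mean value theorem applied to [phi - K / n.+1%:R * t ^+ n.+1]; the Taylor estimates
    below are instances of it along segments. *)
Lemma taylor_le (phi dphi : R -> R) (K : R) n :
  (forall t : R, 0 <= t <= 1 -> is_derive t 1 phi (dphi t)) ->
  (forall t : R, 0 <= t <= 1 -> dphi t <= K * t ^+ n) ->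
  phi 1 - phi 0 <= K / n.+1%:R.
Proof.
move=> dp le; pose K' := K / n.+1%:R.
pose psi := (phi - K' *: (@GRing.exp R ^~ n.+1)) : R -> R.
have dpsi (t : R) : 0 <= t <= 1 ->
    is_derive t 1 psi (dphi t - K' *: (n.+1%:R *: t ^+ n *: 1)).
  move=> tI; apply: is_deriveB; first exact: dp.
  apply: is_deriveZ; split; last by rewrite exp_derive.
  exact: exprn_derivable.
have [c cI] := mvt01 dpsi.
have cI' : 0 <= c <= 1 by case/andP: cI => ? ?; rewrite !ltW.
have {}le := le c cI'.
have -> : psi 1 = phi 1 - K' by rewrite /psi !fctE /= expr1n [_ *: _]mulr1.
have -> : psi 0 = phi 0 by rewrite /psi !fctE /= expr0n /= scaler0 subr0.
have -> : K' *: (n.+1%:R *: c ^+ n *: 1) = K * c ^+ n.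
  by rewrite /K' /GRing.scale /= mulr1 mulrA divfK ?pnatr_eq0.
by rewrite -/K'; lra.
Qed.

Lemma taylor_abs (phi dphi : R -> R) (K : R) n :
  (forall t : R, 0 <= t <= 1 -> is_derive t 1 phi (dphi t)) ->
  (forall t : R, 0 <= t <= 1 -> `|dphi t| <= K * t ^+ n) ->
  `|phi 1 - phi 0| <= K / n.+1%:R.
Proof.
move=> dp le; rewrite ler_norml; apply/andP; split; last first.
  by apply: taylor_le dp _ => t tI; apply: le_trans (ler_norm _) (le t tI).
rewrite lerNl opprB -[phi 0]opprK addrC.
apply: (@taylor_le (fun t => - phi t) (fun t => - dphi t)) => t tI.
  by apply: is_deriveN; apply: dp.
by rewrite (le_trans _ (le t tI))// -normrN ler_norm.
Qed.

(** Meant for functions known only through two-sided bounds, such as the maximum value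
    [Phi] and its partial derivatives. *)
Lemma derive_quadratic_bound F z v c K :
  (forall t : R, `|t| <= 1 -> `|F (z + t *: v) - F z - t * c| <= K * t ^+ 2) ->
  'D_v F z = c.
Proof.
move=> h; rewrite /derive; apply: cvg_lim => //.
apply/cvgrPdist_le => e e0.
have K1 : 0 < `|K| + 1 by rewrite ltr_wpDl.
near=> t.
have t0 : t != 0 by near: t; exact: nbhs_dnbhs_neq.
have t1 : `|t| <= 1.
  near: t; apply: dnbhs0_le; exact: ltr01.
have te : `|t| <= e / (`|K| + 1).
  near: t; apply: dnbhs0_le; exact: divr_gt0.
rewrite /= distrC [t *: v + z]addrC.
have := h t t1.
have -> : F (z + t *: v) - F z - t * c = t * (t^-1 *: (F (z + t *: v) - F z) - c).
  by rewrite mulrBr mulrA mulfV// mul1r.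
rewrite normrM -[t ^+ 2]real_normK ?num_real// expr2 mulrA (mulrC K) -mulrA.
rewrite ler_pM2l ?normr_gt0// => /le_trans; apply.
rewrite (@le_trans _ _ ((`|K| + 1) * `|t|))//.
  by rewrite ler_wpM2r// (le_trans (ler_norm K))// lerDl.
by rewrite -ler_pdivlMl// mulrC.
Unshelve. all: by end_near. Qed.

Lemma differentiable_expansion F z : differentiable F z ->
  forall e : R, 0 < e -> exists2 del : R, 0 < del &
    forall u, enorm u <= del ->
      `|F (z + u) - F z - dotp (grad F z) u| <= e * enorm u.
Proof.
move=> dF e e0.
have /eqaddoP/(_ e e0) := diff_locally dF.
move/nbhs_norm0P => [r r0 hr].
exists (r / 2); first by rewrite divr_gt0.
move=> u ur; have ul : `|u| < r.
  apply: le_lt_trans (mx_norm_le_enorm u) (le_lt_trans ur _).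
  by rewrite gtr_pMr// invf_lt1// ltr1n.
move: (hr u ul); rewrite /= !fctE /= [u + z]addrC -derive_lin// deriveE// opprD addrA => /le_trans; apply.
by apply: ler_wpM2l; [exact: ltW|exact: mx_norm_le_enorm].
Qed.

(** Symmetry of second derivatives when the first partial derivatives are
    differentiable at the point only: the mixed second difference of [F] over
    [t *: u], [t *: v] is [t ^+ 2 * 'D_v ('D_u F) z] up to [o(t ^+ 2)] by the mean
    value theorem along [u], and is symmetric in [u] and [v]. *)
Lemma second_difference F z u v : (forall x, differentiable F x) ->
  differentiable ('D_u F) z ->
  forall e : R, 0 < e -> exists2 del : R, 0 < del &
    forall t : R, 0 < t <= del ->
      `|F (z + t *: u + t *: v) - F (z + t *: u) - F (z + t *: v) + F z
        - t ^+ 2 * 'D_v ('D_u F) z| <= e * t ^+ 2.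
Proof.
move=> dF dDu e e0.
pose N := enorm u + enorm v + 1.
have N0 : 0 < N. by have := enorm_ge0 u; have := enorm_ge0 v; rewrite /N; lra.
have e' : 0 < e / (2 * N) by rewrite divr_gt0 ?mulr_gt0.
have [r r0 hr] := differentiable_expansion dDu e'.
exists (r / N); first by rewrite divr_gt0.
move=> t /andP[t0 tr].
pose phi s := F (z + t *: v + s *: (t *: u)) - F (z + s *: (t *: u)).
pose dphi s := 'D_(t *: u) F (z + t *: v + s *: (t *: u))
             - 'D_(t *: u) F (z + s *: (t *: u)).
have dp (s : R) : 0 <= s <= 1 -> is_derive s 1 phi (dphi s).
  by move=> _; apply: is_deriveB; apply: is_derive_line; apply: diff_derivable.
have [s /andP[s0 s1] E] := mvt01 dp.
have -> : F (z + t *: u + t *: v) - F (z + t *: u) - F (z + t *: v) + F z = dphi s.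
  by rewrite -E /phi !scale1r !scale0r !addr0 (addrAC z (t *: u)); ring.
have lin x : 'D_(t *: u) F x = t * 'D_u F x.
  by rewrite !derive_lin// dotpZr.
rewrite /dphi !lin -(addrA z) scalerA.
have s' : 0 <= s * t by rewrite mulr_ge0 ?ltW.
have st : s * t <= t by rewrite ger_pMl// ltW.
have tN : t * N <= r by rewrite -ler_pdivlMr.
have b1 : enorm (t *: v + (s * t) *: u) <= t * N.
  rewrite (le_trans (enormD _ _))// !enormZ !ger0_norm ?(ltW t0)//.
  have := ler_wpM2r (enorm_ge0 u) st; rewrite /N; lra.
have b2 : enorm ((s * t) *: u) <= t * N.
  rewrite enormZ ger0_norm//; have := ler_wpM2r (enorm_ge0 u) st.
  by have := mulr_ge0 (ltW t0) (enorm_ge0 v); rewrite /N; lra.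
have h1 := hr _ (le_trans b1 tN); have h2 := hr _ (le_trans b2 tN).
have Dv : 'D_v ('D_u F) z = dotp (grad ('D_u F) z) v by rewrite derive_lin.
move: h1 h2; rewrite dotpDr (dotpZr t) -Dv.
set A := 'D_u F _; set A0 := 'D_u F z; set B := 'D_u F _; set g := dotp _ _; set D := 'D_v _ _.
move=> h1 h2.
have -> : t * A - t * B - t ^+ 2 * D = t * ((A - A0 - (t * D + g)) - (B - A0 - g)).
  by ring.
rewrite normrM (gtr0_norm t0).
have -> : e * t ^+ 2 = t * (e / (2 * N) * (t * N) + e / (2 * N) * (t * N)).
  by field; rewrite gt_eqF.
rewrite ler_pM2l// (le_trans (ler_normB _ _))// lerD//.
  by rewrite (le_trans h1)// ler_pM2l.
by rewrite (le_trans h2)// ler_pM2l.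
Qed.

Lemma derive_symmetric F z u v : (forall x, differentiable F x) ->
  differentiable ('D_u F) z -> differentiable ('D_v F) z ->
  'D_v ('D_u F) z = 'D_u ('D_v F) z.
Proof.
move=> dF du dv; apply/eqP; rewrite -subr_eq0 -normr_le0; apply/ler_addgt0Pl => e e0.
rewrite addr0.
have e2 : 0 < e / 2 by rewrite divr_gt0.
have [r1 r10 h1] := second_difference v dF du e2.
have [r2 r20 h2] := second_difference u dF dv e2.
pose t := Num.min r1 r2.
have t0 : 0 < t by rewrite lt_min r10.
have /h1 {h1}h1 : 0 < t <= r1 by rewrite t0 ge_min lexx.
have /h2 {h2}h2 : 0 < t <= r2 by rewrite t0 ge_min lexx orbT.
have t2 : 0 < t ^+ 2 by rewrite exprn_gt0.
rewrite -(ler_pM2l t2) -[X in X * `|_|]gtr0_norm// -normrM.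
move: h1 h2; rewrite [z + t *: v + t *: u]addrAC.
set A := F _; set B := F _; set C := F _; set E := F _; set D1 := 'D_v _ _; set D2 := 'D_u _ _.
move=> h1 h2.
have -> : t ^+ 2 * (D1 - D2) = (A - C - B + E - t ^+ 2 * D2) - (A - B - C + E - t ^+ 2 * D1).
  by ring.
by rewrite (le_trans (ler_normB _ _))// (le_trans (lerD h2 h1))// -mulrDl -splitr mulrC.
Qed.

End Derivatives.

(** * Consequences of the standing assumptions *)

Section Blocks.
Context {R : realType} {n m : nat}.
Implicit Types (u v : 'cV[R]_(n + m)).

Lemma dotp_col (a b : 'cV[R]_n) (c e : 'cV[R]_m) :
  dotp (col_mx a c) (col_mx b e) = dotp a b + dotp c e.
Proof. by rewrite /dotp tr_col_mx mul_row_col mxE. Qed.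

Lemma Pmx_mul v : @Pmx R n m *m v = col_mx 0 (dsubmx v).
Proof.
by rewrite -[v in LHS]vsubmxK /Pmx mul_block_col !mul0mx mul1mx !add0r.
Qed.

Lemma dotp_Pmx u v : dotp u (@Pmx R n m *m v) = dotp (dsubmx u) (dsubmx v).
Proof. by rewrite Pmx_mul -[u in LHS]vsubmxK dotp_col dotp0r add0r. Qed.

Lemma dotp_PmxC u v : dotp u (@Pmx R n m *m v) = dotp (@Pmx R n m *m u) v.
Proof. by rewrite dotp_Pmx [RHS]dotpC dotp_Pmx dotpC. Qed.

Lemma Pmx_idem v : @Pmx R n m *m (@Pmx R n m *m v) = @Pmx R n m *m v.
Proof. by rewrite !Pmx_mul col_mxKd. Qed.

Lemma enorm_Pmx v : enorm (@Pmx R n m *m v) = enorm (dsubmx v).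
Proof. by rewrite !enormE dotp_Pmx Pmx_mul col_mxKd. Qed.

Lemma enorm_dsubmx_le v : enorm (dsubmx v) <= enorm v.
Proof.
rewrite -ler_sqr ?nnegrE// !enorm_sqr -{3 4}[v]vsubmxK dotp_col.
by rewrite lerDr dotp_ge0.
Qed.

Lemma enorm_Pmx_le v : enorm (@Pmx R n m *m v) <= enorm v.
Proof. by rewrite enorm_Pmx enorm_dsubmx_le. Qed.

Lemma enorm_col0 (s : 'cV[R]_m) : enorm (col_mx (0 : 'cV[R]_n) s) = enorm s.
Proof. by rewrite !enormE dotp_col dotp0l add0r. Qed.

Lemma enorm_col_0 (s : 'cV[R]_n) : enorm (col_mx s (0 : 'cV[R]_m)) = enorm s.
Proof. by rewrite !enormE dotp_col dotp0l addr0. Qed.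

End Blocks.

Section ScalarLimits.
Context {R : realType}.

Lemma is_derive_mulc (c t : R) : is_derive t 1 (fun s : R => s * c) c.
Proof.
have -> : (fun s : R => s * c) = (fun s : R => c *: id s).
  by apply/funext => s; rewrite mulrC.
by apply: is_derive_eq; rewrite [LHS]mulr1.
Qed.

Lemma is_derive_half_sqr (c t : R) :
  is_derive t 1 (fun s : R => s ^+ 2 / 2 * c) (t * c).
Proof.
have -> : (fun s : R => s ^+ 2 / 2 * c) = (c / 2) *: (id ^+ 2 : R -> R).
  by apply/funext => s; rewrite !fctE /GRing.scale /=; ring.
by apply: is_derive_eq; rewrite /GRing.scale /= mulr1 expr1; field.
Qed.

(** Dividing by [t] and letting [t] tend to [0]. *)
Lemma le_of_first_order (a b K : R) :
  (forall t, 0 < t <= 1 -> t * a <= t * b + t ^+ 2 * K) -> a <= b.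
Proof.
move=> h; apply/ler_addgt0Pl => e e0.
have K1 : 0 < `|K| + 1 by rewrite ltr_wpDl.
pose t := Num.min 1 (e / (`|K| + 1)).
have t0 : 0 < t by rewrite lt_min ltr01 divr_gt0.
have t1 : t <= 1 by rewrite ge_min lexx.
have te : t * (`|K| + 1) <= e by rewrite -ler_pdivlMr// ge_min lexx orbT.
have /h : 0 < t <= 1 by rewrite t0.
have -> : t * b + t ^+ 2 * K = t * (b + t * K) by ring.
rewrite ler_pM2l// => /le_trans; apply.
rewrite addrC lerD2r (le_trans _ te)// ler_pM2l// (le_trans (ler_norm _))//.
by rewrite lerDl.
Qed.

End ScalarLimits.

Section Assumptions.
Context {R : realType} {n m : nat} (f : 'cV[R]_(n + m) -> R) (mu L rho : R).
Context (hf : standing_assumptions f mu L rho).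
Implicit Types (u v w x z : 'cV[R]_(n + m)).
Notation P := (@Pmx R n m).
Notation g := (grad f).
Notation H := (hess f).

Lemma mu_gt0 : 0 < mu. Proof. by case: hf. Qed.
Lemma L_gt0 : 0 < L. Proof. by case: hf. Qed.
Lemma rho_gt0 : 0 < rho. Proof. by case: hf. Qed.

Lemma diff_f z : differentiable f z.
Proof. by case: (sa_smooth hf). Qed.

Lemma diff_D1 v z : differentiable ('D_v f) z.
Proof. by case: (sa_smooth hf) => _ /(_ v)[]. Qed.

Lemma diff_D2 v w z : differentiable ('D_w ('D_v f)) z.
Proof. by case: (sa_smooth hf) => _ /(_ v)[_ /(_ w)[]]. Qed.

Lemma D1E v z : 'D_v f z = dotp v (g z).
Proof. by rewrite (derive_lin v (diff_f z)) dotpC. Qed.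

Lemma D2C v w z : 'D_w ('D_v f) z = 'D_v ('D_w f) z.
Proof. by apply: derive_symmetric; [exact: diff_f|exact: diff_D1..]. Qed.

Lemma D2E v w z : 'D_w ('D_v f) z = dotp v (H z *m w).
Proof.
rewrite D2C (derive_lin v (diff_D1 w z)) !dotpE; apply: eq_bigr => i _; rewrite mulrC; congr (_ * _).
rewrite mxE D2C (derive_lin w (diff_D1 _ z)) mxE dotpE.
by apply: eq_bigr => j _; rewrite !mxE.
Qed.

Lemma hess_sym u v z : dotp u (H z *m v) = dotp v (H z *m u).
Proof. by rewrite -!D2E D2C. Qed.

Lemma hess_lip_dual z x u v :
  `|dotp u (H (z + x) *m v) - dotp u (H z *m v)| <= rho * enorm x * enorm u * enorm v.
Proof.
rewrite -dotpBr -mulmxBl (le_trans (cauchy_schwarz _ _))//.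
rewrite (_ : rho * _ * _ * _ = enorm u * (rho * enorm x * enorm v)); last by ring.
rewrite ler_wpM2l//.
by rewrite (le_trans (spectral_norm_ge _ _))// ler_wpM2r// (sa_hess_lipschitz hf).
Qed.

Lemma hess_lip z x v :
  enorm (H (z + x) *m v - H z *m v) <= rho * enorm x * enorm v.
Proof.
rewrite -mulmxBl (le_trans (spectral_norm_ge _ _))// ler_wpM2r//.
exact: (sa_hess_lipschitz hf).
Qed.

Lemma is_derive_f_line z x (t : R) :
  is_derive t 1 (fun s : R => f (z + s *: x)) (dotp x (g (z + t *: x))).
Proof. by rewrite -D1E; apply/is_derive_line/diff_derivable/diff_f. Qed.

Lemma is_derive_g_line z x v (t : R) :
  is_derive t 1 (fun s : R => dotp v (g (z + s *: x))) (dotp v (H (z + t *: x) *m x)).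
Proof.
rewrite -D2E (_ : (fun s => _) = (fun s => 'D_v f (z + s *: x))).
  by apply/is_derive_line/diff_derivable/diff_D1.
by apply/funext => s; rewrite D1E.
Qed.

Lemma grad_taylor_dual z x v :
  `|dotp v (g (z + x)) - dotp v (g z) - dotp v (H z *m x)|
    <= rho / 2 * enorm x ^+ 2 * enorm v.
Proof.
pose phi t := dotp v (g (z + t *: x)) - t * dotp v (H z *m x).
pose dphi t := dotp v (H (z + t *: x) *m x) - dotp v (H z *m x).
have := @taylor_abs _ phi dphi (rho * enorm x ^+ 2 * enorm v) 1.
rewrite /phi scale1r scale0r addr0 mul1r mul0r subr0 addrAC => h.
rewrite (_ : rho / 2 * _ * _ = rho * enorm x ^+ 2 * enorm v / 2); last by ring.
apply: h => t /andP[t0 t1].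
  by apply: is_deriveB; [exact: is_derive_g_line|exact: is_derive_mulc].
rewrite /dphi (le_trans (hess_lip_dual _ _ _ _))// enormZ (ger0_norm t0).
by rewrite le_eqVlt; apply/orP; left; apply/eqP; ring.
Qed.

Lemma grad_taylor z x :
  enorm (g (z + x) - g z - H z *m x) <= rho / 2 * enorm x ^+ 2.
Proof.
apply: enorm_le_dual.
  by rewrite mulr_ge0 ?exprn_ge0// divr_ge0// ltW// rho_gt0.
by move=> v; rewrite !dotpBr (le_trans (ler_norm _))// grad_taylor_dual.
Qed.

Lemma f_taylor z x :
  `|f (z + x) - f z - dotp (g z) x - 2^-1 * dotp x (H z *m x)|
    <= rho / 6 * enorm x ^+ 3.
Proof.
pose phi t := f (z + t *: x) - (t * dotp x (g z)) - t ^+ 2 / 2 * dotp x (H z *m x).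
pose dphi t := dotp x (g (z + t *: x)) - dotp x (g z) - t * dotp x (H z *m x).
have := @taylor_abs _ phi dphi (rho / 2 * enorm x ^+ 3) 2.
rewrite /phi scale1r scale0r addr0 mul1r mul0r expr1n expr0n /= !mul0r !subr0 mul1r.
rewrite [dotp (g z) x]dotpC => h.
have -> : f (z + x) - f z - dotp x (g z) - 2^-1 * dotp x (H z *m x) =
   f (z + x) - dotp x (g z) - 2^-1 * dotp x (H z *m x) - f z by ring.
rewrite (_ : rho / 6 * _ = rho / 2 * enorm x ^+ 3 / 3%:R); last by field.
apply: h => t /andP[t0 t1].
  apply: is_deriveB; last exact: is_derive_half_sqr.
  by apply: is_deriveB; [exact: is_derive_f_line|exact: is_derive_mulc].
have := grad_taylor_dual z (t *: x) x.
rewrite -scalemxAr dotpZr enormZ (ger0_norm t0) => /le_trans; apply.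
by rewrite le_eqVlt; apply/orP; left; apply/eqP; ring.
Qed.

Lemma hess_le z v : enorm (H z *m v) <= L * enorm v.
Proof.
apply: enorm_le_dual => [|u]; first by rewrite mulr_ge0// ltW// L_gt0.
apply: (@le_of_first_order _ _ _ (rho / 2 * enorm v ^+ 2 * enorm u)) => t /andP[t0 t1].
have := grad_taylor_dual z (t *: v) u; rewrite ler_norml => /andP[+ _].
rewrite -scalemxAr dotpZr enormZ (gtr0_norm t0) => h1.
have : dotp u (g (z + t *: v) - g z) <= enorm u * (L * (t * enorm v)).
  rewrite (le_trans (dotp_le _ _))// ler_wpM2l//.
  by rewrite (le_trans (sa_grad_lipschitz hf _ _))// enormZ gtr0_norm.
by rewrite dotpBr; lra.
Qed.

(** Midpoint strong concavity at [z] with the points [z + t *: P v] and [z - t *: P v]: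
    the odd terms of the Taylor expansions cancel, and dividing by [t ^+ 2] leaves the
    quadratic form, with an error of order [t]. *)
Lemma hess_concave z v : dotp (P *m v) (H z *m (P *m v)) <= - mu * enorm (P *m v) ^+ 2.
Proof.
set S := P *m v; set s := dsubmx v.
have ES : S = col_mx 0 s by rewrite /S Pmx_mul.
have nS : enorm S = enorm s by rewrite ES enorm_col0.
apply: (@le_of_first_order _ _ _ (rho / 3 * enorm S ^+ 3)) => t /andP[t0 t1].
have shift a : z + a *: S = col_mx (usubmx z) (dsubmx z + a *: s).
  by rewrite ES scale_col_mx scaler0 -{1}[z]vsubmxK add_col_mx addr0.
have h2 : 0 <= (2^-1 : R) <= 1 by apply/andP; split; lra.
have := sa_concave hf (usubmx z) (dsubmx z + t *: s) (dsubmx z + (- t) *: s) h2.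
rewrite -!shift.
have -> : 2^-1 *: (dsubmx z + t *: s) + (1 - 2^-1) *: (dsubmx z + (- t) *: s)
        = dsubmx z.
  have -> : (1 - 2^-1 = 2^-1 :> R) by lra.
  rewrite -scalerDr scaleNr addrACA subrr addr0 -mulr2n.
  by rewrite -[dsubmx z *+ 2]scaler_nat scalerA mulVf ?scale1r ?pnatr_eq0.
have -> : dsubmx z + t *: s - (dsubmx z + (- t) *: s) = (2 * t) *: s.
  by rewrite scaleNr opprB addrC subrKA -scalerDl; congr (_ *: _); ring.
rewrite vsubmxK enormZ gtr0_norm ?mulr_gt0// -nS => hc.
have := f_taylor z (t *: S); have := f_taylor z ((- t) *: S).
rewrite !ler_norml => /andP[h3 _] /andP[h4 _].
move: h3 h4; rewrite -!scalemxAr !dotpZl !dotpZr !enormZ normrN (gtr0_norm t0) => h3 h4.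
rewrite -(ler_pM2l t0); move: hc h3 h4.
set A := f _; set B := f _; set C := f _; set D := dotp _ _; set E := dotp _ _.
set e := enorm S; set r := rho; nra.
Qed.

End Assumptions.

(** * Minimizers of a cubic model *)

Section CubicModel.
Context {R : realType} {d : nat}.
Implicit Types (u v x : 'cV[R]_d).

Definition cubic_model (b : 'cV[R]_d) (M : 'M[R]_d) (c : R) x : R :=
  dotp b x + 2^-1 * dotp x (M *m x) + c / 6 * enorm x ^+ 3.

(** The cubic term is expanded through the squared norm:
    [s ^+ 3 - r ^+ 3 = 3 / 2 * r * (s ^+ 2 - r ^+ 2) + (s - r) ^+ 2 * (s + r / 2)],
    which leaves a remainder of second order in [s - r]. *)
Lemma cubic_model_shift b (M : 'M[R]_d) c x v :
  (forall u w, dotp u (M *m w) = dotp w (M *m u)) ->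
  cubic_model b M c (x + v) - cubic_model b M c x =
    dotp (b + M *m x + (c / 2 * enorm x) *: x) v
    + 2^-1 * (dotp v (M *m v) + c / 2 * enorm x * enorm v ^+ 2)
    + c / 6 * ((enorm (x + v) - enorm x) ^+ 2 * (enorm (x + v) + enorm x / 2)).
Proof.
move=> sM; have := enorm_sqrD x v.
rewrite /cubic_model mulmxDr !(dotpDl, dotpDr) dotpZl (dotpC (M *m x)) (sM v x).
set p := enorm (x + v); set q := enorm x; set e := enorm v; set D := dotp x v.
set A := dotp x _; set B := dotp x _; set C := dotp v (M *m v).
set E := dotp b x; set F := dotp b v.
move=> /(congr1 (fun t => t - q ^+ 2 - e ^+ 2)) h.
have {h}-> : D = (p ^+ 2 - q ^+ 2 - e ^+ 2) / 2 by rewrite h; field.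
by field.
Qed.

(** A global minimizer satisfies more than the second order necessary condition, in
    which the Hessian of the cubic term also has a part along [x]. If [v] is not
    orthogonal to [x], moving from [x] to the other point of the sphere on the line
    through [x] directed by [v] leaves the cubic term unchanged, and
    [cubic_model_shift] has no remainder; if [v] is orthogonal to [x], the remainder is
    of third order. *)
Lemma cubic_model_optimality b (M : 'M[R]_d) c x : 0 <= c ->
  (forall u w, dotp u (M *m w) = dotp w (M *m u)) ->
  (forall y, cubic_model b M c x <= cubic_model b M c y) ->
  b + M *m x + (c / 2 * enorm x) *: x = 0 /\
  forall v, 0 <= dotp v (M *m v) + c / 2 * enorm x * enorm v ^+ 2.
Proof.
move=> c0 sM hmin.
set q := b + M *m x + _; set r := enorm x.
have r0 : 0 <= r by exact: enorm_ge0.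
have key v : 0 <= dotp q v + 2^-1 * (dotp v (M *m v) + c / 2 * r * enorm v ^+ 2)
    + c / 6 * ((enorm (x + v) - r) ^+ 2 * (enorm (x + v) + r / 2)).
  by rewrite -cubic_model_shift// subr_ge0.
have q0 : q = 0.
  apply: enorm_eq0; apply/eqP; rewrite -sqrf_eq0 eq_le sqr_ge0 andbT.
  apply: (@le_of_first_order _ _ _ (2^-1 * (dotp q (M *m q) + c / 2 * r * enorm q ^+ 2)
    + c / 6 * (enorm q ^+ 2 * (r + enorm q + r / 2)))) => t /andP[t0 t1].
  have := key ((- t) *: q).
  rewrite -scalemxAr !(dotpZl, dotpZr) -enorm_sqr enormZ normrN gtr0_norm//.
  set s := enorm (x + _); set e := enorm q.
  have e0 : 0 <= e by exact: enorm_ge0.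
  have hs : (s - r) ^+ 2 <= t ^+ 2 * e ^+ 2.
    rewrite -[leLHS]real_normK ?num_real// -exprMn ler_sqr ?nnegrE ?mulr_ge0// ?(ltW t0)//.
    rewrite (le_trans (enorm_dist _ _))// [x + _]addrC addrK enormZ normrN gtr0_norm//.
  have s0 : 0 <= s by exact: enorm_ge0.
  have hs' : s <= r + e.
    rewrite (le_trans (enormD _ _))// lerD2l enormZ normrN gtr0_norm//.
    by rewrite ler_piMl.
  have h1 : (s - r) ^+ 2 * (s + r / 2) <= t ^+ 2 * e ^+ 2 * (r + e + r / 2).
    apply: ler_pM => //; first exact: sqr_ge0.
      by rewrite addr_ge0// divr_ge0.
    by rewrite lerD2r.
  have := ler_wpM2l c0 h1.
  set Q := dotp q _; nra.
split=> // v.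
have {}key w : 0 <= 2^-1 * (dotp w (M *m w) + c / 2 * r * enorm w ^+ 2)
    + c / 6 * ((enorm (x + w) - r) ^+ 2 * (enorm (x + w) + r / 2)).
  by have := key w; rewrite q0 dotp0l add0r.
have [v0|v0] := eqVneq (enorm v) 0.
  by rewrite (enorm_eq0 v0) dotp0l enorm0 expr0n mulr0 addr0.
have vpos : 0 < enorm v by rewrite lt_neqAle eq_sym v0 enorm_ge0.
have [xv|xv] := eqVneq (dotp x v) 0; last first.
  (* the point symmetric to [x] along [v] lies on the same sphere *)
  pose t := - (2 * dotp x v / enorm v ^+ 2).
  have t0 : t != 0.
    by rewrite oppr_eq0 mulf_neq0 ?invr_eq0 ?expf_neq0 ?mulf_neq0 ?pnatr_eq0.
  have := key (t *: v).
  have -> : enorm (x + t *: v) = r.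
    apply/eqP; rewrite -(eqrXn2 (ltn0Sn 1))// enorm_sqrD dotpZr enormZ exprMn.
    rewrite real_normK ?num_real// -/r -subr_eq0 /t; apply/eqP; field.
    by rewrite gt_eqF.
  rewrite subrr expr0n mul0r mulr0 addr0 -scalemxAr dotpZl dotpZr enormZ exprMn.
  rewrite real_normK ?num_real//.
  have -> : t * (t * dotp v (M *m v)) + c / 2 * r * (t ^+ 2 * enorm v ^+ 2)
    = t ^+ 2 * (dotp v (M *m v) + c / 2 * r * enorm v ^+ 2) by ring.
  by rewrite pmulr_rge0 ?invr_gt0// pmulr_rge0// exprn_even_gt0.
rewrite -oppr_le0 -(pmulr_rle0 _ (_ : 0 < 2^-1)) ?invr_gt0//.
apply: (@le_of_first_order _ _ _ (c / 6 * enorm v ^+ 3)) => t /andP[t0 t1].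
have := key (t *: v).
have hs : enorm (x + t *: v) ^+ 2 = r ^+ 2 + t ^+ 2 * enorm v ^+ 2.
  by rewrite enorm_sqrD dotpZr xv enormZ gtr0_norm// exprMn -/r; ring.
have hs' : enorm (x + t *: v) <= r + t * enorm v.
  by rewrite (le_trans (enormD _ _))// enormZ gtr0_norm.
move: hs hs'; rewrite -scalemxAr dotpZl dotpZr enormZ gtr0_norm//.
set s := enorm (x + _); set e := enorm v; set Q := dotp v _ => hs hs' h.
have s0 : 0 <= s by exact: enorm_ge0.
have te : 0 < t * e by rewrite mulr_gt0.
have rs : r <= s.
  by rewrite -ler_sqr ?nnegrE// hs lerDl mulr_ge0// sqr_ge0.
have h2 : (s - r) ^+ 2 * (s + r / 2) <= (t * e) ^+ 3.
  have e1 : (s - r) * (s + r) = (t * e) ^+ 2 by rewrite exprMn -subr_sqr hs; ring.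
  apply: (@le_trans _ _ ((s - r) ^+ 2 * (s + r))).
    by rewrite ler_wpM2l ?sqr_ge0// lerD2l ler_piMr// invf_le1// ler1n.
  rewrite expr2 -mulrA e1 [leRHS]exprS ler_wpM2r ?sqr_ge0//; lra.
have h3 := ler_wpM2l c0 h2.
rewrite -(ler_pM2l t0); nra.
Qed.

End CubicModel.

(** * The regularized function and one step of the method *)

Section Regularized.
Context {R : realType} {n m : nat} (f : 'cV[R]_(n + m) -> R) (mu L rho beta : R).
Context (hf : standing_assumptions f mu L rho) (hbeta : mu^-1 < beta).
Implicit Types (u v w x y z xi : 'cV[R]_(n + m)).
Notation P := (@Pmx R n m).
Notation g := (grad f).
Notation H := (hess f).
Notation h := (h_reg beta f).
Notation G := (grad (h_reg beta f)).
Notation a z := (enorm (P *m grad f z)).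
Notation kappa := (3 * beta * L + 1).

Let mu0 : 0 < mu := mu_gt0 hf.
Let L0 : 0 < L := L_gt0 hf.
Let rho0 : 0 < rho := rho_gt0 hf.

Lemma beta_gt0 : 0 < beta.
Proof. by rewrite (lt_trans _ hbeta)// invr_gt0. Qed.
Let beta0 := beta_gt0.

Definition gap := beta * mu - 1.

Lemma gap_gt0 : 0 < gap.
Proof. by rewrite subr_gt0 -ltr_pdivrMr// mul1r. Qed.
Let gap0 := gap_gt0.

Lemma kappa_gt1 : 1 < kappa.
Proof. by rewrite ltrDr !mulr_gt0. Qed.

Lemma h_regE z : h z = f z + beta / 2 * a z ^+ 2.
Proof. by rewrite /h_reg /grad_y enorm_Pmx. Qed.

(** [h] is [f] plus half [beta] times the sum of squares of the partial derivatives in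
    [y], whose derivatives are entries of the Hessian of [f]. *)
Lemma grad_h_reg z : G z = g z + beta *: (H z *m (P *m g z)).
Proof.
apply/colP => i; rewrite mxE; set e := basis_vec i.
have hE : h = f + (beta / 2) *: \sum_(j < m) ('D_(basis_vec (rshift n j)) f ^+ 2).
  apply/funext => x; rewrite fctE /h_reg /grad_y enorm_sqr dotpE; congr (_ + _).
  rewrite [RHS]/GRing.scale /= fct_sumE; congr (_ * _); apply: eq_bigr => j _.
  by rewrite !mxE exprfctE.
have dP j x : derivable ('D_(basis_vec (rshift n j)) f) x e.
  by apply: diff_derivable; exact: (diff_D1 hf).
have hD : is_derive z e (f + (beta / 2) *:
      \sum_(j < m) ('D_(basis_vec (rshift n j)) f ^+ 2))
    ('D_e f z + (beta / 2) *:
      \sum_(j < m) ((2%:R * 'D_(basis_vec (rshift n j)) f z ^+ 1)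
        *: 'D_e ('D_(basis_vec (rshift n j)) f) z)).
  apply: is_deriveD; first by apply: derivableP; apply/diff_derivable/(diff_f hf).
  apply: is_deriveZ; apply: is_derive_sum => j.
  by apply: is_deriveX; apply: derivableP.
rewrite hE (@derive_val _ _ _ _ _ _ _ hD).
rewrite (D1E hf).
have eE v : dotp e v = v i 0.
  rewrite dotpE (bigD1 i) //= big1 => [|k ki]; first by rewrite mxE !eqxx mul1r addr0.
  by rewrite mxE (negbTE ki) mul0r.
have bE j v : dotp (basis_vec j) v = v j 0.
  rewrite dotpE (bigD1 j) //= big1 => [|k ki]; first by rewrite mxE !eqxx mul1r addr0.
  by rewrite mxE (negbTE ki) mul0r.
rewrite eE [RHS]mxE; congr (_ + _).
rewrite [RHS]mxE -[(H z *m _) i 0]eE (hess_sym hf) -dotp_PmxC dotp_Pmx dotpE.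
rewrite /GRing.scale /= !mulr_sumr; apply: eq_bigr => j _.
by rewrite (D1E hf) (D2E hf) !bE !mxE; field.
Qed.

(** Strong concavity in [y] together with [1 / mu < beta] makes
    [I + beta * H * P] uniformly injective; this is what keeps the critical
    points of the regularized function critical for [f]. *)
Lemma coercive_y z u : gap * enorm (P *m u) <= enorm (u + beta *: (H z *m (P *m u))).
Proof.
set p := enorm (P *m u).
have [p0|p0] := eqVneq p 0; first by rewrite p0 mulr0.
have pp : 0 < p by rewrite lt_neqAle eq_sym p0 enorm_ge0.
have := dotp_ge (P *m u) (u + beta *: (H z *m (P *m u))).
rewrite dotpDr dotpZr.
have -> : dotp (P *m u) u = p ^+ 2.
  by rewrite /p enorm_sqr (dotp_PmxC (P *m u) u) Pmx_idem.
have := hess_concave hf z u; rewrite -/p.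
set e := enorm (u + _); set Q := dotp _ _ => h1 h2.
rewrite -(ler_pM2l pp) /gap.
have := ler_wpM2l (ltW beta0) h1; lra.
Qed.

(** [u] is recovered from [u + beta H P u] up to [beta H P u], which [coercive_y]
    controls. *)
Lemma coercive_full : exists2 K, 0 < K & forall z u,
  enorm u <= K * enorm (u + beta *: (H z *m (P *m u))).
Proof.
exists (1 + beta * L / gap).
  by rewrite addr_gt0// divr_gt0// mulr_gt0.
move=> z u; set w := u + _.
have -> : u = w - beta *: (H z *m (P *m u)) by rewrite /w addrK.
rewrite (le_trans (enormB _ _))// mulrDl mul1r lerD2l enormZ (gtr0_norm beta0).
rewrite -!mulrA ler_pM2l// (le_trans (hess_le hf _ _))// ler_pM2l//.
by rewrite ler_pdivlMl// coercive_y.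
Qed.

Lemma grad_y_le z : a z <= enorm (G z) / gap.
Proof. by rewrite ler_pdivlMr// mulrC grad_h_reg coercive_y. Qed.

Lemma Hbar_mul z v :
  Hbar beta f z *m v = H z *m v + beta *: (H z *m (P *m (H z *m v))).
Proof. by rewrite /Hbar mulmxDl -scalemxAl !mulmxA. Qed.

Lemma Hbar_quad z u v : dotp u (Hbar beta f z *m v) =
  dotp u (H z *m v) + beta * dotp (P *m (H z *m u)) (P *m (H z *m v)).
Proof.
rewrite Hbar_mul dotpDr dotpZr (hess_sym hf _ (P *m _)); congr (_ + _ * _).
by rewrite -dotp_PmxC [RHS]dotp_PmxC Pmx_idem dotpC.
Qed.

Lemma Hbar_sym z u v : dotp u (Hbar beta f z *m v) = dotp v (Hbar beta f z *m u).
Proof. by rewrite (Hbar_quad z u v) (Hbar_quad z v u) (hess_sym hf u v z) [X in _ + _ * X]dotpC. Qed.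

Lemma Hbar_le z v : enorm (Hbar beta f z *m v) <= (L + beta * L ^+ 2) * enorm v.
Proof.
rewrite Hbar_mul (le_trans (enormD _ _))// mulrDl lerD ?(hess_le hf)//.
rewrite enormZ (gtr0_norm beta0) -mulrA ler_pM2l// (le_trans (hess_le hf _ _))//.
rewrite expr2 -mulrA ler_pM2l// (le_trans (enorm_Pmx_le _))//.
exact: (hess_le hf).
Qed.

Lemma Hbar_lip z x u v :
  `|dotp u (Hbar beta f (z + x) *m v) - dotp u (Hbar beta f z *m v)|
    <= (rho + 2 * beta * L * rho) * enorm x * enorm u * enorm v.
Proof.
move: (z + x) (hess_lip hf z x) (hess_lip_dual hf z x u v) => z1 lip hA.
rewrite (congr2 (fun s t => s - t) (Hbar_quad z1 u v) (Hbar_quad z u v)).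
have pB w : enorm (P *m (H z1 *m w) - P *m (H z *m w)) <= rho * enorm x * enorm w.
  by rewrite -mulmxBr (le_trans (enorm_Pmx_le _) (lip w)).
have pL z' w : enorm (P *m (H z' *m w)) <= L * enorm w.
  exact: le_trans (enorm_Pmx_le _) (hess_le hf z' w).
have hX := le_trans (dotp_dist _ _ _ _)
  (lerD (ler_pM (enorm_ge0 _) (enorm_ge0 _) (pB u) (pL z1 v))
        (ler_pM (enorm_ge0 _) (enorm_ge0 _) (pL z u) (pB v))).
have split_dist (A B X Y b1 b2 : R) : `|A - B| <= b1 -> `|X - Y| <= b2 ->
    `|A + beta * X - (B + beta * Y)| <= b1 + beta * b2.
  move=> h1 h2; have -> : A + beta * X - (B + beta * Y) = (A - B) + beta * (X - Y).
    by ring.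
  by rewrite (le_trans (ler_normD _ _))// lerD// normrM (gtr0_norm beta0) ler_pM2l.
apply: le_trans (split_dist _ _ _ _ _ _ hA hX) _.
by rewrite le_eqVlt; apply/orP; left; apply/eqP; ring.
Qed.

(** The remainder [|r| ^+ 2] of order four is not expanded: the difference of squares
    is written as a product with one factor of order at most one, so that the
    estimate stays cubic globally. *)
Lemma h_descent z x :
  h (z + x) <= h z + dotp (G z) x + 2^-1 * dotp x (Hbar beta f z *m x)
    + beta * rho / 2 * a z * enorm x ^+ 2 + kappa * rho / 6 * enorm x ^+ 3.
Proof.
rewrite !h_regE.
set p0 := P *m g z; set p1 := P *m g (z + x); set A := P *m (H z *m x).
set r := p1 - p0 - A.
have hr : enorm r <= rho / 2 * enorm x ^+ 2.
  rewrite /r -!mulmxBr (le_trans (enorm_Pmx_le _))//.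
  exact: (grad_taylor hf).
have hA : enorm A <= L * enorm x.
  by rewrite (le_trans (enorm_Pmx_le _))// (hess_le hf).
have hp : enorm (p1 - p0) <= L * enorm x.
  by rewrite -mulmxBr (le_trans (enorm_Pmx_le _))// (sa_grad_lipschitz hf).
have E2 : dotp (G z) x = dotp (g z) x + beta * dotp p0 A.
  rewrite grad_h_reg dotpDl dotpZl -/p0 [dotp (H z *m _) x]dotpC (hess_sym hf).
  by rewrite /A /p0 dotp_PmxC Pmx_idem.
have E3 : dotp x (Hbar beta f z *m x) = dotp x (H z *m x) + beta * enorm A ^+ 2.
  by rewrite Hbar_quad -enorm_sqr.
have Ep1 : p1 = p0 + A + r by apply/colP => i; rewrite /r !mxE; ring.
clearbody r p0 p1 A.
have E1 : enorm p1 ^+ 2 = enorm p0 ^+ 2 + 2 * dotp p0 A + enorm A ^+ 2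
    + dotp (2 *: p0 + A + (p1 - p0)) r.
  rewrite [in LHS]Ep1.
  have -> : p1 - p0 = A + r by rewrite [in LHS]Ep1; apply/colP => i; rewrite !mxE; ring.
  rewrite !enorm_sqr !(dotpDl, dotpDr) dotpZl (dotpC A p0) (dotpC r p0) (dotpC r A).
  by ring.
have h1 : dotp (2 *: p0 + A + (p1 - p0)) r
    <= (2 * enorm p0 + 2 * L * enorm x) * (rho / 2 * enorm x ^+ 2).
  rewrite (le_trans (dotp_le _ _))// ler_pM//.
  rewrite (le_trans (enormD _ _))//; have := enormD (2 *: p0) A.
  by rewrite enormZ (ger0_norm (ler0n R 2)); lra.
have := f_taylor hf z x; rewrite ler_norml => /andP[_ h2].
have h3 := ler_wpM2l (ltW beta0) h1.
rewrite E1 E2 E3; move: h2 h3.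
set B := dotp (2 *: p0 + _ + _) r; set e := enorm x; set q := enorm p0; nra.
Qed.

Lemma G_remainder (A B : 'M[R]_(n + m)) b1 b2 x :
  b1 + beta *: (A *m (P *m b1)) - (b2 + beta *: (B *m (P *m b2)))
    - (B *m x + beta *: (B *m (P *m (B *m x))))
  = (b1 - b2 - B *m x) + beta *: (B *m (P *m (b1 - b2 - B *m x)))
    + beta *: (A *m (P *m b1) - B *m (P *m b1)).
Proof. by rewrite !mulmxBr !scalerBr; apply/colP => i; rewrite ![in LHS]mxE ![in RHS]mxE; ring. Qed.

(** The variation of the factor [H] in [grad_h_reg] is multiplied by the partial gradient
    in [y]; it is not accounted for by [Hbar] and makes the last term. *)
Lemma G_taylor z x :
  enorm (G (z + x) - G z - Hbar beta f z *m x)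
    <= (1 + beta * L) * (rho / 2) * enorm x ^+ 2 + beta * rho * enorm x * a (z + x).
Proof.
rewrite !grad_h_reg Hbar_mul.
set r := g (z + x) - g z - H z *m x.
have hr : enorm r <= rho / 2 * enorm x ^+ 2 by exact: (grad_taylor hf).
set q := P *m g (z + x).
rewrite G_remainder -/r -/q.
rewrite (le_trans (enormD _ _))// lerD//.
  rewrite (le_trans (enormD _ _))// -mulrA mulrDl mul1r lerD// enormZ (gtr0_norm beta0).
  rewrite -mulrA ler_pM2l// (le_trans (hess_le hf _ _))// ler_pM2l//.
  by rewrite (le_trans (enorm_Pmx_le _)).
rewrite enormZ (gtr0_norm beta0) -!mulrA ler_pM2l// mulrA.
exact: (hess_lip hf).
Qed.

(** ** The step *)

Definition is_step z xi := forall eta,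
  acqrn_model beta (2 * beta * rho) (2 * kappa * rho) f z xi
  <= acqrn_model beta (2 * beta * rho) (2 * kappa * rho) f z eta.

Section Step.
Context (z xi : 'cV[R]_(n + m)) (hstep : is_step z xi).
Notation eta := (enorm xi).

Lemma kr0 : 0 < kappa * rho.
Proof. by rewrite mulr_gt0// (lt_trans ltr01 kappa_gt1). Qed.

Lemma step_optimality :
  G z + Hbar beta f z *m xi + (2 * beta * rho * a z + kappa * rho * eta) *: xi = 0 /\
  forall v, 0 <= dotp v (Hbar beta f z *m v)
     + (2 * beta * rho * a z + kappa * rho * eta) * enorm v ^+ 2.
Proof.
set M := Hbar beta f z + (2 * beta * rho * a z)%:M.
have ME v : M *m v = Hbar beta f z *m v + (2 * beta * rho * a z) *: v.
  by rewrite mulmxDl mul_scalar_mx.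
have c0 : 0 <= 2 * kappa * rho by have := kr0; lra.
have sM u w : dotp u (M *m w) = dotp w (M *m u).
  by rewrite !ME !dotpDr !dotpZr (Hbar_sym z u w) (dotpC u w).
have [y|E psd] := cubic_model_optimality c0 sM (x := xi) (b := G z).
  by have := hstep y; rewrite /acqrn_model /grad_y -enorm_Pmx.
have cE : 2 * kappa * rho / 2 = kappa * rho by field.
split=> [|v].
  by rewrite -E ME cE scalerDl !addrA.
by have := psd v; rewrite ME dotpDr dotpZr cE -enorm_sqr; lra.
Qed.

(** Comparison of the model at the minimizer with its value at [0], together with
    [h_descent]: the coefficients of the model are twice those of the majorant, which
    leaves half of the cubic term as a decrease. *)
Lemma step_decrease : h (z + xi) + kappa * rho / 6 * eta ^+ 3 <= h z.
Proof.
have := hstep 0; rewrite /acqrn_model !dotp0r !dotp0l enorm0 expr0n /= !mulr0 !addr0.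
rewrite /grad_y -enorm_Pmx mulmxDl mul_scalar_mx dotpDr dotpZr -enorm_sqr.
have := h_descent z xi.
have : 0 <= beta * rho * a z * eta ^+ 2 by rewrite !mulr_ge0 ?exprn_ge0// ltW.
move: (a z) (dotp xi (Hbar beta f z *m xi)) (dotp (G z) xi) => a0 q p; lra.
Qed.

(** By stationarity the model gradient vanishes after the step, so only the error of
    [G_taylor] and the gradients of the regularizing terms remain. *)
Lemma step_grad_next : enorm (G (z + xi)) <=
  ((1 + beta * L) * (rho / 2) + kappa * rho) * eta ^+ 2
  + beta * rho * eta * a (z + xi) + 2 * beta * rho * a z * eta.
Proof.
have [E _] := step_optimality; have hW := G_taylor z xi.
have c0 : 0 <= 2 * beta * rho * a z + kappa * rho * eta.
  by rewrite addr_ge0// mulr_ge0 ?(ltW kr0)// mulr_ge0 ?(ltW rho0)// mulr_ge0// ltW.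
move: (G (z + xi)) (G z) (Hbar beta f z *m xi) (a z) (a (z + xi)) E hW c0 => Gp G0 B a0 a1.
set c := _ + kappa * rho * eta => E hW c0.
have -> : Gp = Gp - G0 - B - c *: xi.
  by apply/colP => i; move/colP/(_ i): E; rewrite !mxE; lra.
rewrite (le_trans (enormB _ _))// enormZ ger0_norm//.
by rewrite (le_trans (lerD hW (lexx _)))// /c; lra.
Qed.

Lemma step_grad : enorm (G z) <=
  (L + beta * L ^+ 2) * eta + (2 * beta * rho * a z + kappa * rho * eta) * eta.
Proof.
have [E _] := step_optimality; have hB := Hbar_le z xi.
have c0 : 0 <= 2 * beta * rho * a z + kappa * rho * eta.
  by rewrite addr_ge0// mulr_ge0 ?(ltW kr0)// mulr_ge0 ?(ltW rho0)// mulr_ge0// ltW.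
move: (G z) (Hbar beta f z *m xi) (a z) E hB c0 => G0 B a0.
set c := _ + kappa * rho * eta => E hB c0.
have -> : G0 = - (B + c *: xi).
  by apply/eqP; rewrite -subr_eq0 opprK addrA; apply/eqP.
by rewrite enormN (le_trans (enormD _ _))// lerD// enormZ ger0_norm.
Qed.

End Step.

(** The partial gradient enters both bounds with a factor that is small with the
    step and is controlled by the full gradient, so it can be absorbed. *)
Lemma small_step_bounds : exists eta0 C1 C2, [/\ 0 < eta0, 0 < C1, 0 < C2 &
  forall z xi, is_step z xi -> enorm xi <= eta0 ->
    enorm (G z) <= C2 * enorm xi /\ enorm (G (z + xi)) <= C1 * enorm xi ^+ 2].
Proof.
set al := 2 * beta * rho / gap.
have al0 : 0 < al by rewrite divr_gt0// !mulr_gt0.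
have kr := kr0.
(* for steps of length at most [eta0] the factor to be absorbed is at most [1 / 2] *)
set eta0 := Num.min 1 (2 * al)^-1.
set C2 := 2 * (L + beta * L ^+ 2 + kappa * rho).
have C20 : 0 < C2.
  by rewrite mulr_gt0// addr_gt0// addr_gt0// mulr_gt0// exprn_gt0.
set D := (1 + beta * L) * (rho / 2) + kappa * rho.
have D0 : 0 < D.
  by rewrite addr_gt0// mulr_gt0 ?divr_gt0// addr_gt0// mulr_gt0.
exists eta0, (2 * (D + al * C2)), C2; split=> //.
- by rewrite lt_min ltr01 invr_gt0 mulr_gt0.
- by rewrite mulr_gt0// addr_gt0// mulr_gt0.
move=> z xi hs he.
have e1 : enorm xi <= 1 by rewrite (le_trans he)// ge_min lexx.
have e2 : al * enorm xi <= 2^-1.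
  have : enorm xi <= (2 * al)^-1 by rewrite (le_trans he)// ge_min lexx orbT.
  by rewrite invfM -ler_pdivlMl// mulrC.
have e0 := enorm_ge0 xi.
have ha y : 2 * beta * rho * a y <= al * enorm (G y).
  have := grad_y_le y; rewrite /al ler_pdivlMr// mulrC => hy.
  rewrite -!mulrA ler_pM2l// ler_pM2l// ler_pM2l//.
  by rewrite ler_pdivlMl// mulrC.
have hG : enorm (G z) <= C2 * enorm xi.
  have := step_grad hs; have := ler_wpM2r e0 (ha z).
  have := ler_wpM2r (enorm_ge0 (G z)) e2.
  have : kappa * rho * enorm xi * enorm xi <= kappa * rho * enorm xi.
    by rewrite ler_piMr// mulr_ge0// ltW.
  rewrite /C2; move: (G z) (P *m g z) => Gz az; lra.
split=> //.
have := step_grad_next hs; have := ha (z + xi); have := ha z; move: hG.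
move: (G (z + xi)) (G z) (P *m g (z + xi)) (P *m g z) => G1 G0 a1 a0 hG h0 h1.
have := ler_wpM2r e0 h0; have := ler_wpM2r e0 h1.
have := ler_wpM2r (enorm_ge0 G1) e2; have := ler_wpM2l (ltW al0) (ler_wpM2r e0 hG).
have : 0 <= D * enorm xi ^+ 2 by rewrite mulr_ge0 ?exprn_ge0// ltW.
have : 0 <= al * C2 * enorm xi ^+ 2 by rewrite mulr_ge0 ?exprn_ge0// mulr_ge0 ?ltW.
by rewrite -/D; move: (enorm G1) (enorm G0) (enorm a1) (enorm a0) => *; lra.
Qed.

(** ** Second-order critical limits *)

Section Critical.
Context (zs : 'cV[R]_(n + m)) (Gzs : G zs = 0).

Lemma critical_grad : g zs = 0.
Proof.
have [K _ hK] := coercive_full; apply: enorm_eq0; apply: le_anti.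
by rewrite enorm_ge0 andbT (le_trans (hK zs _))// -grad_h_reg Gzs enorm0 mulr0.
Qed.

Lemma critical_a : a zs = 0.
Proof. by rewrite critical_grad mulmx0 enorm0. Qed.

Lemma critical_h : h zs = f zs.
Proof. by rewrite h_regE critical_a expr0n /= mulr0 addr0. Qed.

Lemma a_le_dist e : a (zs + e) <= L * enorm e.
Proof.
rewrite (le_trans (enorm_Pmx_le _))//.
by have := sa_grad_lipschitz hf zs e; rewrite critical_grad subr0.
Qed.

Lemma G_linearization e : enorm (G (zs + e) - Hbar beta f zs *m e)
  <= ((1 + beta * L) * (rho / 2) + beta * rho * L) * enorm e ^+ 2.
Proof.
have := G_taylor zs e; rewrite Gzs subr0 => /le_trans; apply.
have br : 0 <= beta * rho * enorm e by rewrite mulr_ge0// ltW// mulr_gt0.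
by have := ler_wpM2l br (a_le_dist e); move: (P *m g (zs + e)) => a1; lra.
Qed.

(** The step is compared with the displacement [- e] to the limit: with [N] the
    regularized model matrix, [N (xi + e)] is of order [e ^+ 2 + |xi| * e], whereas
    [N] is bounded below by [kappa * rho * |xi| - K * e] because its value at the
    limit is positive semidefinite. *)
Lemma step_le_dist : psd (Hbar beta f zs) ->
  exists2 C, 0 < C & forall e xi, is_step (zs + e) xi -> enorm xi <= C * enorm e.
Proof.
move=> hpsd.
have kr := kr0.
set K1 := rho + 2 * beta * L * rho.
set K2 := (1 + beta * L) * (rho / 2).
have K10 : 0 < K1 by rewrite addr_gt0// !mulr_gt0.
have K20 : 0 < K2 by rewrite mulr_gt0 ?divr_gt0// addr_gt0// mulr_gt0.
set C := 4 + 2 * (2 * K1 + K2) / (kappa * rho).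
have C4 : 4 <= C by rewrite lerDl divr_ge0 ?(ltW kr)// mulr_ge0// !addr_ge0 ?ltW// mulr_gt0.
exists C; first by apply: lt_le_trans C4.
move=> e xi hs; rewrite leNgt; apply/negP => lt_e.
set t := enorm xi in lt_e *; set s := enorm e in lt_e *.
have s0 : 0 <= s by exact: enorm_ge0.
have [E _] := step_optimality hs.
have c0 : kappa * rho * t <= 2 * beta * rho * a (zs + e) + kappa * rho * t.
  by rewrite lerDr mulr_ge0// mulr_ge0 ?(ltW rho0)// mulr_ge0// ltW.
pose w := xi + e.
have hR : enorm (G (zs + e) + Hbar beta f (zs + e) *m (- e)) <= K2 * s ^+ 2.
  have := G_taylor (zs + e) (- e); rewrite addrK critical_a Gzs mulr0 addr0 enormN.
  by rewrite sub0r -opprD enormN.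
have low := Hbar_lip zs e w w; have := hpsd w.
move: (Hbar beta f (zs + e)) (Hbar beta f zs) (G (zs + e)) (a (zs + e)) E c0 hR low.
move=> B1 B0 G1 a1; rewrite -/t; set c := _ + kappa * rho * t => E c0 hR low pw.
have {low pw}low : - (K1 * s) * enorm w ^+ 2 <= dotp w (B1 *m w).
  by move: low; rewrite ler_norml => /andP[h1 _]; rewrite /K1 /s expr2; lra.
have EN : B1 *m w + c *: w = - (G1 + B1 *m (- e)) + c *: e.
  rewrite /w mulmxDr scalerDr mulmxN; apply/colP => i; move/colP/(_ i): E.
  by rewrite !mxE; lra.
have up : dotp w (B1 *m w) + c * enorm w ^+ 2
    <= enorm w * (K2 * s ^+ 2 + c * s).
  have -> : dotp w (B1 *m w) + c * enorm w ^+ 2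
      = dotp w (B1 *m w + c *: w).
    by rewrite dotpDr dotpZr -enorm_sqr.
  rewrite EN (le_trans (dotp_le _ _))// ler_wpM2l// (le_trans (enormD _ _))//.
  rewrite enormN lerD// enormZ ger0_norm//.
  exact: le_trans (mulr_ge0 (ltW kr) (enorm_ge0 xi)) c0.
have t0 : 0 < t.
  by rewrite (le_lt_trans _ lt_e)// mulr_ge0// (le_trans _ C4).
have ts : 4 * s < t by rewrite (le_lt_trans _ lt_e)// ler_wpM2r.
have hw : t - s <= enorm w.
  by have := enormB w e; rewrite /w addrK -/t -/s; lra.
have w0 : 0 < enorm w by rewrite (lt_le_trans _ hw)//; lra.
set W := enorm w in low up hw w0.
have main : (c - K1 * s) * W <= K2 * s ^+ 2 + c * s.
  by rewrite -(ler_pM2l w0); move: low up; rewrite expr2; lra.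
have W2 : W <= 2 * t by have := enormD xi e; rewrite -/w -/W -/t -/s; lra.
have m1 : kappa * rho * t * (t / 2) <= c * (W - s).
  by apply: ler_pM => //; [rewrite mulr_ge0// ltW|rewrite divr_ge0// ltW|lra].
have m2 : K1 * s * W <= K1 * s * (2 * t).
  by rewrite ler_wpM2l// mulr_ge0// ltW.
have m3 : K2 * s ^+ 2 <= K2 * s * t.
  by rewrite expr2 mulrA; apply: ler_wpM2l; [rewrite mulr_ge0// ltW|lra].
have m4 : (kappa * rho * t) / 2 <= (2 * K1 + K2) * s.
  by rewrite -(ler_pM2l t0); move: main m1 m2 m3; lra.
have m5 : t <= 2 * (2 * K1 + K2) / (kappa * rho) * s.
  by rewrite mulrAC ler_pdivlMr//; move: m4; lra.
by move: lt_e; rewrite /C mulrDl; lra.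
Qed.

End Critical.
End Regularized.

(** * Rates of convergence under a Kurdyka-Lojasiewicz inequality *)

Section PowerInequalities.
Context {R : realType}.
Implicit Types (a b p s t x : R).

Lemma le_powR x y p : 0 <= p -> 0 <= x -> x <= y -> x `^ p <= y `^ p.
Proof.
by move=> p0 x0 xy; apply: ge0_ler_powR => //; rewrite nnegrE// (le_trans x0).
Qed.

Lemma powR_tangent t s : 0 <= t -> 0 < s < 1 -> t `^ s <= 1 + s * (t - 1).
Proof.
move=> t0 /andP[s0 s1]; have [->|tn0] := eqVneq t 0.
  by rewrite powR0 ?gt_eqF//; lra.
have tp : 0 < t by rewrite lt_neqAle eq_sym tn0.
set x := ln t; have tE : t = expR x by rewrite lnK.
rewrite tE -expRM.
have h1 := expR_ge1Dx ((1 - s) * x); have h2 := expR_ge1Dx (- (s * x)).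
have e0 : 0 < expR (x * s) by exact: expR_gt0.
have E1 : expR x = expR (x * s) * expR ((1 - s) * x) by rewrite -expRD; congr expR; ring.
have E2 : 1 = expR (x * s) * expR (- (s * x)) by rewrite -expRD mulrC subrr expR0.
have k1 := ler_wpM2l (ltW e0) h1; have k2 := ler_wpM2l (ltW e0) h2.
rewrite -E1 in k1; rewrite -E2 in k2.
have s1' : 0 <= 1 - s by lra.
have := lerD (ler_wpM2l (ltW s0) k1) (ler_wpM2l s1' k2).
lra.
Qed.

(** Concavity of [t `^ (1 - s)], in the form used with desingularizing functions. *)
Lemma powR_concave_diff a b s : 0 < s < 1 -> 0 <= b <= a ->
  (1 - s) * (a - b) <= a `^ s * (a `^ (1 - s) - b `^ (1 - s)).
Proof.
move=> /andP[s0 s1] /andP[b0 ba].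
have [a0|an0] := eqVneq a 0.
  have -> : b = 0 by apply/eqP; rewrite eq_le b0 -a0 ba.
  by rewrite a0 !subrr !mulr0.
have ap : 0 < a by rewrite lt_neqAle eq_sym an0 (le_trans b0).
have h := @powR_tangent (b / a) (1 - s).
have bE : b `^ (1 - s) = a `^ (1 - s) * (b / a) `^ (1 - s).
  by rewrite -powRM ?divr_ge0 ?(ltW ap)// mulrC divfK.
have aE : a `^ s * a `^ (1 - s) = a.
  rewrite -powRD ?an0 ?implybT// addrC subrK powRr1// ltW//.
have -> : a `^ s * (a `^ (1 - s) - b `^ (1 - s)) = a * (1 - (b / a) `^ (1 - s)).
  rewrite bE (_ : _ * _ = (a `^ s * a `^ (1 - s)) * (1 - (b / a) `^ (1 - s))); last by ring.
  by rewrite aE.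
have := h (divr_ge0 b0 (ltW ap)); rewrite subr_gt0 s1 ltrBlDr ltrDl s0 => /(_ isT).
rewrite -(ler_pM2l ap) => {}h.
have E : a * (b / a) = b by rewrite mulrC divfK.
move: h; rewrite !mulrDr mulr1 => h.
have : a * ((1 - s) * (b / a - 1)) = (1 - s) * (a * (b / a) - a) by ring.
by rewrite E; lra.
Qed.

(** The arithmetic-geometric inequality for [y], [y] and [w]. *)
Lemma amgm3 x y w : 0 <= x -> 0 <= y -> 0 <= w -> x ^+ 3 <= y ^+ 2 * w ->
  3 * x <= 2 * y + w.
Proof.
move=> x0 y0 w0 h; rewrite leNgt; apply/negP => lt.
have h1 : 0 <= (w - y) ^+ 2 * (w + 8 * y) by rewrite mulr_ge0 ?sqr_ge0// addr_ge0// mulr_ge0.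
have h2 : (2 * y + w) ^+ 3 < (3 * x) ^+ 3.
  by rewrite ltrXn2r// ?nnegrE ?addr_ge0 ?mulr_ge0.
by move: h h1 h2; rewrite !exprS !expr0; nra.
Qed.

Lemma cubeK x : 0 <= x -> (x ^+ 3) `^ 3^-1 = x.
Proof.
by move=> x0; rewrite -powR_mulrn// -powRrM mulfV ?pnatr_eq0// powRr1.
Qed.

Lemma powR_invK x p : 0 <= x -> p != 0 -> (x `^ p) `^ p^-1 = x.
Proof. by move=> x0 p0; rewrite -powRrM mulfV// powRr1. Qed.

End PowerInequalities.

Section KL_sequences.
Context {R : realType} (r eta dist : nat -> R) (theta c K del : R) (k0 : nat).
Context (theta01 : 0 < theta < 1) (c_gt0 : 0 < c) (K_gt0 : 0 < K) (del_gt0 : 0 < del).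
Context (r_ge0 : forall k, 0 <= r k) (eta_ge0 : forall k, 0 <= eta k)
  (dist_ge0 : forall k, 0 <= dist k).
Context (decrease : forall k, r k.+1 + c * eta k ^+ 3 <= r k).
Context (dist_up : forall k, dist k.+1 <= dist k + eta k)
  (dist_down : forall k, dist k <= dist k.+1 + eta k).
Context (kl : forall k, (k0 <= k)%N -> dist k.+1 <= del ->
  r k.+1 `^ theta <= K * eta k ^+ 2).
Context (recurs : forall e n, 0 < e -> exists2 k, (n <= k)%N & dist k < e /\ r k < e).

Lemma r_step_le k : r k.+1 <= r k.
Proof.
by apply: le_trans (decrease k); rewrite lerDl mulr_ge0 ?exprn_ge0// ltW.
Qed.

Lemma r_nonincr j k : (j <= k)%N -> r k <= r j.
Proof.
move=> /subnK <-; elim: (k - j)%N => [//|i IH]; rewrite addSn.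
exact: le_trans (r_step_le _) IH.
Qed.

Lemma r_to0 e : 0 < e -> exists k1, forall k, (k1 <= k)%N -> r k < e.
Proof.
move=> e0; have [k1 _ [_ h]] := recurs 0 e0.
by exists k1 => k /r_nonincr /le_lt_trans; apply.
Qed.

Lemma eta_le_r k : eta k <= (r k / c) `^ 3^-1.
Proof.
rewrite -{1}(cubeK (eta_ge0 k)); apply: le_powR; rewrite ?invr_ge0 ?exprn_ge0//.
rewrite ler_pdivlMr// mulrC; apply: le_trans (decrease k).
by rewrite lerDr.
Qed.

Lemma powR_small (s e : R) : 0 < s -> 0 < e -> exists2 d, 0 < d &
  forall x, 0 <= x < d -> x `^ s < e.
Proof.
move=> s0 e0; exists (e `^ s^-1); first exact: powR_gt0.
move=> x /andP[x0 xd].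
rewrite -[e](powR_invK (ltW e0) (_ : s^-1 != 0)) ?invr_eq0 ?gt_eqF// invrK.
by rewrite gt0_ltr_powR// nnegrE ?powR_ge0.
Qed.

Lemma eta_to0 e : 0 < e -> exists k1, forall k, (k1 <= k)%N -> eta k < e.
Proof.
move=> e0; have [d d0 hd] := @powR_small 3^-1 e ltac:(by rewrite invr_gt0) e0.
have [k1 h1] := r_to0 (mulr_gt0 d0 c_gt0).
exists k1 => k /h1 rk; apply: le_lt_trans (eta_le_r k) (hd _ _).
by rewrite divr_ge0 ?(ltW c_gt0)//= ltr_pdivrMr.
Qed.

Let K' := K / (c * (1 - theta)).
Let V k := K' * r k.+1 `^ (1 - theta) + 2 * eta k.

Let theta_gt0 : 0 < theta. Proof. by case/andP: theta01. Qed.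
Let theta_lt1 : 0 < 1 - theta. Proof. by case/andP: theta01 => _ h; rewrite subr_gt0. Qed.
Let K'_gt0 : 0 < K'. Proof. by rewrite divr_gt0// mulr_gt0. Qed.

Lemma V_ge0 k : 0 <= V k.
Proof.
apply: addr_ge0; apply: mulr_ge0 => //; [exact: ltW|exact: powR_ge0].
Qed.

Lemma V_to0 e : 0 < e -> exists k1, forall k, (k1 <= k)%N -> V k < e.
Proof.
move=> e0; have e2 : 0 < e / 2 / K' by apply: divr_gt0 => //; exact: divr_gt0.
have [d d0 hd] := powR_small theta_lt1 e2.
have [k1 h1] := r_to0 d0.
have e4 : 0 < e / 4 by rewrite divr_gt0.
have [k2 h2] := eta_to0 e4.
exists (maxn k1 k2) => k; rewrite geq_max => /andP[kk1 kk2].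
have := hd (r k.+1); rewrite r_ge0 h1 ?(leq_trans kk1)// => /(_ isT).
rewrite ltr_pdivlMr// mulrC => h3; have := h2 _ kk2; rewrite /V; lra.
Qed.

(** The step [eta k.+1] is cubically bounded by the decrease of [r], the decrease of [r]
    by that of [r `^ (1 - theta)] and [eta k ^+ 2] through concavity and the inequality
    [kl]; [amgm3] then splits off two thirds of [eta k], which telescopes. *)
Lemma potential k : (k0 <= k)%N -> dist k.+1 <= del -> eta k.+1 <= V k - V k.+1.
Proof.
move=> kk hd; have hkl := kl kk hd.
have r12 : 0 <= r k.+2 <= r k.+1 by rewrite r_ge0 r_step_le.
have h1 := powR_concave_diff theta01 r12.
set D := r k.+1 `^ (1 - theta) - r k.+2 `^ (1 - theta) in h1.
have D0 : 0 <= D by rewrite subr_ge0 le_powR ?(ltW theta_lt1)//; case/andP: r12.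
have h2 : eta k.+1 ^+ 3 <= eta k ^+ 2 * (K' * D).
  have h3 : c * eta k.+1 ^+ 3 <= r k.+1 - r k.+2 by have := decrease k.+1; lra.
  have h4 := ler_wpM2l (ltW theta_lt1) h3.
  have h5 := le_trans h4 (le_trans h1 (ler_wpM2r D0 hkl)).
  have c1 : 0 < c * (1 - theta) by rewrite mulr_gt0.
  rewrite -(ler_pM2l c1).
  have -> : c * (1 - theta) * (eta k ^+ 2 * (K' * D)) = K * eta k ^+ 2 * D.
    by rewrite /K'; field; rewrite !gt_eqF.
  by apply: le_trans h5; rewrite le_eqVlt; apply/orP; left; apply/eqP; ring.
have KD0 : 0 <= K' * D by rewrite mulr_ge0// ltW.
have := amgm3 (eta_ge0 k.+1) (eta_ge0 k) KD0 h2.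
by rewrite /V /D; lra.
Qed.

(** Once the iterate is close to the limit and [V] is small, [V] pays for all later
    steps, so the sequence cannot leave the neighbourhood where [kl] applies. *)
Lemma trap e : 0 < e -> e <= del -> exists2 k1, (k0 <= k1)%N &
  forall k, (k1 <= k)%N -> dist k.+1 + V k < e.
Proof.
move=> e0 ed; have e2 : 0 < e / 2 by rewrite divr_gt0.
have [k2 h2] := V_to0 e2.
have [[//|k3] h3 [h4 _]] := recurs (maxn k0 k2).+1 e2.
move: h3; rewrite ltnS geq_max => /andP[le0 le2].
exists k3 => // k /subnK <-; elim: (k - k3)%N => [|i IH].
  by rewrite add0n; have := h2 _ le2; lra.
rewrite addSn; set j := (i + k3)%N in IH *.
have jk : (k0 <= j)%N by rewrite (leq_trans le0)// leq_addl.
have Vj := V_ge0 j.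
have := potential jk; have := dist_up j.+1.
have dj : dist j.+1 <= del by lra.
by move=> h /(_ dj); lra.
Qed.

Lemma dist_to0 e : 0 < e -> exists k1, forall k, (k1 <= k)%N -> dist k < e.
Proof.
move=> e0; have m0 : 0 < Num.min e del by rewrite lt_min e0.
have [|k1 _ h] := trap m0; first by rewrite ge_min lexx orbT.
exists k1.+1 => -[//|k]; rewrite ltnS => /h.
have := V_ge0 k; have : Num.min e del <= e by rewrite ge_min lexx.
lra.
Qed.

(** The sum of the later steps is at most [V k], and some later iterate is arbitrarily
    close to the limit. *)
Lemma kl_eventually : exists2 k1, (k0 <= k1)%N & forall k, (k1 <= k)%N ->
  r k.+1 `^ theta <= K * eta k ^+ 2 /\ dist k.+1 <= V k.
Proof.
have [k1 k01 h1] := trap del_gt0 (lexx _).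
have hd k : (k1 <= k)%N -> dist k.+1 <= del.
  by move=> /h1; have := V_ge0 k; lra.
exists k1 => // k kk; split; first by apply: kl (hd _ kk); exact: leq_trans k01 kk.
apply/ler_addgt0Pl => e e0; rewrite addrC -lerBlDl.
have [k2 h2] := dist_to0 e0.
have mono i : dist k.+1 - V k <= dist (i + k).+1 - V (i + k).
  elim: i => [//|i IH]; apply: le_trans IH _; rewrite addSn.
  set j := (i + k)%N.
  have kj : (k1 <= j)%N by rewrite (leq_trans kk)// leq_addl.
  have := potential (leq_trans k01 kj) (hd _ kj); have := dist_down j.+1; lra.
have := mono k2; have := V_ge0 (k2 + k)%N; have := h2 (k2 + k).+1.
by rewrite leqW ?leq_addr// => /(_ isT); lra.
Qed.

(** The first term comes from [eta_le_r]. Which of the two powers dominates depends on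
    the position of [theta] with respect to [2 / 3], hence the next two lemmas. *)
Lemma dist_le_gap : exists k1, forall k, (k1 <= k)%N ->
  dist k <= 3 * (r k / c) `^ 3^-1 + K' * r k `^ (1 - theta).
Proof.
have [k1 _ h1] := kl_eventually; exists k1 => k kk.
have [_ h2] := h1 _ kk; have h3 := eta_le_r k; have := dist_down k.
have h4 : K' * r k.+1 `^ (1 - theta) <= K' * r k `^ (1 - theta).
  by rewrite ler_pM2l// le_powR ?(ltW theta_lt1)// r_step_le.
by move: h2; rewrite /V; lra.
Qed.

Lemma dist_le_cbrt : theta <= 2 / 3 -> exists2 C, 0 < C &
  exists k1, forall k, (k1 <= k)%N -> dist k <= C * r k `^ 3^-1.
Proof.
move=> th; have [k1 h1] := dist_le_gap; have [k2 h2] := r_to0 ltr01.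
have ci : 0 < c^-1 `^ 3^-1 by rewrite powR_gt0// invr_gt0.
exists (3 * c^-1 `^ 3^-1 + K'); first by rewrite addr_gt0// mulr_gt0.
exists (maxn k1 k2) => k; rewrite geq_max => /andP[kk1 kk2].
apply: le_trans (h1 _ kk1) _; rewrite [leRHS]mulrDl lerD//.
  by rewrite powRM ?invr_ge0 ?(ltW c_gt0)// mulrAC mulrA.
rewrite ler_pM2l//; have [->|r0] := eqVneq (r k) 0.
  by rewrite !powR0 ?invr_eq0 ?pnatr_eq0 ?gt_eqF.
apply: ger_powR; last by have := th; lra.
by rewrite lt_neqAle eq_sym r0 r_ge0 ltW// h2.
Qed.

Lemma dist_le_power : 2 / 3 <= theta -> exists2 C, 0 < C &
  exists k1, forall k, (k1 <= k)%N -> dist k <= C * r k `^ (1 - theta).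
Proof.
move=> th; have [k1 h1] := dist_le_gap; have [k2 h2] := r_to0 ltr01.
have ci : 0 < c^-1 `^ 3^-1 by rewrite powR_gt0// invr_gt0.
exists (3 * c^-1 `^ 3^-1 + K'); first by rewrite addr_gt0// mulr_gt0.
exists (maxn k1 k2) => k; rewrite geq_max => /andP[kk1 kk2].
apply: le_trans (h1 _ kk1) _; rewrite [leRHS]mulrDl lerD2r.
rewrite powRM ?invr_ge0 ?(ltW c_gt0)// [r k `^ _ * _]mulrC mulrA ler_wpM2l//.
  by rewrite mulr_ge0// ltW.
have [->|r0] := eqVneq (r k) 0.
  by rewrite !powR0 ?invr_eq0 ?pnatr_eq0 ?gt_eqF.
apply: ger_powR; last by have := th; lra.
by rewrite lt_neqAle eq_sym r0 r_ge0 ltW// h2.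
Qed.

(** [r k.+1 `^ 3^-1] is [r k.+1 `^ theta] raised to [1 / (3 * theta)], and
    [r k.+1 `^ theta] is of order [eta k ^+ 2], hence of order [dist k ^+ 2]. *)
Lemma dist_le_order C3 : theta <= 2 / 3 -> 0 < C3 -> (forall k, eta k <= C3 * dist k) ->
  exists2 C, 0 < C & exists k1, forall k, (k1 <= k)%N ->
    dist k.+1 <= C * dist k `^ (2 / (3 * theta)).
Proof.
move=> th C30 hstep; have [C C0 [k1 h1]] := dist_le_cbrt th.
have [k2 _ h2] := kl_eventually.
have t3 : 3 * theta != 0 by rewrite mulf_neq0 ?gt_eqF.
have p0 : 0 < (3 * theta)^-1 by rewrite invr_gt0 mulr_gt0.
exists (C * (K * C3 ^+ 2) `^ (3 * theta)^-1).
  by rewrite mulr_gt0// powR_gt0// mulr_gt0// exprn_gt0.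
exists (maxn k1 k2) => k; rewrite geq_max => /andP[kk1 kk2].
apply: le_trans (h1 k.+1 (leqW kk1)) _; rewrite -mulrA ler_pM2l//.
have -> : r k.+1 `^ 3^-1 = (r k.+1 `^ theta) `^ (3 * theta)^-1.
  by rewrite -powRrM; congr (_ `^ _); field; rewrite gt_eqF.
rewrite powRrM powR_mulrn// -powRM ?mulr_ge0 ?exprn_ge0 ?(ltW K_gt0) ?(ltW C30)//.
apply: le_powR; rewrite ?powR_ge0 ?(ltW p0)//.
have [h3 _] := h2 _ kk2; apply: le_trans h3 _.
rewrite -mulrA ler_pM2l// -exprMn lerXn2r ?nnegrE ?mulr_ge0 ?(ltW C30)//.
Qed.

End KL_sequences.

Section Sublinear.
Context {R : realType}.

Lemma powR_ratio (q : R) k : 0 < q -> (0 < k)%N ->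
  k%:R `^ (- q) - k.+1%:R `^ (- q) <= k.+1%:R `^ (- q) * (2 * q * expR q / k.+1%:R).
Proof.
move=> q0 k0; have kR : 0 < k%:R :> R by rewrite ltr0n.
have k1R : 0 < k.+1%:R :> R by rewrite ltr0n.
set x := (k%:R : R)^-1.
have x0 : 0 < x by rewrite invr_gt0.
have x1 : x <= 1 by rewrite invf_le1// ler1n.
have E : k%:R `^ (- q) = k.+1%:R `^ (- q) * (1 + x) `^ q :> R.
  have -> : 1 + x = k.+1%:R / k%:R by rewrite -natr1 mulrDl mulfV ?gt_eqF// mul1r.
  rewrite powRM ?invr_ge0 ?(ltW kR) ?(ltW k1R)// !powRN mulrA mulVf ?mul1r ?gt_eqF ?powR_gt0//.
  by rewrite -[in RHS]powR_inv1 ?(ltW kR)// -powRrM mulN1r powRN.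
rewrite E -[X in _ - X]mulr1 -mulrBr ler_pM2l ?powR_gt0//.
have h1 : (1 + x) `^ q <= expR (q * x).
  rewrite mulrC expRM; apply: le_powR; [exact: ltW| |exact: expR_ge1Dx].
  by rewrite addr_ge0// ltW.
have h2 : expR (q * x) - 1 <= q * x * expR (q * x).
  have := expR_ge1Dx (- (q * x)).
  rewrite -(ler_pM2r (expR_gt0 (q * x))) -expRD addNr expR0; lra.
have h3 : expR (q * x) <= expR q by rewrite ler_expR ger_pMr.
have h4 : x <= 2 / k.+1%:R.
  rewrite /x -[_^-1]mul1r ler_pdivrMr// mulrAC ler_pdivlMr// mul1r -natrM ler_nat.
  by rewrite mul2n -addnn -addn1 leq_add2l.
have h5 : q * x * expR (q * x) <= q * (2 / k.+1%:R) * expR q.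
  by apply: ler_pM; rewrite ?expR_ge0 ?mulr_ge0 ?(ltW q0) ?(ltW x0)// ler_pM2l.
have -> : 2 * q * expR q / k.+1%:R = q * (2 / k.+1%:R) * expR q by ring.
by apply: le_trans h5; apply: le_trans h2; rewrite lerD2r.
Qed.

(** Discrete comparison with the solution [k `^ (- q)], [q = 1 / (gam - 1)], of
    [u' = - u `^ gam]. *)
Lemma sublinear_decay (u : nat -> R) (gam q B : R) k0 : 1 < gam -> q * (gam - 1) = 1 ->
  0 < B -> (forall k, 0 <= u k) ->
  (forall k, (k0 <= k)%N -> u k.+1 `^ gam <= B * (u k - u k.+1)) ->
  exists2 A, 0 < A & exists k1, forall k, (k1 <= k)%N -> u k <= A * k%:R `^ (- q).
Proof.
move=> g1 qg B0 u0 hu.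
have gm0 : 0 < gam - 1 by rewrite subr_gt0.
have q0 : 0 < q by rewrite -(pmulr_lgt0 _ gm0) qg.
(* [A1] makes a violation of the bound incompatible with the recursion, by [powR_ratio];
   the maximum with the value at [k1] starts the induction *)
set k1 := k0.+1; set A1 := (2 * B * q * expR q + 1) `^ q.
have b0 : 0 < 2 * B * q * expR q + 1.
  by rewrite ltr_wpDl// !mulr_ge0 ?expR_ge0// ltW.
have A10 : 0 < A1 by rewrite powR_gt0.
have k1q : 0 < k1%:R `^ q :> R by rewrite powR_gt0// ltr0n.
set A := Num.max A1 (u k1 * k1%:R `^ q).
have A0 : 0 < A by rewrite lt_max A10.
exists A => //; exists k1 => k /subnK <-; elim: (k - k1)%N => [|i IH].
  rewrite add0n powRN ler_pdivlMr//.
  by rewrite /A le_max lexx orbT.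
rewrite addSn; set j := (i + k1)%N in IH *.
have j0 : (0 < j)%N by rewrite /j /k1 addnS.
have jk : (k0 <= j)%N by rewrite /j /k1 addnS ltnW// ltnS leq_addl.
rewrite leNgt; apply/negP => lt.
have jR : 0 < j.+1%:R :> R by rewrite ltr0n.
have jq : 0 < j.+1%:R `^ (- q) :> R by rewrite powR_gt0.
have h1 := hu _ jk.
have h2 : A `^ gam * (j.+1%:R `^ (- q) / j.+1%:R) <= u j.+1 `^ gam.
  have -> : j.+1%:R `^ (- q) / j.+1%:R = (j.+1%:R `^ (- q)) `^ gam :> R.
    rewrite -powRrM (_ : - q * gam = - q + - 1); last by move: qg; lra.
    rewrite powRD; last by rewrite (gt_eqF jR) implybT.
    by rewrite powR_inv1// ltW.
  rewrite -powRM ?(ltW A0) ?(ltW jq)//; apply: le_powR => //; last exact: ltW.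
    by rewrite ltW// (lt_trans ltr01).
  by rewrite mulr_ge0// ltW.
have h3 : u j - u j.+1 <= A * (j%:R `^ (- q) - j.+1%:R `^ (- q)).
  by rewrite mulrBr lerB// ltW.
have h4 := ler_wpM2l (ltW A0) (powR_ratio q0 j0).
have h5 := le_trans h2 (le_trans h1 (ler_wpM2l (ltW B0) (le_trans h3 h4))).
have h6 : A `^ (gam - 1) <= 2 * B * q * expR q.
  have w0 : 0 < A * (j.+1%:R `^ (- q) / j.+1%:R) by rewrite mulr_gt0// divr_gt0.
  rewrite -(ler_pM2l w0) mulrAC mulr_powRB1 ?(ltW A0) ?(lt_trans ltr01)//.
  by apply: le_trans h5 _; rewrite le_eqVlt; apply/orP; left; apply/eqP; ring.
have h7 : 2 * B * q * expR q + 1 <= A `^ (gam - 1).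
  have -> : 2 * B * q * expR q + 1 = A1 `^ (gam - 1).
    by rewrite -powRrM qg powRr1// ltW.
  apply: le_powR; rewrite ?(ltW gm0) ?(ltW A10)//.
  by rewrite /A le_max lexx.
lra.
Qed.

End Sublinear.

(** * Critical values of a cubic form on a sphere *)

Section Derivations.
Context {R : realType}.

(** [D] is a derivation of [B] into the reals, seen as a [B]-module through [phi];
    the last clause says that it factors through the subring [phi B]. *)
Definition derivation_along (B : idomainType) (phi : {rmorphism B -> R}) (D : B -> R) :=
  [/\ forall x y, D (x + y) = D x + D y,
      forall x y, D (x * y) = phi x * D y + D x * phi y
    & forall x, phi x = 0 -> D x = 0].

Section Theory.
Context (B : idomainType) (phi : {rmorphism B -> R}) (D : B -> R).
Context (hD : derivation_along phi D).

Lemma derivation0 : D 0 = 0.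
Proof. by case: hD => _ _; apply; rewrite rmorph0. Qed.

Lemma derivationN x : D (- x) = - D x.
Proof.
by case: hD => hA _ _; apply/eqP; rewrite -addr_eq0 -hA addNr derivation0.
Qed.

Lemma derivation_sum I (s : seq I) (F : I -> B) :
  D (\sum_(i <- s) F i) = \sum_(i <- s) D (F i).
Proof. by case: hD => hA _ _; apply: (big_morph D hA derivation0). Qed.

(** A derivation that kills the kernel of [phi] is a function on the image; relations
    between real numbers can thus be differentiated. *)
Lemma derivation_wd x y : phi x = phi y -> D x = D y.
Proof.
case: hD => hA _ hK h; apply/eqP; rewrite -subr_eq0 -derivationN -hA; apply/eqP.
by apply: hK; rewrite rmorphB h subrr.
Qed.

Definition eval_at (a : R) (p : {poly B}) : R := (map_poly phi p).[a].

Lemma eval_at_is_monoid_morphism a : monoid_morphism (eval_at a).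
Proof. by split=> [|p q]; rewrite /eval_at ?rmorph1 ?hornerC// rmorphM hornerM. Qed.

Lemma eval_at_is_zmod_morphism a : zmod_morphism (eval_at a).
Proof. by move=> p q; rewrite /eval_at rmorphB hornerD hornerN. Qed.

Lemma eval_atC a b : eval_at a b%:P = phi b.
Proof. by rewrite /eval_at map_polyC hornerC. Qed.

Lemma eval_atX a : eval_at a 'X = a.
Proof. by rewrite /eval_at map_polyX hornerX. Qed.

Lemma map_derivationM p q :
  map_poly D (p * q) = map_poly phi p * map_poly D q + map_poly D p * map_poly phi q.
Proof.
have [hA hM _] := hD.
apply/polyP => i; rewrite coef_map_id0 ?derivation0// coefM derivation_sum.
rewrite coefD !coefM -big_split /=; apply: eq_bigr => j _.
by rewrite hM !coef_map !coef_map_id0 ?derivation0.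
Qed.

Lemma map_derivationD p q : map_poly D (p + q) = map_poly D p + map_poly D q.
Proof.
have [hA _ _] := hD.
by apply/polyP => i; rewrite coefD !coef_map_id0 ?derivation0// coefD hA.
Qed.

(** The candidate extension to [B[a]] sending [a] to [s]. *)
Definition extend (a s : R) (p : {poly B}) : R :=
  (map_poly D p).[a] + (map_poly phi p)^`().[a] * s.

Lemma extendD a s p q : extend a s (p + q) = extend a s p + extend a s q.
Proof. by rewrite /extend map_derivationD rmorphD derivD !hornerD; ring. Qed.

Lemma extendM a s p q :
  extend a s (p * q) = eval_at a p * extend a s q + extend a s p * eval_at a q.
Proof.
by rewrite /extend /eval_at map_derivationM rmorphM derivM !hornerD !hornerM; ring.
Qed.

Lemma extendC a s b : extend a s b%:P = D b.
Proof.
rewrite /extend map_polyC derivC horner0 mul0r addr0.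
suff -> : map_poly D b%:P = (D b)%:P by rewrite hornerC.
apply/polyP => i; rewrite coef_map_id0 ?derivation0// !coefC.
by case: eqP => // _; rewrite derivation0.
Qed.

Lemma extend_map0 a s p : map_poly phi p = 0 -> extend a s p = 0.
Proof.
have [_ _ hK] := hD => p0.
rewrite /extend p0 deriv0 horner0 mul0r addr0.
suff -> : map_poly D p = 0 by rewrite horner0.
apply/polyP => i; rewrite coef_map_id0 ?derivation0// coef0 hK//.
by rewrite -coef_map p0 coef0.
Qed.

(** Either no polynomial over [phi B] vanishes at [a], and any image of [a] will do;
    or the image is forced by a vanishing polynomial of least size, whose
    derivative at [a] is nonzero in characteristic zero. *)
Lemma extend_kernel a : exists s, forall p, eval_at a p = 0 -> extend a s p = 0.
Proof.
have [hA hM hK] := hD.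
pose good n := `[< exists p : {poly B},
  [/\ size p = n, eval_at a p = 0 & map_poly phi p != 0] >].
have [[n gn]|ng] := pselect (exists n, good n); last first.
  exists 0 => p pa; apply: extend_map0; apply/eqP; apply: contrapT => /negP np.
  by apply: ng; exists (size p); apply/asboolP; exists p.
have [n0 gn' minn] := ex_minnP (ex_intro _ n gn).
have [P [szP Pa P0]] := asboolP _ gn'.
have small p : eval_at a p = 0 -> (size p < n0)%N -> map_poly phi p = 0.
  move=> pa ps; apply/eqP; apply: contraLR ps => np; rewrite -leqNgt.
  by apply: minn; apply/asboolP; exists p.
have dP : (map_poly phi P)^`().[a] != 0.
  apply/eqP => d0.
  have szd : (size P^`() < n0)%N.
    rewrite -szP lt_size_deriv//; apply: contra_neq P0 => ->; exact: map_poly0.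
  have : map_poly phi P^`() = 0 by apply: small; rewrite // /eval_at -deriv_map.
  rewrite -deriv_map => h.
  have sz1 : (size (map_poly phi P) <= 1)%N.
    apply/leq_sizeP => -[//|j] _.
    have /eqP := congr1 (fun q : {poly R} => q`_j) h.
    by rewrite coef_deriv coef0 mulrn_eq0 /= => /eqP.
  move/size1_polyC: sz1 => E; move: Pa P0; rewrite /eval_at E hornerC => ->.
  by rewrite eqxx.
exists (- ((map_poly D P).[a] / (map_poly phi P)^`().[a])).
set s := - _.
have EP : extend a s P = 0 by rewrite /extend /s mulrN mulrC divfK// subrr.
move=> p pa; set l := lead_coef P ^+ scalp p P.
have Pn0 : P != 0 by apply: contra_neq P0 => ->; rewrite map_poly0.
have E : l%:P * p = p %/ P * P + p %% P by rewrite mul_polyC Pdiv.Idomain.divp_eq.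
have ra : eval_at a (p %% P) = 0.
  have := congr1 (eval_at a) E; rewrite /eval_at !rmorphM rmorphD !rmorphM /=.
  rewrite hornerD !hornerM -/(eval_at a P) -/(eval_at a p) -/(eval_at a (p %% P)).
  by rewrite pa Pa !mulr0 add0r => <-.
have rE : extend a s (p %% P) = 0.
  by apply: extend_map0; apply: small => //; rewrite -szP ltn_modp.
have := congr1 (extend a s) E; rewrite extendD !extendM pa EP Pa rE !mulr0 !addr0.
rewrite eval_atC => /eqP; rewrite mulf_eq0 => /orP[|/eqP//].
rewrite rmorphXn expf_eq0 => /andP[_ /eqP lc0].
(* a vanishing leading coefficient would leave a smaller polynomial *)
exfalso; move/eqP: P0; apply.
pose Q := P - lead_coef P *: 'X^((size P).-1).
have QE : map_poly phi Q = map_poly phi P.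
  by rewrite /Q -mul_polyC rmorphB rmorphM /= map_polyC /= lc0 mul0r subr0.
rewrite -QE; apply: small; first by rewrite /eval_at QE.
rewrite -szP -[X in (_ < X)%N]prednK ?size_poly_gt0// ltnS.
apply/leq_sizeP => j; rewrite leq_eqVlt => /orP[/eqP <-|lt].
  by rewrite coefB coefZ coefXn eqxx mulr1 subrr.
rewrite coefB coefZ coefXn gtn_eqF// mulr0 subr0.
by apply: nth_default; rewrite -[size P]prednK ?size_poly_gt0.
Qed.

End Theory.

HB.instance Definition _ (B : idomainType) (phi : {rmorphism B -> R}) a :=
  GRing.isZmodMorphism.Build {poly B} R (eval_at phi a) (eval_at_is_zmod_morphism phi a).
HB.instance Definition _ (B : idomainType) (phi : {rmorphism B -> R}) a :=
  GRing.isMonoidMorphism.Build {poly B} R (eval_at phi a) (eval_at_is_monoid_morphism phi a).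

(** Iterating [extend_kernel]: every finite list of reals can be added to the domain of
    a derivation. *)
Lemma adjoin (B : idomainType) (phi : {rmorphism B -> R}) D (ws : seq R) :
  derivation_along phi D ->
  exists (B' : idomainType) (phi' : {rmorphism B' -> R}) (D' : B' -> R),
  [/\ derivation_along phi' D',
      forall w, w \in ws -> exists x, phi' x = w
    & forall x, exists y, phi' y = phi x /\ D' y = D x].
Proof.
elim: ws B phi D => [|w ws IH] B phi D hD.
  by exists B, phi, D; split=> // x; exists x.
have [s hs] := extend_kernel hD w.
have hD' : derivation_along (eval_at phi w) (extend phi D w s).
  split; [exact: extendD|exact: extendM|exact: hs].
have [B' [phi' [D' [h1 h2 h3]]]] := IH _ _ _ hD'.
exists B', phi', D'; split=> // [v|x].
  rewrite in_cons => /orP[/eqP ->|/h2//].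
  by have [y [hy _]] := h3 'X; exists y; rewrite hy; exact: eval_atX.
have [y [h4 h5]] := h3 x%:P; exists y.
by rewrite h4 h5; split; [exact: eval_atC|exact: extendC].
Qed.

(** Adjoining the constants one at a time as values of polynomials keeps the ring of
    representatives countable. *)
Lemma countable_subring (cs : seq R) :
  exists (B : countIdomainType) (phi : {rmorphism B -> R}),
  forall c, c \in cs -> exists x, phi x = c.
Proof.
elim: cs => [|c cs [B [phi h]]].
  by exists int, (intr : {rmorphism int -> R}).
exists {poly B}, (eval_at phi c) => v; rewrite in_cons => /orP[/eqP ->|/h [x <-]].
  by exists 'X; exact: eval_atX.
by exists x%:P; exact: eval_atC.
Qed.

(** A countable ring has countably many algebraic numbers, and an interval is not
    countable since its Lebesgue measure is positive. *)
Lemma exists_transcendental (B : countIdomainType) (phi : {rmorphism B -> R}) (a b : R) :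
  a < b -> exists2 t, a < t < b &
  forall p : {poly B}, eval_at phi t p = 0 -> map_poly phi p = 0.
Proof.
move=> ab; apply: contrapT => hn.
pose roots (p : {poly B}) : set R :=
  if map_poly phi p == 0 then set0 else [set t | root (map_poly phi p) t].
have cr p : countable (roots p).
  rewrite /roots; case: eqP => [_|/eqP p0]; first exact: countable0.
  apply: finite_set_countable; apply: contrapT => inf.
  have [X Xr szX] := infinite_set_fset (size (map_poly phi p)) inf.
  have Xroots : all (root (map_poly phi p)) (finmap.enum_fset X) by apply/allP => t /Xr.
  have := max_poly_roots p0 Xroots (finmap.fset_uniq X).
  by rewrite ltnNge szX.
have cU : countable (\bigcup_(p in [set: {poly B}]) roots p).
  by apply: bigcup_countable => //; exact: countableP.
have cI : countable [set` `]a, b[].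
  apply: sub_countable cU; apply: subset_card_le => t /=; rewrite in_itv /= => tI.
  apply: contrapT => ht; apply: hn; exists t => // p pt.
  apply/eqP; apply: contrapT => /negP p0; apply: ht; exists p => //.
  by rewrite /roots (negbTE p0) /=; apply/rootP.
have := countable_lebesgue_measure0 cI.
rewrite lebesgue_measure_itv /= lte_fin ab -EFinB => /eqP.
by rewrite eqe subr_eq0 gt_eqF.
Qed.

End Derivations.
Section Noncritical.
Context {R : realType} {N : nat}.

Definition trilinear (C : 'I_N -> 'I_N -> 'I_N -> R) (u v w : 'cV[R]_N) : R :=
  \sum_i \sum_j \sum_k C i j k * u i 0 * v j 0 * w k 0.

(** Sard's theorem for the cubic form [T w w w / 6] on the unit sphere of the kernel
    of [H]. A value [t] transcendental over the coefficients admits a derivation [D] of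
    a ring containing the coordinates of a point [w], with [D] zero on the
    coefficients and [D t = 1]. Then [D w] is tangent to the sphere and to the kernel,
    so at a critical point [6 * D t = 3 * T w w (D w) = 18 * t * dotp w (D w) = 0]. *)
Lemma exists_noncritical_value C (H : 'M[R]_N) (a b : R) : a < b ->
  (forall u v w, trilinear C u v w = trilinear C v u w) ->
  (forall u v w, trilinear C u v w = trilinear C u w v) ->
  exists2 t, a < t < b & forall w, dotp w w = 1 -> H *m w = 0 ->
    trilinear C w w w = 6 * t ->
    ~ (forall v, H *m v = 0 -> trilinear C w w v = 6 * t * dotp w v).
Proof.
move=> ab s12 s23.
pose cs := [seq C i.1.1 i.1.2 i.2 | i : 'I_N * 'I_N * 'I_N]
  ++ [seq H i.1 i.2 | i : 'I_N * 'I_N].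
have [B0 [phi0 h0]] := countable_subring cs.
have [t tab ht] := exists_transcendental phi0 ab.
exists t => // w ww Hw wt crit.
pose D1 (p : {poly B0}) := (map_poly phi0 p)^`().[t].
have hD1 : derivation_along (eval_at phi0 t) D1.
  split=> [p q|p q|p /ht p0]; rewrite /D1.
  - by rewrite rmorphD derivD hornerD.
  - by rewrite rmorphM derivM hornerD !hornerM /eval_at addrC.
  - by rewrite p0 deriv0 horner0.
have [B [phi [D [hD hw lift]]]] := adjoin [seq w i 0 | i : 'I_N] hD1.
have const c : c \in cs -> exists x, phi x = c /\ D x = 0.
  move=> /h0 [x <-]; have [y [h1 h2]] := lift x%:P; exists y.
  by rewrite h1 h2 /D1 map_polyC derivC horner0; split=> //; exact: eval_atC.
have [tt [tt1 tt2]] : exists tt, phi tt = t /\ D tt = 1.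
  have [y [h1 h2]] := lift 'X; exists y.
  by rewrite h1 h2 /D1 map_polyX derivX hornerC; split=> //; exact: eval_atX.
have /choice [x hx] : forall i, exists x, phi x = w i 0.
  by move=> i; apply: hw; exact: (codom_f (fun i => w i 0)).
have /choice [c hc] : forall i : 'I_N * 'I_N * 'I_N, exists x,
    phi x = C i.1.1 i.1.2 i.2 /\ D x = 0.
  move=> i; apply: const; rewrite mem_cat; apply/orP; left.
  exact: (codom_f (fun i : 'I_N * 'I_N * 'I_N => C i.1.1 i.1.2 i.2)).
have /choice [hh hhh] : forall i : 'I_N * 'I_N, exists x, phi x = H i.1 i.2 /\ D x = 0.
  move=> i; apply: const; rewrite mem_cat; apply/orP; right.
  exact: (codom_f (fun i : 'I_N * 'I_N => H i.1 i.2)).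
have [hA hM _] := hD.
pose v := \col_i D (x i).
have wv : dotp w v = 0.
  have E : D (\sum_i x i * x i) = D (1 + 0).
    apply: (derivation_wd hD); rewrite addr0 rmorph1 -ww dotpE rmorph_sum.
    by apply: eq_bigr => i _; rewrite rmorphM /= hx.
  have D1E : D (1 + 0) = 0.
    have := hM 1 1; rewrite !mulr1 rmorph1 mul1r mulr1 addr0; lra.
  move: E; rewrite D1E (derivation_sum hD) => E.
  apply/eqP; rewrite -(mulrI_eq0 _ (@lregP _ 2%:R _)) ?pnatr_eq0//.
  apply/eqP; rewrite -[RHS]E dotpE mulr_sumr; apply: eq_bigr => i _.
  by rewrite hM hx mxE; ring.
have Hv : H *m v = 0.
  apply/colP => i; rewrite !mxE.
  have E : D (\sum_j hh (i, j) * x j) = D 0.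
    apply: (derivation_wd hD); rewrite rmorph0 rmorph_sum.
    have := congr1 (fun M : 'cV[R]_N => M i 0) Hw; rewrite !mxE => Ew; rewrite -[RHS]Ew.
    by apply: eq_bigr => j _; rewrite rmorphM /= hx (hhh (i, j)).1.
  move: E; rewrite (derivation0 hD) (derivation_sum hD) => E; rewrite -[RHS]E.
  by apply: eq_bigr => j _; rewrite hM mxE (hhh (i, j)).1 (hhh (i, j)).2 mul0r addr0.
have E : D (\sum_i \sum_j \sum_k c (i, j, k) * x i * x j * x k)
       = D (tt + tt + tt + tt + tt + tt).
  apply: (derivation_wd hD); rewrite !rmorphD /= tt1.
  have -> : t + t + t + t + t + t = 6 * t by ring.
  rewrite -wt !rmorph_sum; apply: eq_bigr => i _; rewrite rmorph_sum.
  apply: eq_bigr => j _; rewrite rmorph_sum; apply: eq_bigr => k _.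
  by rewrite !rmorphM /= !hx (hc (i, j, k)).1.
have E2 : D (\sum_i \sum_j \sum_k c (i, j, k) * x i * x j * x k)
    = trilinear C v w w + trilinear C w v w + trilinear C w w v.
  rewrite (derivation_sum hD) -!big_split /=; apply: eq_bigr => i _.
  rewrite (derivation_sum hD) -!big_split /=; apply: eq_bigr => j _.
  rewrite (derivation_sum hD) -!big_split /=; apply: eq_bigr => k _.
  rewrite !hM !rmorphM /= !hx (hc (i, j, k)).1 (hc (i, j, k)).2 !mxE; ring.
move: E; rewrite E2 (s12 v) (s23 w v) crit// wv mulr0 !hA tt2; lra.
Qed.

End Noncritical.

(** * The iterates of the method *)

Section Iterates.
Context {R : realType} {n m : nat} (f : 'cV[R]_(n + m) -> R) (mu L rho beta : R).
Context (hf : standing_assumptions f mu L rho) (hbeta : mu^-1 < beta).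
Context (z xi : nat -> 'cV[R]_(n + m)) (zs : 'cV[R]_(n + m)).
Notation P := (@Pmx R n m).
Notation g := (grad f).
Notation h := (h_reg beta f).
Notation G := (grad (h_reg beta f)).
Notation a z := (enorm (P *m grad f z)).
Notation kappa := (3 * beta * L + 1).
Context (steps : forall k, is_step f L rho beta (z k) (xi k)).
Context (z_next : forall k, z k.+1 = z k + xi k).
Context (accum : forall e N, 0 < e -> exists2 k, (N <= k)%N & enorm (z k - zs) < e).

Notation r k := (h (z k) - h zs).
Notation eta k := (enorm (xi k)).
Notation dist k := (enorm (z k - zs)).

Let mu0 : 0 < mu := mu_gt0 hf.
Let L0 : 0 < L := L_gt0 hf.
Let rho0 : 0 < rho := rho_gt0 hf.
Let beta0 : 0 < beta := beta_gt0 hf hbeta.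
Let kr : 0 < kappa * rho := kr0 hf hbeta.

Lemma a_lip x e : a (x + e) <= a x + L * enorm e.
Proof.
rewrite -lerBlDl (le_trans (ler_norm _))// (le_trans (enorm_dist _ _))// -mulmxBr.
by rewrite (le_trans (enorm_Pmx_le _))// (sa_grad_lipschitz hf).
Qed.

Lemma G_lip_at y : exists2 C, 0 < C &
  forall e, enorm e <= 1 -> enorm (G (y + e) - G y) <= C * enorm e.
Proof.
set K := (1 + beta * L) * (rho / 2).
have K0 : 0 < K by rewrite mulr_gt0 ?divr_gt0// addr_gt0// mulr_gt0.
set K2 := L + beta * L ^+ 2.
have K20 : 0 < K2 by rewrite addr_gt0// mulr_gt0// exprn_gt0.
set K3 := beta * rho * (a y + L).
have K30 : 0 <= K3 by rewrite mulr_ge0 ?addr_ge0// ltW// mulr_gt0.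
exists (K2 + K + K3); first by rewrite ltr_wpDr// addr_gt0.
move=> e e1.
have h1 := G_taylor hf hbeta y e; have h2 := Hbar_le hf hbeta y e.
have br : 0 <= beta * rho * enorm e by rewrite mulr_ge0// ltW// mulr_gt0.
have h3 : beta * rho * enorm e * a (y + e) <= K3 * enorm e.
  apply: le_trans (ler_wpM2l br (_ : _ <= a y + L)) _; last by rewrite /K3 mulrAC.
  by rewrite (le_trans (a_lip _ _))// lerD2l ler_piMr// ltW.
have h4 : K * enorm e ^+ 2 <= K * enorm e by rewrite ler_pM2l// expr2 ler_piMl.
move: h1 h2 h3; move: (G (y + e)) (G y) (Hbar beta f y *m e) (P *m g (y + e)).
rewrite -/K -/K2 => G1 G0 B a1 h1 h2 h3.
have := enormD (G1 - G0 - B) B; rewrite subrK => /le_trans; apply.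
have -> : (K2 + K + K3) * enorm e = K * enorm e + K3 * enorm e + K2 * enorm e by ring.
exact: lerD (le_trans h1 (lerD h4 h3)) h2.
Qed.

Lemma h_lip_at y : exists2 C, 0 < C &
  forall e, enorm e <= 1 -> `|h (y + e) - h y| <= C * enorm e.
Proof.
have [C1 C10 hG] := G_lip_at y.
set K2 := L + beta * L ^+ 2.
have K20 : 0 < K2 by rewrite addr_gt0// mulr_gt0// exprn_gt0.
set b := beta * rho / 2.
have b0 : 0 < b by rewrite !mulr_gt0.
set c := kappa * rho / 6.
have c0 : 0 < c by rewrite divr_gt0.
set C := enorm (G y) + C1 + K2 + b * (a y + L) + c.
have C0 : 0 < C.
  have : 0 <= b * (a y + L) by rewrite mulr_ge0 ?addr_ge0// ltW.
  by rewrite /C; move: (enorm_ge0 (G y)) (b * _) => ? ? ?; lra.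
have up x e : enorm e <= 1 -> enorm (G x) <= enorm (G y) + C1 -> a x <= a y + L ->
    h (x + e) <= h x + C * enorm e.
  move=> e1 Gx ax; apply: le_trans (h_descent hf hbeta x e) _.
  have h1 : dotp (G x) e <= (enorm (G y) + C1) * enorm e.
    by rewrite (le_trans (dotp_le _ _))// ler_wpM2r.
  have h2 : 2^-1 * dotp e (Hbar beta f x *m e) <= K2 * enorm e.
    have : dotp e (Hbar beta f x *m e) <= K2 * enorm e.
      rewrite (le_trans (dotp_le _ _))// (le_trans (ler_piMl _ e1))//.
      exact: (Hbar_le hf hbeta).
    have := mulr_ge0 (ltW K20) (enorm_ge0 e).
    by move: (dotp e (Hbar beta f x *m e)) => q; clear Gx ax h1; lra.
  have e2 : enorm e ^+ 2 <= enorm e by rewrite expr2 ler_piMl.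
  have h3 : b * a x * enorm e ^+ 2 <= b * (a y + L) * enorm e.
    apply: ler_pM => //; [|exact: exprn_ge0|by rewrite ler_pM2l].
    by rewrite mulr_ge0// ltW.
  have h4 : c * enorm e ^+ 3 <= c * enorm e.
    rewrite ler_pM2l// exprS; apply: le_trans (ler_wpM2l (enorm_ge0 e) e2) _.
    by rewrite ler_piMl.
  rewrite -/b -/c /C; move: h1 h2 h3 h4.
  move: (dotp (G x) e) (dotp e (Hbar beta f x *m e)) (a x) (a y) (enorm (G y)) (h x).
  by move=> q1 q2 q3 q4 q5 q6; clear Gx ax; lra.
exists C => // e e1; rewrite ler_norml; apply/andP; split; last first.
  by rewrite lerBlDl up// lerDl ltW.
have := up (y + e) (- e); rewrite addrK enormN => /(_ e1) h1.
rewrite lerNl opprB lerBlDl h1//.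
  have := enormD (G (y + e) - G y) (G y); rewrite subrK => /le_trans; apply.
  by rewrite addrC lerD2l (le_trans (hG e e1))// ler_piMr// ltW.
rewrite (le_trans (a_lip _ _))// lerD2l ler_piMr// ltW//.
Qed.

Lemma iter_decrease k : r k.+1 + kappa * rho / 6 * eta k ^+ 3 <= r k.
Proof.
have := lerD (step_decrease hf hbeta (steps k)) (lexx (- h zs)).
by rewrite -z_next addrAC.
Qed.

Lemma z_shift k : zs + (z k - zs) = z k.
Proof. by rewrite addrC subrK. Qed.

Lemma accum_gap e N : 0 < e -> exists2 k, (N <= k)%N & dist k < e /\ `|r k| < e.
Proof.
move=> e0; have [C C0 hC] := h_lip_at zs.
have m0 : 0 < Num.min (Num.min e 1) (e / C) by rewrite !lt_min e0 ltr01 divr_gt0.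
have [k Nk hk] := accum N m0; exists k => //.
move: hk; rewrite !lt_min => /andP[/andP[h1 h2]] h3; split=> //.
have := hC _ (ltW h2); rewrite z_shift => /le_lt_trans; apply.
by rewrite mulrC -ltr_pdivlMr.
Qed.

(** The values decrease and, by continuity, come arbitrarily close to the value at the
    accumulation point. *)
Lemma gap_ge0 k : 0 <= r k.
Proof.
apply/ler_addgt0Pl => e e0; have [j kj [_ hj]] := accum_gap k e0.
have mono : r j <= r k.
  move/subnK: kj => <-; elim: (j - k)%N => [//|i IH]; rewrite addSn.
  apply: le_trans IH; apply: le_trans (iter_decrease _).
  by rewrite lerDl mulr_ge0 ?exprn_ge0// ltW// divr_gt0.
rewrite -lerBlDl sub0r; apply: le_trans mono.
by move: hj; rewrite ltr_norml => /andP[/ltW].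
Qed.

Lemma accum_gap' e N : 0 < e -> exists2 k, (N <= k)%N & dist k < e /\ r k < e.
Proof.
move=> e0; have [k Nk [h1 h2]] := accum_gap N e0; exists k => //; split=> //.
exact: le_lt_trans (ler_norm _) h2.
Qed.

Let c6 : 0 < kappa * rho / 6. Proof. by rewrite divr_gt0. Qed.

Lemma iter_eta_to0 e : 0 < e -> exists k1, forall k, (k1 <= k)%N -> eta k < e.
Proof.
exact: (@eta_to0 _ (fun k => r k) (fun k => eta k) (fun k => dist k) _ c6
  gap_ge0 (fun k => enorm_ge0 _) iter_decrease accum_gap').
Qed.

Lemma iter_grad : exists C1 C2 k1, [/\ 0 < C1, 0 < C2 & forall k, (k1 <= k)%N ->
  enorm (G (z k)) <= C2 * eta k /\ enorm (G (z k.+1)) <= C1 * eta k ^+ 2].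
Proof.
have [eta0 [C1 [C2 [e0 C10 C20 hs]]]] := small_step_bounds hf hbeta.
have [k1 hk] := iter_eta_to0 e0.
exists C1, C2, k1; split=> // k /hk /ltW he; rewrite z_next; exact: hs.
Qed.

Lemma limit_critical : G zs = 0.
Proof.
have [C1 [C2 [k1 [_ C20 hk1]]]] := iter_grad.
have [C C0 hC] := G_lip_at zs.
apply: enorm_eq0; apply/eqP; rewrite eq_le enorm_ge0 andbT.
apply/ler_addgt0Pl => e e0; rewrite addr0.
have e2 : 0 < e / 2 by rewrite divr_gt0.
have [k2 hk2] := iter_eta_to0 (divr_gt0 e2 C20).
have m0 : 0 < Num.min 1 (e / 2 / C) by rewrite lt_min ltr01 divr_gt0.
have [k] := accum (maxn k1 k2) m0.
rewrite geq_max lt_min => /andP[kk1 kk2] /andP[d1 d2].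
have [h1 _] := hk1 _ kk1; have h2 := hk2 _ kk2.
have := hC _ (ltW d1); rewrite z_shift => h3.
move: d2; rewrite ltr_pdivlMr// => d2; move: h2; rewrite ltr_pdivlMr// => h2.
have := enormB (G (z k)) (G (z k) - G zs); rewrite opprB addrC subrK.
by move: h1 h3 h2 d2; move: (G (z k)) (G zs) => Gk Gs; lra.
Qed.

(** The regularizing terms in the second condition of [step_optimality] tend to [0]
    along the iterates approaching [zs]. *)
Lemma limit_psd : psd (Hbar beta f zs).
Proof.
have Gzs := limit_critical.
move=> v; apply/ler_addgt0Pl => e e0.
have scal (q1 q2 A B V : R) : q1 - q2 <= A * V * V -> 0 <= q1 + B * V ^+ 2 ->
    (A + B) * V ^+ 2 <= e -> 0 <= e + q2.
  by rewrite expr2 => ? ? ?; lra.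
set K1 := rho + 2 * beta * L * rho.
have K10 : 0 < K1 by rewrite addr_gt0// !mulr_gt0.
set K := K1 + 2 * beta * rho * L + kappa * rho.
have K0 : 0 < K by rewrite !addr_gt0// !mulr_gt0.
have V0 : 0 < enorm v ^+ 2 + 1 by rewrite ltr_wpDl// exprn_ge0.
pose d : R := e / (K * (enorm v ^+ 2 + 1)).
have d0 : 0 < d by rewrite divr_gt0// mulr_gt0.
have [k2 hk2] := iter_eta_to0 d0.
have [k kk2 hd] := accum k2 d0.
have [_ hpsd] := step_optimality hf hbeta (steps k).
have := hpsd v; have hl := Hbar_lip hf hbeta zs (z k - zs) v v.
have ha := a_le_dist hf hbeta Gzs (z k - zs).
move: hl ha; rewrite z_shift ler_norml => /andP[_ hl] ha hp.
have he := hk2 _ kk2.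
have hd' := ltW hd; have he' := ltW he.
have br : 0 <= 2 * beta * rho by rewrite ltW// !mulr_gt0.
have bound : K1 * dist k + (2 * beta * rho * a (z k) + kappa * rho * eta k) <= K * d.
  have -> : K * d = K1 * d + (2 * beta * rho * (L * d) + kappa * rho * d).
    by rewrite /K; ring.
  apply: lerD; first exact (ler_wpM2l (ltW K10) hd').
  apply: lerD; last exact (ler_wpM2l (ltW kr) he').
  exact (ler_wpM2l br (le_trans ha (ler_wpM2l (ltW L0) hd'))).
have Kd : K * d * enorm v ^+ 2 <= e.
  have -> : e = K * d * (enorm v ^+ 2 + 1).
    by rewrite /d; field; rewrite !gt_eqF.
  by rewrite ler_wpM2l ?lerDl// mulr_ge0// ltW.
have le_e := le_trans (ler_wpM2r (exprn_ge0 2 (enorm_ge0 v)) bound) Kd.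
exact: scal hl hp le_e.
Qed.

Lemma iter_step_le_dist : exists2 C, 0 < C & forall k, eta k <= C * dist k.
Proof.
have [C C0 hC] := step_le_dist hf hbeta limit_critical limit_psd.
exists C => // k; apply: hC.
by rewrite z_shift; exact: steps.
Qed.

Lemma dist_next_le k : dist k.+1 <= dist k + eta k.
Proof. by rewrite z_next addrAC enormD. Qed.

Lemma dist_le_next k : dist k <= dist k.+1 + eta k.
Proof.
by have := enormB (z k.+1 - zs) (xi k); rewrite z_next addrAC addrK.
Qed.

(** The gradient at [z k.+1] is of order [eta k ^+ 2] by [small_step_bounds]. *)
Lemma KL_iterates theta : KL_at h theta zs -> exists K del k0,
  [/\ 0 < K, 0 < del & forall k, (k0 <= k)%N -> dist k.+1 <= del ->
    r k.+1 `^ theta <= K * eta k ^+ 2].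
Proof.
move=> [_ [U [nU [C [C0 hU]]]]].
have [C1 [C2 [k1 [C10 C20 hk1]]]] := iter_grad.
move/nbhs_enormP : nU => [d d0 hd].
exists (C1 / C), (d / 2), k1; split; [exact: divr_gt0|exact: divr_gt0|].
move=> k kk dk; have [_ h1] := hk1 _ kk.
have /hd/hU : dist k.+1 < d.
  by apply: le_lt_trans dk _; rewrite gtr_pMr// invf_lt1// ltr1n.
rewrite (ger0_norm (gap_ge0 _)) => h2; rewrite mulrAC ler_pdivlMr// mulrC.
exact: le_trans h2 h1.
Qed.

End Iterates.

(** * The second-order sufficient condition *)

Section SecondOrder.
Context {R : realType} {n m : nat} (f : 'cV[R]_(n + m) -> R) (mu L rho : R).
Context (hf : standing_assumptions f mu L rho).
Implicit Types (z S u v w : 'cV[R]_(n + m)) (x : 'cV[R]_n) (y : 'cV[R]_m).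
Notation P := (@Pmx R n m).
Notation g := (grad f).
Notation H := (hess f).

Let mu0 : 0 < mu := mu_gt0 hf.
Let L0 : 0 < L := L_gt0 hf.
Let rho0 : 0 < rho := rho_gt0 hf.

Lemma grad_lip_dual z u v : `|dotp v (g (z + u)) - dotp v (g z)| <= L * enorm u * enorm v.
Proof.
rewrite -dotpBr (le_trans (cauchy_schwarz _ _))// mulrC ler_wpM2r//.
exact: (sa_grad_lipschitz hf).
Qed.

Lemma f_taylor1 z u : `|f (z + u) - f z - dotp u (g z)| <= L / 2 * enorm u ^+ 2.
Proof.
pose phi t := f (z + t *: u) - t * dotp u (g z).
pose dphi t := dotp u (g (z + t *: u)) - dotp u (g z).
have := @taylor_abs _ phi dphi (L * enorm u ^+ 2) 1.
rewrite /phi scale1r scale0r addr0 mul1r mul0r subr0 addrAC => h.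
rewrite (_ : L / 2 * _ = L * enorm u ^+ 2 / 2); last by ring.
apply: h => t /andP[t0 t1].
  by apply: is_deriveB; [exact: (is_derive_f_line hf)|exact: is_derive_mulc].
rewrite /dphi (le_trans (grad_lip_dual _ _ _))// enormZ (ger0_norm t0) expr1.
by rewrite le_eqVlt; apply/orP; left; apply/eqP; ring.
Qed.

Lemma strong_monotone z S : P *m S = S ->
  dotp S (g (z + S)) - dotp S (g z) <= - mu * enorm S ^+ 2.
Proof.
move=> PS.
pose phi t := dotp S (g (z + t *: S)).
pose dphi t := dotp S (H (z + t *: S) *m S).
have := @taylor_le _ phi dphi (- mu * enorm S ^+ 2) 0.
rewrite /phi scale1r scale0r addr0 divr1; apply=> t _.
  exact: (is_derive_g_line hf).
by rewrite mulr1 /dphi; have := hess_concave hf (z + t *: S) S; rewrite PS.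
Qed.

Lemma concave_upper z S : P *m S = S ->
  f (z + S) <= f z + dotp S (g z) - mu / 2 * enorm S ^+ 2.
Proof.
move=> PS.
pose phi t := f (z + t *: S) - t * dotp S (g z).
pose dphi t := dotp S (g (z + t *: S)) - dotp S (g z).
have := @taylor_le _ phi dphi (- mu * enorm S ^+ 2) 1.
rewrite /phi scale1r scale0r addr0 mul1r mul0r subr0 => h.
suff : f (z + S) - dotp S (g z) - f z <= - mu * enorm S ^+ 2 / 2.
  by move: (f (z + S)) (f z) (dotp S (g z)) => *; lra.
apply: h => t /andP[t0 t1].
  by apply: is_deriveB; [exact: (is_derive_f_line hf)|exact: is_derive_mulc].
rewrite /dphi expr1; move: t0; rewrite le_eqVlt => /orP[/eqP <-|t0].
  by rewrite scale0r addr0 subrr mulr0.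
have := @strong_monotone z (t *: S); rewrite -scalemxAr PS => /(_ erefl).
rewrite !dotpZl enormZ (gtr0_norm t0) => h; rewrite -(ler_pM2l t0); move: h.
by move: (dotp S _) (dotp S _) (enorm S) => *; lra.
Qed.

Lemma col_mxP0 y : P *m col_mx 0 y = col_mx (0 : 'cV[R]_n) y.
Proof. by rewrite Pmx_mul col_mxKd. Qed.

(** By strong concavity [f] is below its value at [y = 0] outside of a ball, which is
    contained in a compact box. *)
Lemma exists_maximizer x : exists y, forall y', f (col_mx x y') <= f (col_mx x y).
Proof.
pose z0 : 'cV[R]_(n + m) := col_mx x 0.
pose r := 2 * enorm (g z0) / mu.
have r0 : 0 <= r by rewrite divr_ge0 ?mulr_ge0// ltW.
pose F (v : 'rV[R]_m) := f (col_mx x v^T).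
pose A : set 'rV[R]_m := [set v | forall i, `[- r, r]%classic (v ord0 i)].
have cA : compact A.
  by apply: (@rV_compact _ _ (fun=> `[- r, r]%classic)) => i; exact: segment_compact.
have A0 : A !=set0.
  by exists 0 => i /=; rewrite mxE in_itv /= r0 oppr_le0 r0.
have cF : {within A, continuous F}.
  apply: continuous_subspaceT => v.
  have dcol : differentiable (fun w : 'rV[R]_m => col_mx x w^T : 'cV[R]_(n + m)) v.
    have -> : (fun w : 'rV[R]_m => col_mx x w^T : 'cV[R]_(n + m)) = cst z0 +
        \sum_(i < m) (fun w : 'rV[R]_m => w ord0 i *: col_mx (0 : 'cV[R]_n) (basis_vec i)).
      apply/funext => w; rewrite fctE fct_sumE /cst /z0.
      apply/colP => k; rewrite [RHS]mxE summxE -[k]fintype.splitK.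
      case: (fintype.split k) => j /=.
        rewrite !col_mxEu big1 ?addr0// => i _.
        by rewrite mxE col_mxEu mxE mulr0.
      rewrite !col_mxEd !mxE add0r (bigD1 j) //= big1 => [|i ij].
        by rewrite mxE col_mxEd mxE !eqxx mulr1 addr0.
      by rewrite mxE col_mxEd mxE eq_sym (negbTE ij) mulr0.
    apply: differentiableD => //; apply: differentiable_sum => i.
    by apply: differentiableZl; exact: differentiable_coord.
  exact: differentiable_continuous (differentiable_comp dcol (diff_f hf _)).
have [v _ hv] := EVT_max_rV A0 cA cF.
exists v^T => y'.
have hA (w : 'rV[R]_m) : A w -> F w <= F v by move=> Aw; apply: hv; rewrite inE.
have [inA|outA] := pselect (A y'^T).
  by have := hA _ inA; rewrite /F trmxK.
have big : r < enorm y'.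
  rewrite ltNge; apply/negP => le; apply: outA => i /=; rewrite mxE in_itv /= -ler_norml.
  exact: le_trans (abs_coord_le_enorm _ _) le.
have h0 : f z0 <= f (col_mx x v^T).
  have := hA 0; rewrite /F trmx0; apply=> i /=.
  by rewrite mxE in_itv /= r0 oppr_le0 r0.
apply: le_trans h0.
have := @concave_upper z0 (col_mx 0 y') (col_mxP0 _).
have -> : z0 + col_mx 0 y' = col_mx x y' by rewrite add_col_mx addr0 add0r.
move=> /le_trans; apply; rewrite enorm_col0.
have h1 := dotp_le (col_mx (0 : 'cV[R]_n) y') (g z0); rewrite enorm_col0 in h1.
have h2 : enorm (g z0) <= mu / 2 * enorm y'.
  move: big; rewrite /r ltr_pdivrMr// => /ltW.
  by move: (enorm (g z0)) (enorm y') => *; lra.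
have h3 := ler_wpM2l (enorm_ge0 y') h2.
move: h1 h3; move: (dotp _ _) (enorm (g z0)) (enorm y') (f z0) => *; lra.
Qed.

Section Argmax.
Context (ymax : 'cV[R]_n -> 'cV[R]_m).
Context (ymaxP : forall x y, f (col_mx x y) <= f (col_mx x (ymax x))).
Notation zmax x := (col_mx x (ymax x)).

Lemma Phi_max x : Phi f x = f (zmax x).
Proof.
apply/eqP; rewrite eq_le; apply/andP; split.
  apply: ge_sup; first by exists (f (zmax x)), (ymax x).
  by move=> _ [y _ <-].
apply: ub_le_sup; last by exists (ymax x).
by exists (f (zmax x)) => _ [y _ <-].
Qed.

Lemma grad_y_max x : P *m g (zmax x) = 0.
Proof.
set S := P *m g (zmax x).
apply: enorm_eq0; apply/eqP; rewrite -sqrf_eq0 eq_le sqr_ge0 andbT.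
apply: (@le_of_first_order _ _ _ (L / 2 * enorm S ^+ 2)) => t /andP[t0 t1].
have := f_taylor1 (zmax x) (t *: S); rewrite ler_norml => /andP[+ _].
have -> : zmax x + t *: S = col_mx x (ymax x + t *: dsubmx (g (zmax x))).
  by rewrite /S Pmx_mul scale_col_mx scaler0 add_col_mx addr0.
have := ymaxP x (ymax x + t *: dsubmx (g (zmax x))).
have -> : dotp (t *: S) (g (zmax x)) = t * enorm S ^+ 2.
  by rewrite dotpZl /S enorm_sqr dotp_PmxC Pmx_idem.
rewrite enormZ (gtr0_norm t0) exprMn.
by move: (f _) (f _) (enorm S ^+ 2) => *; lra.
Qed.

(** Strong monotonicity between [y] and the maximizer, where the partial gradient is
    [0]. *)
Lemma dist_ymax x y : enorm (y - ymax x) <= enorm (P *m g (col_mx x y)) / mu.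
Proof.
set S := col_mx (0 : 'cV[R]_n) (y - ymax x).
have nS : enorm S = enorm (y - ymax x) by rewrite /S enorm_col0.
have := strong_monotone (zmax x) (col_mxP0 (y - ymax x)); rewrite -/S.
have -> : zmax x + S = col_mx x y by rewrite add_col_mx addr0 addrC subrK.
have z1 : dotp S (g (zmax x)) = 0.
  by rewrite /S -(col_mxP0 (y - ymax x)) -dotp_PmxC grad_y_max dotp0r.
have z2 : dotp S (g (col_mx x y)) = dotp S (P *m g (col_mx x y)).
  by rewrite dotp_PmxC /S col_mxP0.
rewrite z1 z2 subr0 -nS => h.
have h2 := dotp_ge S (P *m g (col_mx x y)).
rewrite ler_pdivlMr//; have [->|s0] := eqVneq (enorm S) 0.
  by rewrite mul0r enorm_ge0.
have sp : 0 < enorm S by rewrite lt_neqAle eq_sym s0 enorm_ge0.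
rewrite -(ler_pM2l sp); move: h h2.
by move: (dotp S _) (enorm S) (enorm (P *m _)) => p q s; rewrite expr2; lra.
Qed.

Lemma ymax_lip x (v : 'cV[R]_n) : enorm (ymax x - ymax (x + v)) <= L / mu * enorm v.
Proof.
apply: le_trans (dist_ymax _ _) _; rewrite mulrAC ler_pM2r ?invr_gt0//.
have -> : col_mx (x + v) (ymax x) = zmax x + col_mx v 0.
  by rewrite add_col_mx addr0.
have := sa_grad_lipschitz hf (zmax x) (col_mx v 0); rewrite enorm_col_0.
apply: le_trans; rewrite -[X in enorm X]subr0 -(grad_y_max x) -mulmxBr.
exact: enorm_Pmx_le.
Qed.

(** Danskin's formula: maximality bounds [Phi] at [x + t *: v] from both sides by values
    of [f] with the maximizer frozen at either end, and the maximizer is Lipschitz. *)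
Lemma derive_Phi (v : 'cV[R]_n) x : 'D_v (Phi f) x = dotp (col_mx v 0) (g (zmax x)).
Proof.
set V := col_mx v (0 : 'cV[R]_m).
have nV : enorm V = enorm v by rewrite /V enorm_col_0.
have K0 : 0 <= L * (L / mu) * enorm v ^+ 2.
  by rewrite mulr_ge0 ?exprn_ge0// mulr_ge0 ?divr_ge0// ltW.
apply: (@derive_quadratic_bound _ _ _ _ _ _
  (L / 2 * enorm v ^+ 2 + L * (L / mu) * enorm v ^+ 2)) => t t1.
rewrite !Phi_max.
have shift y : col_mx x y + t *: V = col_mx (x + t *: v) y.
  by rewrite scale_col_mx scaler0 add_col_mx addr0.
have nt : enorm (t *: V) ^+ 2 = t ^+ 2 * enorm v ^+ 2.
  by rewrite enormZ nV exprMn real_normK ?num_real.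
have lo := f_taylor1 (zmax x) (t *: V); rewrite shift nt dotpZl in lo.
have up := f_taylor1 (col_mx x (ymax (x + t *: v))) (t *: V).
rewrite shift nt dotpZl in up.
have m1 := ymaxP (x + t *: v) (ymax x).
have m2 := ymaxP x (ymax (x + t *: v)).
have dg : `|t * dotp V (g (col_mx x (ymax (x + t *: v)))) - t * dotp V (g (zmax x))|
    <= t ^+ 2 * (L * (L / mu) * enorm v ^+ 2).
  rewrite -mulrBr normrM.
  have := grad_lip_dual (zmax x) (col_mx 0 (ymax (x + t *: v) - ymax x)) V.
  have -> : zmax x + col_mx 0 (ymax (x + t *: v) - ymax x) = col_mx x (ymax (x + t *: v)).
    by rewrite add_col_mx addr0 addrC subrK.
  rewrite enorm_col0 enormBC nV => h.
  have := ymax_lip x (t *: v); rewrite enormZ => hy.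
  have -> : t ^+ 2 * (L * (L / mu) * enorm v ^+ 2) =
      `|t| * (L * (L / mu * (`|t| * enorm v)) * enorm v).
    by rewrite -[t ^+ 2]real_normK ?num_real//; ring.
  by rewrite ler_wpM2l// (le_trans h)// ler_wpM2r// ler_pM2l.
move: lo up m1 m2 dg; rewrite !ler_norml.
move: (f (zmax x)) (f (zmax (x + t *: v))) (f (col_mx (x + t *: v) (ymax x)))
  (f (col_mx x (ymax (x + t *: v)))) (dotp V (g (zmax x)))
  (dotp V (g (col_mx x (ymax (x + t *: v))))) K0.
move=> f0 f1 f2 f3 d0 d1 K0 /andP[lo1 lo2] /andP[up1 up2] m1 m2 /andP[dg1 dg2].
have t2 : 0 <= t ^+ 2 * (L * (L / mu) * enorm v ^+ 2) by rewrite mulr_ge0// sqr_ge0.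
by apply/andP; split; lra.
Qed.

Section AtCritical.
Context (zs : 'cV[R]_(n + m)) (gzs : g zs = 0).

Lemma zmax_critical : zmax (usubmx zs) = zs.
Proof.
have := dist_ymax (usubmx zs) (dsubmx zs); rewrite vsubmxK gzs mulmx0 enorm0 mul0r => h.
have /eqP : dsubmx zs - ymax (usubmx zs) = 0.
  by apply: enorm_eq0; apply/eqP; rewrite eq_le h enorm_ge0.
by rewrite subr_eq0 => /eqP <-; rewrite vsubmxK.
Qed.

(** The tangent [W] to the graph of the maximizer solves the linearized equation
    [P H W = 0]; it is found from the invertible block of [H] in [y]. *)
Lemma exists_tangent : exists Y : 'M[R]_(m, n), P *m H zs *m col_mx 1%:M Y = 0.
Proof.
set D := drsubmx (H zs); set B := dlsubmx (H zs).
have Dun : D \in unitmx.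
  rewrite -row_free_unit; apply: inj_row_free => v vD0.
  have E := hess_concave hf zs (col_mx 0 v^T); rewrite col_mxP0 in E.
  have z0 : dotp (col_mx 0 v^T) (H zs *m col_mx 0 v^T) = 0.
    rewrite -[H zs]submxK mul_block_col !mulmx0 !add0r dotp_col dotp0l add0r -/D.
    by rewrite /dotp trmxK mulmxA vD0 mul0mx mxE.
  rewrite z0 enorm_col0 mulNr oppr_ge0 pmulr_rle0// in E.
  have : enorm v^T = 0 by apply/eqP; rewrite -sqrf_eq0 eq_le E sqr_ge0.
  by move/enorm_eq0 => /(congr1 trmx); rewrite trmxK trmx0.
exists (- (invmx D *m B)).
rewrite -[H zs]submxK -/D -/B /Pmx mulmx_block mul_block_col.
by rewrite !mul1mx !mulmx1 !mulmxN !mul0mx !add0r mul0mx oppr0 (mulmxA D) mulmxV// mul1mx subrr col_mx0.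
Qed.

Section Tangent.
Context (Y : 'M[R]_(m, n)) (hY : P *m H zs *m col_mx 1%:M Y = 0).
Notation W := (col_mx 1%:M Y).

Lemma W_mul (v : 'cV[R]_n) : W *m v = col_mx v (Y *m v).
Proof. by rewrite mul_col_mx mul1mx. Qed.

(** The gradient of [Phi] is the partial gradient of [f] along the graph of the
    maximizer. Along the tangent [W] the partial gradient in [y] is of second order,
    so by [dist_ymax] the graph stays at distance of second order from the line. *)
Lemma hess_Phi : hess (Phi f) (usubmx zs) = usubmx (H zs *m W).
Proof.
apply/matrixP => i j; rewrite !mxE.
set v := basis_vec j; set E := col_mx (basis_vec i) (0 : 'cV[R]_m).
have -> : 'D_(basis_vec i) (Phi f) = fun x => dotp E (g (zmax x)).
  by apply/funext => x; rewrite derive_Phi.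
have -> : \sum_j0 H zs (lshift m i) j0 * W j0 j = dotp E (H zs *m (W *m v)).
  transitivity (usubmx (H zs *m W *m v) i 0).
    by rewrite /v /basis_vec -colE !mxE.
  rewrite -[in LHS]mulmxA -[in RHS](vsubmxK (H zs *m (W *m v))) dotp_col dotp0l addr0.
  rewrite dotpE (bigD1 i) //= big1 => [|k ki].
    by rewrite [basis_vec i i 0]mxE !eqxx mul1r addr0.
  by rewrite [basis_vec i k 0]mxE (negbTE ki) mul0r.
set w := W *m v.
have Pw : P *m (H zs *m w) = 0 by rewrite /w !mulmxA hY mul0mx.
apply: (@derive_quadratic_bound _ _ _ _ _ _
  ((L / mu + 1) * (rho / 2 * enorm w ^+ 2) * enorm E)) => t t1.
rewrite zmax_critical gzs dotp0r subr0.
set x := usubmx zs + t *: v.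
have zt : zs + t *: w = col_mx x (dsubmx zs + t *: (Y *m v)).
  by rewrite /w W_mul scale_col_mx -{1}[zs]vsubmxK add_col_mx.
have b1 : enorm (g (zs + t *: w) - t *: (H zs *m w)) <= rho / 2 * (t ^+ 2 * enorm w ^+ 2).
  have := grad_taylor hf zs (t *: w); rewrite gzs subr0 -scalemxAr enormZ exprMn.
  by rewrite real_normK ?num_real.
have b2 : enorm (zmax x - (zs + t *: w)) <= rho / 2 * (t ^+ 2 * enorm w ^+ 2) / mu.
  have -> : zmax x - (zs + t *: w) = - col_mx 0 (dsubmx zs + t *: (Y *m v) - ymax x).
    by rewrite zt opp_col_mx add_col_mx subrr opp_col_mx oppr0 opprB.
  rewrite enormN enorm_col0; apply: le_trans (dist_ymax _ _) _.
  rewrite ler_pM2r ?invr_gt0// -zt; apply: le_trans b1.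
  have -> : P *m g (zs + t *: w) = P *m (g (zs + t *: w) - t *: (H zs *m w)).
    by rewrite mulmxBr -scalemxAr Pw scaler0 subr0.
  exact: enorm_Pmx_le.
have b3 : enorm (g (zmax x) - g (zs + t *: w)) <= L * (rho / 2 * (t ^+ 2 * enorm w ^+ 2) / mu).
  have := sa_grad_lipschitz hf (zs + t *: w) (zmax x - (zs + t *: w)).
  rewrite [zs + t *: w + _]addrC subrK => /le_trans; apply.
  by rewrite ler_pM2l.
rewrite -dotpZr -dotpBr (le_trans (cauchy_schwarz _ _))//.
rewrite (_ : _ * enorm E * t ^+ 2
  = enorm E * ((L / mu + 1) * (rho / 2 * enorm w ^+ 2) * t ^+ 2)); last by ring.
rewrite ler_wpM2l//.
have -> : g (zmax x) - t *: (H zs *m w) =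
    (g (zmax x) - g (zs + t *: w)) + (g (zs + t *: w) - t *: (H zs *m w)).
  by rewrite addrA subrK.
rewrite (le_trans (enormD _ _))// (le_trans (lerD b3 b1))//.
by rewrite le_eqVlt; apply/orP; left; apply/eqP; ring.
Qed.

Lemma hess_Phi_quad (v : 'cV[R]_n) : dotp v (hess (Phi f) (usubmx zs) *m v)
  = dotp (W *m v) (H zs *m (W *m v)).
Proof.
rewrite hess_Phi; set q := H zs *m (W *m v).
have -> : usubmx (H zs *m W) *m v = usubmx q.
  by rewrite /q mulmxA -[in RHS](vsubmxK (H zs *m W)) mul_col_mx col_mxKu.
have q0 : dsubmx q = 0.
  have : P *m q = 0 by rewrite /q !mulmxA hY mul0mx.
  by rewrite Pmx_mul => /(congr1 dsubmx); rewrite col_mxKd linear0.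
by rewrite -[q in RHS]vsubmxK q0 W_mul dotp_col dotp0r addr0.
Qed.

End Tangent.
End AtCritical.
End Argmax.

End SecondOrder.

Section Nondegenerate.
Context {R : realType} {n m : nat} (f : 'cV[R]_(n + m) -> R) (mu L rho beta : R).
Context (hf : standing_assumptions f mu L rho) (hbeta : mu^-1 < beta).
Context (zs : 'cV[R]_(n + m)).
Notation P := (@Pmx R n m).
Notation g := (grad f).
Notation H := (hess f).
Notation h := (h_reg beta f).
Notation G := (grad (h_reg beta f)).

Let mu0 : 0 < mu := mu_gt0 hf.
Let L0 : 0 < L := L_gt0 hf.
Let rho0 : 0 < rho := rho_gt0 hf.
Let beta0 : 0 < beta := beta_gt0 hf hbeta.
Let gap0 : 0 < gap mu beta := gap_gt0 hf hbeta.

Lemma pd_lower_bound d (A : 'M[R]_d) : pd A ->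
  exists2 c, 0 < c & forall v, c * enorm v <= enorm (A *m v).
Proof.
move=> pdA.
have Aun : A \in unitmx.
  rewrite -row_free_unit; apply: inj_row_free => v vA.
  apply/eqP; apply: contrapT => /negP v0.
  have := pdA v^T; rewrite trmx_eq0 v0 => /(_ isT).
  by rewrite /dotp trmxK mulmxA vA mul0mx mxE ltxx.
have [K K0 hK] := mulmx_enorm_le (invmx A).
have K1 : 0 < K + 1 by rewrite ltr_wpDl.
exists (K + 1)^-1 => [|v]; first by rewrite invr_gt0.
rewrite mulrC ler_pdivrMr// mulrC -{1}[v](mulKmx Aun) (le_trans (hK _))//.
by rewrite ler_wpM2r// lerDl.
Qed.

(** With [p] the norm of a vector [S] of the [y]-space, [q] that of [P H S] and [d] the
    value of the quadratic form of [H] at [S]. *)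
Lemma block_bound (p q d : R) : 0 <= p -> 0 <= q -> d <= - mu * p ^+ 2 ->
  - (p * q) <= d -> gap mu beta * mu * p ^+ 2 <= d + beta * q ^+ 2.
Proof.
move=> p0 q0 hS h1.
have mD : mu * - d <= q ^+ 2.
  have [pz|pn0] := eqVneq p 0.
    have -> : d = 0.
      by apply/eqP; rewrite eq_le; move: h1 hS; rewrite pz mul0r expr0n /= mulr0 oppr0 => -> ->.
    by rewrite oppr0 mulr0 sqr_ge0.
  have pp : 0 < p ^+ 2 by rewrite exprn_gt0// lt_neqAle eq_sym pn0.
  have D0 : 0 <= - d by move: hS (mulr_ge0 (ltW mu0) (sqr_ge0 p)); lra.
  have D1 : (- d) ^+ 2 <= (p * q) ^+ 2.
    by apply: lerXn2r; rewrite ?nnegrE ?mulr_ge0//; lra.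
  have D2 : - d * (mu * p ^+ 2) <= - d * - d by apply: ler_wpM2l => //; lra.
  rewrite -(ler_pM2l pp); move: D1 D2; rewrite exprMn expr2; lra.
have m1 := ler_wpM2l (ltW beta0) mD.
have m2 : gap mu beta * (mu * p ^+ 2) <= gap mu beta * - d by rewrite ler_pM2l//; lra.
by move: m1 m2; rewrite /gap; lra.
Qed.

(** Split [w] as [W u - S], with [W u] tangent to the graph of the maximizer and [S] in
    the [y]-space: [Hbar] is the Hessian of [Phi] on the first part and at least
    [(beta * mu - 1) * mu] on the second, without cross terms. *)
Lemma Hbar_pd : SOSC f zs -> pd (Hbar beta f zs).
Proof.
move=> [gzs pdPhi] w w0.
have /choice [ymax ymaxP] := exists_maximizer hf.
have [Y hY] := exists_tangent hf zs.
set W := col_mx 1%:M Y in hY.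
set u := usubmx w; set s := Y *m u - dsubmx w; set S := col_mx (0 : 'cV[R]_n) s.
have wE : w = W *m u - S.
  rewrite /W W_mul -[LHS]vsubmxK /S opp_col_mx add_col_mx subr0 /s.
  by rewrite opprB addrCA subrr addr0.
have PS : P *m S = S by rewrite /S col_mxP0.
have PHW : P *m (H zs *m (W *m u)) = 0 by rewrite !mulmxA hY mul0mx.
have quadW : dotp (W *m u) (H zs *m (W *m u)) = dotp u (hess (Phi f) (usubmx zs) *m u).
  by rewrite (hess_Phi_quad hf ymaxP gzs hY).
have cross : dotp S (H zs *m (W *m u)) = 0.
  by rewrite -PS -dotp_PmxC PHW dotp0r.
have PHw : P *m (H zs *m w) = - (P *m (H zs *m S)).
  by rewrite wE !mulmxBr PHW sub0r.
have quad : dotp w (Hbar beta f zs *m w) = dotp u (hess (Phi f) (usubmx zs) *m u)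
    + dotp S (H zs *m S) + beta * enorm (P *m (H zs *m S)) ^+ 2.
  rewrite (Hbar_quad beta hf) PHw dotpNl dotpNr opprK -enorm_sqr.
  congr (_ + _); rewrite wE mulmxBr dotpBr !dotpBl quadW cross.
  by rewrite (hess_sym hf _ S) cross subr0 sub0r opprK.
have hS := hess_concave hf zs S; rewrite PS in hS.
have low : gap mu beta * mu * enorm S ^+ 2
    <= dotp S (H zs *m S) + beta * enorm (P *m (H zs *m S)) ^+ 2.
  have h1 := dotp_ge S (P *m (H zs *m S)); rewrite dotp_PmxC PS in h1.
  exact: block_bound (enorm_ge0 S) (enorm_ge0 _) hS h1.
have [u0|u0] := eqVneq u 0; last first.
  have := pdPhi u u0; have : 0 <= gap mu beta * mu * enorm S ^+ 2.
    by rewrite mulr_ge0 ?exprn_ge0// mulr_ge0// ltW.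
  by rewrite quad -addrA => h1 h2; apply: ltr_pwDl h2 (le_trans h1 low).
rewrite quad u0 dotp0l add0r; apply: lt_le_trans low.
apply: mulr_gt0; first exact: mulr_gt0.
rewrite exprn_gt0// lt_neqAle enorm_ge0 andbT eq_sym.
apply: contra_neq w0 => /enorm_eq0 S0.
by rewrite wE S0 u0 mulmx0 subrr.
Qed.

Section Sosc.
Context (sosc : SOSC f zs).

Let gzs : g zs = 0. Proof. by case: sosc. Qed.

Lemma sosc_G : G zs = 0.
Proof. by rewrite (grad_h_reg beta hf) gzs !mulmx0 scaler0 addr0. Qed.

(** [Hbar] is invertible and the first order part of the gradient of [h]. *)
Lemma sosc_growth : exists c del, [/\ 0 < c, 0 < del &
  forall e, enorm e <= del -> c * enorm e <= enorm (G (zs + e))].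
Proof.
have [c c0 hc] := pd_lower_bound (Hbar_pd sosc).
set K := (1 + beta * L) * (rho / 2) + beta * rho * L.
have K0 : 0 < K.
  by rewrite addr_gt0// !mulr_gt0// ?invr_gt0// addr_gt0// mulr_gt0.
exists (c / 2), (c / 2 / K); split; rewrite ?divr_gt0//.
move=> e he; have h1 := G_linearization hf hbeta sosc_G e; have h2 := hc e.
have h3 : K * enorm e ^+ 2 <= c / 2 * enorm e.
  by rewrite expr2 mulrA ler_wpM2r// mulrC -ler_pdivlMr.
move: h1 h2; rewrite -/K; move: (G (zs + e)) (Hbar beta f zs *m e) => g1 b1 h1 h2.
have := enormB g1 (g1 - b1); rewrite opprB addrC subrK; lra.
Qed.

(** The gradient of [h] grows linearly and [h] at most quadratically. *)
Lemma sosc_KL : KL_at h 2^-1 zs.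
Proof.
split; first by rewrite lexx invf_lt1// ltr1n.
have [c [del [c0 d0 hG]]] := sosc_growth.
set K := L / 2 + beta / 2 * L ^+ 2.
have K0 : 0 < K by rewrite addr_gt0 ?divr_gt0// mulr_gt0 ?divr_gt0// exprn_gt0.
have sK : 0 < Num.sqrt K by rewrite sqrtr_gt0.
exists [set x | enorm (x - zs) <= del]; split.
  by apply/nbhs_enormP; exists del => // y /ltW.
exists (c / Num.sqrt K); split; first exact: divr_gt0.
move=> x /= hx; have xE : zs + (x - zs) = x by rewrite addrC subrK.
have := hG _ hx; rewrite xE => h1.
rewrite powR12_sqrt// mulrAC ler_pdivrMr//.
apply: le_trans (ler_wpM2r (ltW sK) h1); rewrite -mulrA ler_pM2l//.
rewrite mulrC -[leRHS]ger0_norm ?mulr_ge0 ?sqrtr_ge0//; rewrite -[leRHS]sqrtr_sqr; apply: ler_wsqrtr.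
rewrite exprMn sqr_sqrtr; last exact: ltW.
have h2 := f_taylor1 hf zs (x - zs); rewrite xE gzs dotp0r subr0 in h2.
have := a_le_dist hf hbeta sosc_G (x - zs); rewrite xE => h3.
have hz : h zs = f zs by rewrite (critical_h hf hbeta sosc_G).
rewrite hz h_regE.
have h4 : enorm (P *m g x) ^+ 2 <= L ^+ 2 * enorm (x - zs) ^+ 2.
  by rewrite -exprMn lerXn2r// nnegrE// mulr_ge0// ltW.
have h5 := ler_wpM2l (ltW (divr_gt0 beta0 (ltr0n R 2))) h4.
have -> : f x + beta / 2 * enorm (P *m g x) ^+ 2 - f zs =
  (f x - f zs) + beta / 2 * enorm (P *m g x) ^+ 2 by rewrite addrAC.
rewrite (le_trans (ler_normD _ _))//.
have h6 : 0 <= beta / 2 * enorm (P *m g x) ^+ 2.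
  by rewrite mulr_ge0 ?exprn_ge0// ltW// divr_gt0.
rewrite (ger0_norm h6) /K [leRHS]mulrDl; apply: lerD h2 _.
by apply: le_trans h5 _; rewrite [leLHS]mulrA.
Qed.

End Sosc.

End Nondegenerate.

(** * Comparison of the growth of a cubic form at two consecutive iterates *)

Section ScalarComparison.
Context {R : realFieldType}.
Implicit Types (A B P i kappa r rho s t : R).

(** Convexity of [x `^ (3 / 2)], the left-hand side being the tangent at [A ^+ 2]. *)
Lemma cube_ge_tangent A j r : 0 <= A -> 0 <= j -> 0 <= r ->
  r ^+ 2 = A ^+ 2 + 2 * j -> A ^+ 3 + 3 * A * j <= r ^+ 3.
Proof.
move=> A0 j0 r0 E.
have h : 0 <= (r - A) ^+ 2 * (2 * r + A).
  by rewrite mulr_ge0 ?sqr_ge0 ?addr_ge0 ?mulr_ge0.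
have : r ^+ 3 - (A ^+ 3 + 3 * A * j) = (r - A) ^+ 2 * (2 * r + A) / 2.
  have -> : j = (r ^+ 2 - A ^+ 2) / 2 by rewrite E; field.
  by field.
by lra.
Qed.

(** With [x] the current direction and [z] the step, both scaled by the current distance,
    [P] is [T x x x / 6], [A = T x x z], [B = T x z z], [t = T z z z], [s] the norm of
    [z], [i] the inner product and [r] the norm of [x + z]: the ratio of the cubic form to
    the cube of the norm does not increase from [x] to [x + z]. The two equations are the
    optimality condition of the step tested against [x] and [z], the universally
    quantified inequality its second order condition in the plane of [x] and [z], and the
    two last bounds come from [`|T u v w| <= rho * |u| * |v| * |w|] at [(z, z, z)] and at
    [(z, z + s x, z + s x)].
    For [s < 1 / 2] the difference of both sides, bounded below with [cube_ge_tangent] at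
    [A = 1 - s], is [lam * Q] plus nonnegative multiples of [j = i + s], where [Q] is the
    consequence [iq] of the second order condition; hence equality forces [j = 0]. For
    [s >= 1 / 2] the value drops by a factor [1 / 4], the norm by less. *)
Lemma cubic_contraction rho kappa P A B t s i r :
    0 < rho -> 1 < kappa -> 0 < P -> 0 < s -> 0 <= r -> r ^+ 2 = 1 + 2 * i + s ^+ 2 ->
    A + kappa * rho * s * i + 3 * P = 0 ->
    B + kappa * rho * s * s ^+ 2 + A / 2 = 0 ->
    (forall c, 0 <= c ^+ 2 * (6 * P) + 2 * c * A + B
       + kappa * rho * s * (c ^+ 2 + 2 * c * i + s ^+ 2)) ->
    6 * P <= rho -> - s <= i -> t <= rho * s ^+ 3 ->
    t + 2 * s * B + s ^+ 2 * A <= rho * s * (2 * s ^+ 2 + 2 * s * i) ->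
  [/\ 2^-1 <= r, (6 * P + 3 * A + 3 * B + t) / 6 <= P * r ^+ 3
    & (6 * P + 3 * A + 3 * B + t) / 6 = P * r ^+ 3 -> i = - s /\ r < 1].
Proof.
move=> rho0 k1 P0 s0 r0 r2 hA hB hpsd Pr is_ t3 tB.
pose sg := kappa * rho * s; rewrite -/sg in hA hB hpsd.
have rs0 : 0 < rho * s by rewrite mulr_gt0.
have sg_gt : rho * s < sg.
  by rewrite /sg -mulrA -[ltLHS]mul1r ltr_pM2r.
have sg0 : 0 < sg by exact: lt_trans sg_gt.
clearbody sg.
have {}hA : A = - (sg * i) - 3 * P by lra.
have {}hB : B = - (sg * s ^+ 2) + sg * i / 2 + 3 / 2 * P by lra.
have q0 : 0 < 6 * P + sg by lra.
(* the minimizing multiplier in the second order condition *)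
have iq : - 3 * P <= i * (6 * P + sg).
  have := hpsd (3 * P / (6 * P + sg)); set c := 3 * P / _.
  have cq : c * (6 * P + sg) = 3 * P by rewrite /c divfK// gt_eqF.
  have c0 : 0 < c by rewrite /c divr_gt0// mulr_gt0.
  have -> : c ^+ 2 * (6 * P) + 2 * c * A + B + sg * (c ^+ 2 + 2 * c * i + s ^+ 2)
    = c * (c * (6 * P + sg)) - 6 * P * c + (sg * i + 3 * P) / 2.
    by rewrite hA hB; field.
  rewrite cq => h.
  have h2 : 6 * P * c <= sg * i + 3 * P by lra.
  have h3 : 6 * P * (c * (6 * P + sg)) <= (sg * i + 3 * P) * (6 * P + sg).
    by rewrite mulrA; apply: ler_wpM2r h2; exact: ltW.
  rewrite cq in h3.
  by rewrite -(ler_pM2l sg0); move: h3; lra.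
have [s12|s12] := ltP s 2^-1; last first.
  have Ps : P < sg / 3.
    have : rho / 2 <= rho * s by rewrite ler_pM2l.
    by lra.
  have i3 : - 3^-1 <= i.
    rewrite leNgt; apply/negP => lt; have : i * (6 * P + sg) < - 3^-1 * (6 * P + sg).
      by rewrite ltr_pM2r.
    by lra.
  have ss : 4^-1 <= s ^+ 2 by rewrite (_ : 4^-1 = 2^-1 ^+ 2 :> R); [rewrite lerXn2r ?nnegrE//; lra|field].
  have rr : 7 / 12 <= r ^+ 2 by rewrite r2; lra.
  have r12 : 3 / 4 <= r.
    by rewrite leNgt; apply/negP => lt; have : r ^+ 2 < (3 / 4) ^+ 2; [rewrite ltrXn2r// ?nnegrE//; lra|lra].
  have r3 : (3 / 4) ^+ 3 <= r ^+ 3 by rewrite lerXn2r ?nnegrE//; lra.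
  have low : (6 * P + 3 * A + 3 * B + t) / 6 <= P / 4.
    have h1 : - (sg * i) <= sg / 3 by rewrite -mulrN ler_pM2l//; lra.
    have h2 : rho * s ^+ 3 <= sg * s ^+ 2.
      by rewrite exprS mulrA ler_wpM2r ?sqr_ge0// ltW.
    have h3 : sg / 4 <= sg * s ^+ 2 by rewrite ler_pM2l.
    by rewrite hA hB; lra.
  have hi : P * (3 / 4) ^+ 3 <= P * r ^+ 3 by rewrite ler_pM2l.
  by split; lra.
pose j := i + s; have j0 : 0 <= j by rewrite /j; lra.
have iE : i = j - s by rewrite /j addrK.
have rj : r ^+ 2 = (1 - s) ^+ 2 + 2 * j by rewrite r2 iE; ring.
have s1 : 0 <= 1 - s by lra.
have cube := cube_ge_tangent s1 j0 r0 rj.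
have r12 : 1 - s <= r.
  by rewrite leNgt; apply/negP => lt; have : r ^+ 2 < (1 - s) ^+ 2; [rewrite ltrXn2r// ?nnegrE|lra].
pose lam := 4^-1 - s / 3 + s ^+ 2 / 6.
have lam0 : 0 <= lam by rewrite /lam; have := sqr_ge0 s; lra.
have Q0 : 0 <= j * (6 * P + sg) - s * sg + 3 * P * (1 - 2 * s).
  by move: iq; rewrite iE; lra.
have t1 := mulr_ge0 lam0 Q0.
have t2 : 0 <= j * (sg * s * (1 - 2 * s) / 6 + s * (sg - rho * s) / 3).
  rewrite mulr_ge0// addr_ge0// divr_ge0// mulr_ge0//; try lra.
  by rewrite mulr_ge0// ltW.
have w0 : 0 < P * (3 / 2 - s - s ^+ 2).
  by rewrite mulr_gt0//; have : s ^+ 2 < 2^-1 ^+ 2; [rewrite ltrXn2r// ?nnegrE//; lra|lra].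
have t4 : 0 <= j * (P * (3 / 2 - s - s ^+ 2)) by rewrite mulr_ge0// ltW.
have cert : (6 * P + 3 * A + 3 * B + t) / 6
    + j * (P * (3 / 2 - s - s ^+ 2)) <= P * ((1 - s) ^+ 3 + 3 * (1 - s) * j).
  have : P * ((1 - s) ^+ 3 + 3 * (1 - s) * j)
    - (6 * P + 3 * A + 3 * B + (rho * s * (2 * s ^+ 2 + 2 * s * i) - 2 * s * B - s ^+ 2 * A)) / 6
   = lam * (j * (6 * P + sg) - s * sg + 3 * P * (1 - 2 * s))
   + j * (sg * s * (1 - 2 * s) / 6 + s * (sg - rho * s) / 3) + j * (P * (3 / 2 - s - s ^+ 2)).
    by rewrite /lam hA hB iE; field.
  by lra.
have hi : P * ((1 - s) ^+ 3 + 3 * (1 - s) * j) <= P * r ^+ 3 by rewrite ler_pM2l.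
split; [lra|lra|move=> E].
have j00 : j = 0.
  apply: le_anti; rewrite j0 andbT leNgt; apply/negP => jp.
  by have := mulr_gt0 jp w0; lra.
split; first by move: j00; rewrite /j; lra.
rewrite -(ltr_pXn2r (n := 2)) ?nnegrE//; rewrite rj j00 expr1n mulr0 addr0.
by rewrite exprn_ilt1//; lra.
Qed.

End ScalarComparison.

(** * Third order expansions at a critical point *)

Section Trilinear.
Context {R : realType} {N : nat} (C : 'I_N -> 'I_N -> 'I_N -> R).
Notation T := (trilinear C).

Lemma trilinearD u v w w' : T u v (w + w') = T u v w + T u v w'.
Proof.
rewrite /trilinear -big_split; apply: eq_bigr => i _ /=.
rewrite -big_split; apply: eq_bigr => j _ /=.
by rewrite -big_split; apply: eq_bigr => k _ /=; rewrite mxE mulrDr.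
Qed.

Lemma trilinearZ a u v w : T u v (a *: w) = a * T u v w.
Proof.
rewrite /trilinear mulr_sumr; apply: eq_bigr => i _.
rewrite mulr_sumr; apply: eq_bigr => j _; rewrite mulr_sumr; apply: eq_bigr => k _.
by rewrite mxE mulrCA.
Qed.

Lemma trilinear_sym12 : (forall i j k, C i j k = C j i k) ->
  forall u v w, T u v w = T v u w.
Proof.
move=> s u v w; rewrite /trilinear exchange_big /=; apply: eq_bigr => j _.
apply: eq_bigr => i _; apply: eq_bigr => k _.
by rewrite s -!mulrA (mulrCA (u i 0)).
Qed.

Lemma trilinear_sym23 : (forall i j k, C i j k = C i k j) ->
  forall u v w, T u v w = T u w v.
Proof.
move=> s u v w; rewrite /trilinear; apply: eq_bigr => i _.
rewrite exchange_big /=; apply: eq_bigr => k _; apply: eq_bigr => j _.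
by rewrite s mulrAC.
Qed.

End Trilinear.

Lemma sum_const2 {R : realType} N (c : R) :
  \sum_(i < N) \sum_(j < N) c = c * N%:R ^+ 2.
Proof. by rewrite !sumr_const !card_ord -(mulr_natr (c *+ N)) -(mulr_natr c) expr2 mulrA. Qed.

Lemma is_derive_cube {R : realType} (c t : R) :
  is_derive t 1 (fun s : R => s ^+ 3 / 6 * c) (t ^+ 2 / 2 * c).
Proof.
have -> : (fun s : R => s ^+ 3 / 6 * c) = (c / 6) *: (id ^+ 3 : R -> R).
  by apply/funext => s; rewrite !fctE /GRing.scale /=; ring.
by apply: is_derive_eq; rewrite /GRing.scale /= mulr1 -mulr_natr; field.
Qed.

Lemma coord_expansion {R : realType} N (A : 'cV[R]_N -> 'M[R]_N) (F : 'cV[R]_N -> R)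
    i j (c : 'I_N -> R) z eps :
  (forall x, A x i j = F x) -> (forall k, c k = grad F z k 0) -> differentiable F z ->
  0 < eps -> exists2 del, 0 < del & forall e, enorm e <= del ->
    `|A (z + e) i j - A z i j - \sum_k c k * e k 0| <= eps * enorm e.
Proof.
move=> AE cE dF e0; have [del d0 hd] := differentiable_expansion dF e0.
exists del => // e /hd; rewrite dotpE !AE.
by under eq_bigr do rewrite -cE.
Qed.

Section ThirdOrder.
Context {R : realType} {n m : nat} (f : 'cV[R]_(n + m) -> R) (mu L rho : R).
Context (hf : standing_assumptions f mu L rho) (zs : 'cV[R]_(n + m)).
Implicit Types (e u v w : 'cV[R]_(n + m)).
Notation g := (grad f).
Notation H := (hess f).

Definition third (i j k : 'I_(n + m)) : R :=
  'D_(basis_vec k) ('D_(basis_vec j) ('D_(basis_vec i) f)) zs.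
Notation T := (trilinear third).

Lemma third_sym12 u v w : T u v w = T v u w.
Proof.
apply: (@trilinear_sym12 _ _ third) => i j k.
have E : 'D_(basis_vec j) ('D_(basis_vec i) f) = 'D_(basis_vec i) ('D_(basis_vec j) f).
  by apply/funext => z; exact (D2C hf (basis_vec i) (basis_vec j) z).
exact (congr1 (fun F => 'D_(basis_vec k) F zs) E).
Qed.

Lemma third_sym23 u v w : T u v w = T u w v.
Proof.
apply: (@trilinear_sym23 _ _ third) => i j k.
exact (derive_symmetric (diff_D1 hf _) (diff_D2 hf _ _ zs) (diff_D2 hf _ _ zs)).
Qed.

Lemma third_scale2 u v x (p q : R) : T u (p *: v) (q *: x) = p * q * T u v x.
Proof.
by rewrite trilinearZ third_sym23 trilinearZ third_sym23 mulrA [q * p]mulrC.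
Qed.

Lemma third_cubeZ u (p : R) : T (p *: u) (p *: u) (p *: u) = p ^+ 3 * T u u u.
Proof.
by rewrite third_scale2 third_sym12 third_sym23 trilinearZ; ring.
Qed.

Lemma third_sqrD u v x : T u (v + x) (v + x) = T u v v + 2 * T u v x + T u x x.
Proof.
rewrite trilinearD (third_sym23 u (v + x) v) (third_sym23 u (v + x) x).
rewrite !trilinearD (third_sym23 u x v); ring.
Qed.

Lemma third_cubeD u v : T (u + v) (u + v) (u + v)
  = T u u u + 3 * T u u v + 3 * T u v v + T v v v.
Proof.
have E x y : T (u + v) x y = T x y u + T x y v.
  by rewrite third_sym12 third_sym23 trilinearD.
rewrite third_sqrD !E (third_sym23 u v u) (third_sym23 v v u).
rewrite (third_sym12 v u v); ring.
Qed.

Lemma hess_coord z i j : H z i j = 'D_(basis_vec j) ('D_(basis_vec i) f) z.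
Proof. by rewrite mxE. Qed.

Lemma hess_coord_expansion i j eps : 0 < eps -> exists2 del, 0 < del &
  forall e, enorm e <= del ->
    `|H (zs + e) i j - H zs i j - \sum_k third i j k * e k 0| <= eps * enorm e.
Proof.
move=> e0.
have thirdE k : third i j k = grad ('D_(basis_vec j) ('D_(basis_vec i) f)) zs k 0.
  by rewrite mxE.
exact (coord_expansion (fun z => hess_coord z i j) thirdE (diff_D2 hf _ _ zs) e0).
Qed.

(** The entries of the Hessian are differentiable at [zs]; their number is absorbed into
    the choice of [e1]. *)
Lemma hess_expansion eps : 0 < eps -> exists2 del, 0 < del & forall e, enorm e <= del ->
  forall u v, `|dotp u (H (zs + e) *m v) - dotp u (H zs *m v) - T u v e|
    <= eps * enorm e * enorm u * enorm v.
Proof.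
move=> e0; pose N : R := (n + m)%:R; pose e1 := eps / (N ^+ 2 + 1).
have N1 : 0 < N ^+ 2 + 1 by rewrite ltr_wpDl ?sqr_ge0.
have e10 : 0 < e1 by rewrite divr_gt0.
have /choice [del hdel] : forall ij : 'I_(n + m) * 'I_(n + m), exists del : R,
    0 < del /\ forall e, enorm e <= del ->
    `|H (zs + e) ij.1 ij.2 - H zs ij.1 ij.2 - \sum_k third ij.1 ij.2 k * e k 0|
      <= e1 * enorm e.
  by move=> [i j]; have [d d0 hd] := hess_coord_expansion i j e10; exists d.
exists (\big[Num.min/1]_ij del ij).
  by apply: lt_bigmin => // ij _; case: (hdel ij).
move=> e he u v.
have {}hdel i j : `|H (zs + e) i j - H zs i j - \sum_k third i j k * e k 0| <= e1 * enorm e.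
  apply: (hdel (i, j)).2; apply: le_trans he _; exact: bigmin_le_cond.
move: (H (zs + e)) (H zs) hdel => A B hAB.
have -> : dotp u (A *m v) - dotp u (B *m v) - T u v e
  = \sum_i \sum_j u i 0 * v j 0 * (A i j - B i j - \sum_k third i j k * e k 0).
  rewrite !dotpE /trilinear -!sumrB; apply: eq_bigr => i _.
  rewrite !mxE !mulr_sumr -!sumrB; apply: eq_bigr => j _.
  rewrite !mulrBr; congr (_ - _ - _); [ring|ring|].
  by rewrite mulr_sumr; apply: eq_bigr => k _; ring.
have term i j : `|u i 0 * v j 0 * (A i j - B i j - \sum_k third i j k * e k 0)|
   <= e1 * enorm e * enorm u * enorm v.
  rewrite !normrM (_ : e1 * _ * _ * _ = enorm u * enorm v * (e1 * enorm e)); last by ring.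
  by apply: ler_pM => //; apply: ler_pM => //; exact: abs_coord_le_enorm.
apply: (@le_trans _ _ (\sum_(i < n + m) \sum_(j < n + m) (e1 * enorm e * enorm u * enorm v))).
  rewrite (le_trans (ler_norm_sum _ _ _))//; apply: ler_sum => i _.
  by rewrite (le_trans (ler_norm_sum _ _ _))//; apply: ler_sum => j _.
rewrite sum_const2 (_ : e1 * enorm e * enorm u * enorm v * _ = e1 * N ^+ 2 * (enorm e * enorm u * enorm v)); last by ring.
rewrite (_ : eps * _ * _ * _ = eps * (enorm e * enorm u * enorm v)); last by ring.
apply: ler_wpM2r; first by rewrite !mulr_ge0.
by rewrite /e1 mulrAC ler_pdivrMr// ler_pM2l// lerDl.
Qed.

(** The derivative of a [rho]-Lipschitz function: compare [hess_expansion] with the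
    Lipschitz bound at [t *: w], divide by [t], and let [eps] tend to [0]. *)
Lemma third_bound u v w : `|T u v w| <= rho * enorm u * enorm v * enorm w.
Proof.
set M := enorm u * enorm v * enorm w.
have M0 : 0 <= M by rewrite !mulr_ge0.
have M1 : 0 < M + 1 by rewrite ltr_wpDl.
have w1 : 0 < enorm w + 1 by rewrite ltr_wpDl.
rewrite (_ : rho * _ * _ * _ = rho * M); last by rewrite /M; ring.
apply/ler_addgt0Pl => eps e0.
have [del d0 hd] := hess_expansion (divr_gt0 e0 M1).
pose t := del / (enorm w + 1); have t0 : 0 < t by rewrite divr_gt0.
have tw : enorm (t *: w) <= del.
  by rewrite enormZ gtr0_norm// /t mulrAC ler_pdivrMr// ler_pM2l// lerDl.
have scal (a b c X Y Z : R) : `|a - b - t * c| <= X -> `|a - b| <= Y ->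
    X + Y <= t * Z -> `|c| <= Z.
  move=> h1 h2 h3; rewrite -(ler_pM2l t0) -{1}(gtr0_norm t0) -normrM.
  rewrite -[t * c](subKr (a - b)); apply: le_trans (ler_normB _ _) _.
  by rewrite addrC; apply: le_trans (lerD h1 h2) h3.
have h1 := hd _ tw u v; rewrite trilinearZ in h1.
apply: (scal _ _ _ _ _ _ h1 (hess_lip_dual hf zs (t *: w) u v)).
have h4 : eps / (M + 1) * M <= eps by rewrite mulrAC ler_pdivrMr// ler_pM2l// lerDl.
have {h4} := ler_wpM2l (ltW t0) h4; rewrite enormZ (gtr0_norm t0) /M; lra.
Qed.

Context (gzs : g zs = 0).

(** Integration of [hess_expansion] along a segment; [f_expansion] is obtained from
    [grad_expansion] in the same way. *)
Lemma grad_expansion eps : 0 < eps -> exists2 del, 0 < del & forall e, enorm e <= del ->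
  forall v, `|dotp v (g (zs + e)) - dotp v (H zs *m e) - T v e e / 2|
    <= eps * enorm e ^+ 2 * enorm v.
Proof.
move=> e0; have [del d0 hd] := hess_expansion e0; exists del => // e he v.
pose phi t := dotp v (g (zs + t *: e)) - t * dotp v (H zs *m e) - t ^+ 2 / 2 * T v e e.
pose dphi t := dotp v (H (zs + t *: e) *m e) - dotp v (H zs *m e) - t * T v e e.
have := @taylor_abs _ phi dphi (eps * enorm e ^+ 2 * enorm v) 1.
rewrite /phi scale1r scale0r addr0 mul1r mul0r expr1n expr0n /= !mul0r gzs dotp0r !subr0.
rewrite mul1r [2^-1 * _]mulrC => h; apply: le_trans (h _ _) _ => [t tI|t /andP[t0 t1]|].
- apply: is_deriveB; last exact: is_derive_half_sqr.
  by apply: is_deriveB; [exact: (is_derive_g_line hf)|exact: is_derive_mulc].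
- have te : enorm (t *: e) <= del.
    by apply: le_trans he; rewrite enormZ ger0_norm// ler_piMl.
  have := hd _ te v e; rewrite trilinearZ enormZ (ger0_norm t0) => /le_trans; apply.
  by rewrite le_eqVlt; apply/orP; left; apply/eqP; ring.
have : 0 <= eps * enorm e ^+ 2 * enorm v by rewrite !mulr_ge0// ltW.
by lra.
Qed.

Lemma f_expansion eps : 0 < eps -> exists2 del, 0 < del & forall e, enorm e <= del ->
  `|f (zs + e) - f zs - dotp e (H zs *m e) / 2 - T e e e / 6| <= eps * enorm e ^+ 3.
Proof.
move=> e0; have [del d0 hd] := grad_expansion e0; exists del => // e he.
pose phi t := f (zs + t *: e) - t ^+ 2 / 2 * dotp e (H zs *m e) - t ^+ 3 / 6 * T e e e.
pose dphi t := dotp e (g (zs + t *: e)) - t * dotp e (H zs *m e) - t ^+ 2 / 2 * T e e e.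
have := @taylor_abs _ phi dphi (eps * enorm e ^+ 3) 2.
rewrite /phi scale1r scale0r addr0 !expr1n !expr0n /= !mul0r !subr0 => h.
have -> : f (zs + e) - f zs - dotp e (H zs *m e) / 2 - T e e e / 6
  = f (zs + e) - 1 / 2 * dotp e (H zs *m e) - 1 / 6 * T e e e - f zs by field.
apply: le_trans (h _ _) _ => [t tI|t /andP[t0 t1]|].
- apply: is_deriveB; last exact: is_derive_cube.
  by apply: is_deriveB; [exact: (is_derive_f_line hf)|exact: is_derive_half_sqr].
- have te : enorm (t *: e) <= del.
    by apply: le_trans he; rewrite enormZ ger0_norm// ler_piMl.
  have := hd _ te e; rewrite trilinearZ third_sym23 trilinearZ -scalemxAr dotpZr.
  rewrite enormZ (ger0_norm t0) /dphi => h1.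
  rewrite (_ : t ^+ 2 / 2 * T e e e = t * (t * T e e e) / 2); last by ring.
  by apply: le_trans h1 _; rewrite le_eqVlt; apply/orP; left; apply/eqP; ring.
have : 0 <= eps * enorm e ^+ 3 by rewrite !mulr_ge0// ltW.
by lra.
Qed.

End ThirdOrder.

(** * Limits along an ultrafilter *)

Section UltraLimits.
Context {R : realType} (F : set_system nat) (UF : UltraFilter F).
Implicit Types (a b x y : R) (u v : nat -> R).

(** Along an ultrafilter all bounded sequences converge, so that no subsequences need to
    be extracted to pass to the limit in several of them at once. *)
Lemma ultra_bounded u (M : R) : (forall k, `|u k| <= M) -> exists l : R, u @ F --> l.
Proof.
move=> hM; have FI : (u @ F) `[- M, M]%classic.
  apply: (@filterE _ F) => k; rewrite /= in_itv /= -ler_norml; exact: hM.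
have [p [_ hp]] := @segment_compact R (- M) M (u @ F) _ FI.
exists p => A nA; have [FA|FnA] := @in_ultra_setVsetC nat F (u @^-1` A) UF; first exact: FA.
by have [q []] := hp (~` A)%classic A FnA nA.
Qed.

Lemma cvg_bigsum (I : Type) (s : seq I) (U : I -> nat -> R) (l : I -> R) :
  (forall i, U i @ F --> l i) ->
  (fun k => \sum_(i <- s) U i k) @ F --> \sum_(i <- s) l i.
Proof.
move=> h; elim: s => [|i s IH].
  rewrite big_nil (_ : (fun k => _) = fun=> 0); last by apply/funext => k; rewrite big_nil.
  exact: cvg_cst.
rewrite big_cons (_ : (fun k => _) = U i + (fun k => \sum_(j <- s) U j k)); last first.
  by apply/funext => k; rewrite big_cons.
exact: cvgD.
Qed.

(** Convergence of coordinates, the form in which [ultra_bounded] provides limits of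
    vectors and in which polynomial expressions pass to the limit. *)
Definition vcvg d (u : nat -> 'cV[R]_d) (l : 'cV[R]_d) :=
  forall i, (fun k => u k i 0) @ F --> l i 0.

Section Vectors.
Context {d : nat}.
Implicit Types (p q r : nat -> 'cV[R]_d) (l m : 'cV[R]_d).

Lemma vcvg_bounded p (M : R) : (forall k, enorm (p k) <= M) -> exists l, vcvg p l.
Proof.
move=> hM; have /choice [l hl] : forall i, exists l : R, (fun k => p k i 0) @ F --> l.
  move=> i; apply: (@ultra_bounded _ M) => k.
  exact: le_trans (abs_coord_le_enorm _ _) (hM k).
by exists (\col_i l i) => i; rewrite mxE.
Qed.

Lemma vcvg_cst l : vcvg (fun=> l) l.
Proof. by move=> i; exact: cvg_cst. Qed.

Lemma vcvgD p q l m : vcvg p l -> vcvg q m -> vcvg (fun k => p k + q k) (l + m).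
Proof.
move=> hp hq i; rewrite mxE (_ : (fun k => _) = (fun k => p k i 0) + (fun k => q k i 0)).
  exact: cvgD (hp i) (hq i).
by apply/funext => k; rewrite mxE.
Qed.

Lemma vcvg_mulmx e (A : 'M[R]_(e, d)) p l : vcvg p l -> vcvg (fun k => A *m p k) (A *m l).
Proof.
move=> hp i; rewrite mxE (_ : (fun k => _) = (fun k => \sum_j (fun k => A i j * p k j 0) k)).
  by apply: cvg_bigsum => j; apply: cvgM (hp j); exact: cvg_cst.
by apply/funext => k; rewrite mxE.
Qed.

Lemma vcvg_dotp p q l m : vcvg p l -> vcvg q m ->
  (fun k => dotp (p k) (q k)) @ F --> dotp l m.
Proof.
move=> hp hq; rewrite dotpE.
rewrite (_ : (fun k => _) = (fun k => \sum_j (fun k => p k j 0 * q k j 0) k)).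
  by apply: cvg_bigsum => j; exact: cvgM (hp j) (hq j).
by apply/funext => k; rewrite dotpE.
Qed.

Lemma vcvg_enorm p l : vcvg p l -> (fun k => enorm (p k)) @ F --> enorm l.
Proof.
move=> hp; rewrite enormE (_ : (fun k => _) = (fun k => Num.sqrt (dotp (p k) (p k)))).
  by apply: cvg_comp (vcvg_dotp hp hp) _; exact: sqrt_continuous.
by apply/funext => k; rewrite enormE.
Qed.

Lemma vcvg_trilinear C p q r l m (o : 'cV[R]_d) : vcvg p l -> vcvg q m -> vcvg r o ->
  (fun k => trilinear C (p k) (q k) (r k)) @ F --> trilinear C l m o.
Proof.
move=> hp hq hr; rewrite /trilinear; apply: cvg_bigsum => i; apply: cvg_bigsum => j.
apply: cvg_bigsum => k; apply: cvgM (hr k); apply: cvgM (hq j).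
by apply: cvgM (hp i); exact: cvg_cst.
Qed.

End Vectors.

Lemma cvg_squeeze0 u (v : nat -> R) : (\forall k \near F, `|u k| <= v k) -> v @ F --> 0 -> u @ F --> 0.
Proof.
move=> huv hv; apply/cvgr0Pnorm_le => e e0.
have h := (cvgr0Pnorm_le _).1 hv e e0; near=> k.
have h1 : `|u k| <= v k by near: k.
apply: le_trans h1 (le_trans (ler_norm _) _); near: k; exact: h.
Unshelve. all: by end_near. Qed.

Lemma cvg_eq u a b : u @ F --> a -> u @ F --> b -> a = b.
Proof. by move=> ha hb; exact: (cvg_unique (@Rhausdorff R) ha hb). Qed.

End UltraLimits.

(** * Blow-up of the steps at the limit point *)

Section BlowUp.
Context {R : realType} {n m : nat} (f : 'cV[R]_(n + m) -> R) (mu L rho beta : R).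
Context (hf : standing_assumptions f mu L rho) (hbeta : mu^-1 < beta).
Context (zs : 'cV[R]_(n + m)) (Gzs : grad (h_reg beta f) zs = 0).
Implicit Types (e u v w x : 'cV[R]_(n + m)).
Notation P := (@Pmx R n m).
Notation g := (grad f).
Notation H := (hess f).
Notation h := (h_reg beta f).
Notation G := (grad (h_reg beta f)).
Notation a z := (enorm (P *m grad f z)).
Notation kappa := (3 * beta * L + 1).
Notation T := (trilinear (third f zs)).

Let mu0 : 0 < mu := mu_gt0 hf.
Let L0 : 0 < L := L_gt0 hf.
Let rho0 : 0 < rho := rho_gt0 hf.
Let beta0 : 0 < beta := beta_gt0 hf hbeta.
Let gap0 : 0 < gap mu beta := gap_gt0 hf hbeta.
Let kr : 0 < kappa * rho := kr0 hf hbeta.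
Let gzs : g zs = 0 := critical_grad hf hbeta Gzs.

Lemma dist_sub0 (p q t A : R) : q = 0 -> `|p - q - t| <= A -> `|p - t| <= A.
Proof. by move=> ->; rewrite subr0. Qed.

Lemma kernel_hess e v : H zs *m v = 0 -> enorm (H (zs + e) *m v) <= rho * enorm e * enorm v.
Proof.
have aux (p q : 'cV[R]_(n + m)) c : q = 0 -> enorm (p - q) <= c -> enorm p <= c.
  by move=> ->; rewrite subr0.
by move=> Hv; exact (aux _ _ _ Hv (hess_lip hf zs e v)).
Qed.

Lemma hess_near e x :
  enorm (H (zs + e) *m x) <= enorm (H zs *m x) + rho * enorm e * enorm x.
Proof.
have aux (p q : 'cV[R]_(n + m)) c : enorm (p - q) <= c -> enorm p <= enorm q + c.
  by move=> h1; rewrite -[p in leLHS](subrK q) addrC (le_trans (enormD _ _))// lerD2l.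
exact (aux _ _ _ (hess_lip hf zs e x)).
Qed.

(** On the kernel of the Hessian the linear terms of the optimality condition vanish, and
    what is left is of second order: the right-hand side is negligible with respect to
    the square of the distance when [eps] and [H zs *m x] are small and the partial
    gradient in [y] is of second order. *)
Lemma step_kernel_expansion eps e x v : 0 <= eps ->
    is_step f L rho beta (zs + e) x -> H zs *m v = 0 ->
    `|dotp v (g (zs + e)) - dotp v (H zs *m e) - T v e e / 2|
      <= eps * enorm e ^+ 2 * enorm v ->
    `|dotp v (H (zs + e) *m x) - dotp v (H zs *m x) - T v x e|
      <= eps * enorm e * enorm v * enorm x ->
  `|T v e e / 2 + T v x e + kappa * rho * enorm x * dotp v x|
    <= enorm v * (eps * enorm e ^+ 2 + eps * enorm e * enorm x
        + beta * rho * enorm e * a (zs + e)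
        + beta * rho * enorm e * (enorm (H zs *m x) + rho * enorm e * enorm x)
        + 2 * beta * rho * a (zs + e) * enorm x).
Proof.
move=> eps0 st Hv h1 h2; have hH : enorm (H (zs + e) *m v) <= rho * enorm e * enorm v.
  exact: kernel_hess.
have hx := hess_near e x.
have [E _] := step_optimality hf hbeta st.
have {}E : dotp v (g (zs + e)) + beta * dotp (H (zs + e) *m v) (P *m g (zs + e))
    + (dotp v (H (zs + e) *m x)
       + beta * dotp (P *m (H (zs + e) *m v)) (P *m (H (zs + e) *m x)))
    + (2 * beta * rho * a (zs + e) + kappa * rho * enorm x) * dotp v x = 0.
  have := congr1 (dotp v) E; rewrite dotp0r !dotpDr dotpZr.
  rewrite (Hbar_quad beta hf) (grad_h_reg beta hf) dotpDr dotpZr.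
  by rewrite (hess_sym hf v (P *m _)) (dotpC (P *m _)).
have vE w : dotp v (H zs *m w) = 0 by rewrite (hess_sym hf) Hv dotp0r.
have {}h1 := dist_sub0 (vE e) h1; have {}h2 := dist_sub0 (vE x) h2.
have S0 : 0 <= rho * enorm e * enorm v by rewrite !mulr_ge0// ltW.
have q1 : `|dotp (H (zs + e) *m v) (P *m g (zs + e))| <= rho * enorm e * enorm v * a (zs + e).
  by rewrite (le_trans (cauchy_schwarz _ _))// ler_wpM2r.
have q2 : `|dotp (P *m (H (zs + e) *m v)) (P *m (H (zs + e) *m x))|
    <= rho * enorm e * enorm v * (enorm (H zs *m x) + rho * enorm e * enorm x).
  rewrite (le_trans (cauchy_schwarz _ _))//.
  apply: le_trans (ler_wpM2r (enorm_ge0 _) (le_trans (enorm_Pmx_le _) hH)) _.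
  by rewrite ler_wpM2l// (le_trans (enorm_Pmx_le _)).
have d1 := cauchy_schwarz v x.
have scal (p1 p2 y1 y2 d t1 t2 A1 A2 Q1 Q2 D c al : R) : 0 <= al ->
    p1 + beta * y1 + (p2 + beta * y2) + (al + c) * d = 0 -> `|p1 - t1| <= A1 ->
    `|p2 - t2| <= A2 -> `|y1| <= Q1 -> `|y2| <= Q2 -> `|d| <= D ->
    `|t1 + t2 + c * d| <= A1 + A2 + beta * Q1 + beta * Q2 + al * D.
  clear - beta0 => al0 E1 e1 e2 e3 e4 e5.
  have -> : t1 + t2 + c * d = - ((p1 - t1) + (p2 - t2) + beta * y1 + beta * y2 + al * d).
    by lra.
  rewrite normrN (le_trans (ler_normD _ _))// lerD//; last first.
    by rewrite normrM (ger0_norm al0) ler_wpM2l.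
  rewrite (le_trans (ler_normD _ _))// lerD//; last first.
    by rewrite normrM (gtr0_norm beta0) ler_pM2l.
  rewrite (le_trans (ler_normD _ _))// lerD//; last first.
    by rewrite normrM (gtr0_norm beta0) ler_pM2l.
  by rewrite (le_trans (ler_normD _ _))// lerD.
have al0 : 0 <= 2 * beta * rho * a (zs + e).
  by rewrite mulr_ge0// !mulr_ge0// ltW.
apply: le_trans (scal _ _ _ _ _ _ _ _ _ _ _ _ _ _ al0 E h1 h2 q1 q2 d1) _.
by rewrite le_eqVlt; apply/orP; left; apply/eqP; ring.
Qed.

Lemma step_kernel_psd eps e x v : is_step f L rho beta (zs + e) x -> H zs *m v = 0 ->
    `|dotp v (H (zs + e) *m v) - dotp v (H zs *m v) - T v v e|
      <= eps * enorm e * enorm v * enorm v ->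
  0 <= T v v e + kappa * rho * enorm x * enorm v ^+ 2 + enorm v ^+ 2 *
    (eps * enorm e + beta * rho ^+ 2 * enorm e ^+ 2 + 2 * beta * rho * a (zs + e)).
Proof.
move=> st Hv h1; have [_ /(_ v)] := step_optimality hf hbeta st.
rewrite (Hbar_quad beta hf) -enorm_sqr.
have hH : enorm (P *m (H (zs + e) *m v)) ^+ 2 <= (rho * enorm e * enorm v) ^+ 2.
  rewrite lerXn2r// ?nnegrE ?mulr_ge0 ?(ltW rho0)//.
  exact: le_trans (enorm_Pmx_le _) (kernel_hess _ Hv).
have {}hH := ler_wpM2l (ltW beta0) hH.
have vv0 : dotp v (H zs *m v) = 0 by rewrite Hv dotp0r.
have := dist_sub0 vv0 h1; rewrite ler_norml => /andP[_]; move: hH.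
move: (dotp v (H (zs + e) *m v)) (enorm (P *m (H (zs + e) *m v))) (a (zs + e)) (T v v e).
by move=> p q b t; lra.
Qed.

Lemma value_expansion eps e :
    `|f (zs + e) - f zs - dotp e (H zs *m e) / 2 - T e e e / 6| <= eps * enorm e ^+ 3 ->
  h (zs + e) - h zs <= dotp e (H zs *m e) / 2 + T e e e / 6 + eps * enorm e ^+ 3
    + beta / 2 * a (zs + e) ^+ 2.
Proof.
rewrite ler_norml => /andP[_ hu]; rewrite (critical_h hf hbeta Gzs) h_regE; move: hu.
move: (f (zs + e)) (a (zs + e)) (dotp e (H zs *m e)) (T e e e) => p b q t; lra.
Qed.

(** [grad f] is controlled by the gradient of [h] through [coercive_full]. *)
Lemma grad_small : exists2 K, 0 < K & forall e,
  a (zs + e) <= K * enorm (G (zs + e)) /\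
  enorm (H zs *m e) <= K * enorm (G (zs + e)) + rho / 2 * enorm e ^+ 2.
Proof.
have [K K0 hK] := @coercive_full _ _ _ f mu L rho beta hf hbeta; exists K => // e.
have gK : enorm (g (zs + e)) <= K * enorm (G (zs + e)).
  by rewrite (grad_h_reg beta hf); exact: hK.
split; first exact: le_trans (enorm_Pmx_le _) gK.
have aux (p q r : 'cV[R]_(n + m)) c : q = 0 -> enorm (p - q - r) <= c ->
    enorm r <= enorm p + c.
  by move=> ->; rewrite subr0 => h1; rewrite -[r in leLHS](subKr p) (le_trans (enormB _ _))// lerD2l.
have h1 := aux _ _ _ _ gzs (grad_taylor hf zs e).
by apply: le_trans h1 _; rewrite lerD2r.
Qed.

(** The optimality condition solved for the linear term, with [Hbar] moved to [zs]. *)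
Lemma step_Hbar_le e x : is_step f L rho beta (zs + e) x ->
  enorm (Hbar beta f zs *m x) <= enorm (G (zs + e))
   + (2 * beta * rho * a (zs + e) + kappa * rho * enorm x) * enorm x
   + (rho + 2 * beta * L * rho) * enorm e * enorm x.
Proof.
move=> st; have [E _] := step_optimality hf hbeta st.
set c := 2 * beta * rho * a (zs + e) + _ in E *.
have c0 : 0 <= c.
  by rewrite addr_ge0// mulr_ge0 ?(ltW kr)// !mulr_ge0// ltW.
have K0 : 0 <= rho + 2 * beta * L * rho by rewrite addr_ge0 ?mulr_ge0 ?ltW// mulr_gt0// mulr_gt0.
apply: enorm_le_dual => [|v]; first by rewrite !addr_ge0// !mulr_ge0.
have h1 : `|dotp v (Hbar beta f (zs + e) *m x)| <= (enorm (G (zs + e)) + c * enorm x) * enorm v.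
  have aux (p q r : 'cV[R]_(n + m)) : p + q + c *: r = 0 ->
      `|dotp v q| <= (enorm p + c * enorm r) * enorm v.
    move=> E1; have -> : q = - (p + c *: r).
      by apply/eqP; rewrite -addr_eq0 addrA [q + p]addrC E1.
    rewrite (le_trans (cauchy_schwarz _ _))// mulrC ler_wpM2r// enormN.
    by rewrite (le_trans (enormD _ _))// enormZ ger0_norm.
  exact: aux E.
have aux2 (p q c1 c2 : R) : `|p - q| <= c1 -> `|p| <= c2 -> q <= c2 + c1.
  by rewrite !ler_norml => /andP[] + _ /andP[_]; lra.
apply: le_trans (aux2 _ _ _ _ (Hbar_lip hf hbeta zs e v x) h1) _.
by rewrite le_eqVlt; apply/orP; left; apply/eqP; ring.
Qed.

End BlowUp.

Section BlowUpLimit.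
Context {R : realType} {n m : nat} (f : 'cV[R]_(n + m) -> R) (mu L rho beta : R).
Context (hf : standing_assumptions f mu L rho) (hbeta : mu^-1 < beta).
Context (zs : 'cV[R]_(n + m)) (Gzs : grad (h_reg beta f) zs = 0).
Implicit Types (e u v x : 'cV[R]_(n + m)).
Notation P := (@Pmx R n m).
Notation g := (grad f).
Notation H := (hess f).
Notation h := (h_reg beta f).
Notation G := (grad (h_reg beta f)).
Notation a z := (enorm (P *m grad f z)).
Notation kappa := (3 * beta * L + 1).
Notation T := (trilinear (third f zs)).

Let mu0 : 0 < mu := mu_gt0 hf.
Let L0 : 0 < L := L_gt0 hf.
Let rho0 : 0 < rho := rho_gt0 hf.
Let beta0 : 0 < beta := beta_gt0 hf hbeta.
Let kr : 0 < kappa * rho := kr0 hf hbeta.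
Let gzs : g zs = 0 := critical_grad hf hbeta Gzs.

Context (F : set_system nat) (UF : UltraFilter F).
Context (tau : nat -> R) (w ze : nat -> 'cV[R]_(n + m)) (w0 z0 : 'cV[R]_(n + m)).
Context (C C1 c : R).
Context (tau_gt0 : forall j, 0 < tau j) (tau_cvg0 : tau @ F --> 0).
Context (w1 : forall j, enorm (w j) = 1) (zeC : forall j, enorm (ze j) <= C).
Context (st : forall j, is_step f L rho beta (zs + tau j *: w j) (tau j *: ze j)).
Context (hG : forall j, enorm (G (zs + tau j *: w j)) <= C1 * tau j ^+ 2).
Context (hv : forall j, c * tau j ^+ 3 <= h (zs + tau j *: w j) - h zs).
Context (cw : vcvg F w w0) (cz : vcvg F ze z0).

Let tau_ge0 j : 0 <= tau j. Proof. exact: ltW. Qed.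

Lemma ultraS2 (A B D : nat -> Prop) : F A -> F B -> (forall j, A j -> B j -> D j) -> F D.
Proof. by move=> FA FB hD; apply: (filterS2 _ hD). Qed.

Lemma tau_small d : 0 < d -> F (fun j => tau j < d).
Proof. by move=> d0; exact: (cvgr_lt 0 tau_cvg0). Qed.

Lemma enorm_tau j v : enorm (tau j *: v) = tau j * enorm v.
Proof. by rewrite enormZ gtr0_norm. Qed.

Lemma enorm_tauw j : enorm (tau j *: w j) = tau j.
Proof. by rewrite enorm_tau w1 mulr1. Qed.

Let C_ge0 : 0 <= C. Proof. exact: le_trans (enorm_ge0 (ze 0)) (zeC 0). Qed.

(** When the gradient of [h] is of second order, so is [H zs *m e], that is, the direction
    is in the kernel of the Hessian up to first order. *)
Lemma kernel_small : exists2 K, 0 < K & forall j,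
  a (zs + tau j *: w j) <= K * tau j ^+ 2 /\ enorm (H zs *m w j) <= K * tau j.
Proof.
have [K K0 hK] := grad_small hf hbeta Gzs.
have C1_ge0 : 0 <= C1.
  have := le_trans (enorm_ge0 _) (hG 0); rewrite pmulr_lge0//; exact: exprn_gt0.
have KC : 0 <= K * C1 by rewrite mulr_ge0// ltW.
exists (K * C1 + rho / 2) => [|j]; first by rewrite ltr_wpDl// divr_gt0.
have [h1 h2] := hK (tau j *: w j).
have h3 := ler_wpM2l (ltW K0) (hG j).
have t2 : 0 <= rho / 2 * tau j ^+ 2 by rewrite mulr_ge0 ?exprn_ge0// divr_ge0// ltW.
split.
  apply: le_trans h1 _; apply: le_trans h3 _.
  by rewrite mulrDl -mulrA; apply: ler_wpDr.
have := le_trans h2 (lerD h3 (lexx _)).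
rewrite -scalemxAr enorm_tauw enorm_tau => h4.
rewrite -(ler_pM2l (tau_gt0 j)); apply: le_trans h4 _.
by rewrite le_eqVlt; apply/orP; left; apply/eqP; ring.
Qed.

Lemma tau_lin_cvg0 K : (fun j => K * tau j) @ F --> 0.
Proof.
rewrite -[X in _ --> X](mulr0 K); apply: cvgM tau_cvg0; exact: cvg_cst.
Qed.

Lemma limit_unit : enorm w0 = 1.
Proof.
apply: (@cvg_eq _ F UF _ _ _ (vcvg_enorm UF cw)).
by under eq_fun do rewrite w1; exact: cvg_cst.
Qed.

Lemma limit_kernel_dir : H zs *m w0 = 0.
Proof.
have [K K0 hK] := kernel_small; apply: enorm_eq0.
apply: (@cvg_eq _ F UF _ _ _ (vcvg_enorm UF (vcvg_mulmx UF cw))).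
apply: (@cvg_squeeze0 _ F UF _ (fun j => K * tau j)); last exact: tau_lin_cvg0.
by apply: filterE => j; rewrite ger0_norm//; case: (hK j).
Qed.

(** [Hbar *m z0] is the limit of quantities of order [tau], and [Hbar] has the kernel of
    the Hessian by [coercive_full]. *)
Lemma limit_kernel_step : H zs *m z0 = 0.
Proof.
have [K K0 hK] := kernel_small.
have [K' K'0 hK'] := @coercive_full _ _ _ f mu L rho beta hf hbeta.
suff B0 : Hbar beta f zs *m z0 = 0.
  apply: enorm_eq0; apply: le_anti; rewrite enorm_ge0 andbT.
  by apply: le_trans (hK' zs _) _; rewrite -Hbar_mul B0 enorm0 mulr0.
apply: enorm_eq0.
apply: (@cvg_eq _ F UF _ _ _ (vcvg_enorm UF (vcvg_mulmx UF cz))).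
set M := C1 + kappa * rho * C ^+ 2 + (rho + 2 * beta * L * rho) * C.
set M2 := 2 * beta * rho * K * C.
have cvg_bound : (fun j => M * tau j + M2 * (tau j * tau j)) @ F --> 0.
  rewrite -[X in _ --> X]addr0; apply: cvgD; first exact: tau_lin_cvg0.
  rewrite -[X in _ --> X](mulr0 M2); apply: cvgM; first exact: cvg_cst.
  by rewrite -[X in _ --> X](mulr0 0); apply: cvgM.
apply: cvg_squeeze0 cvg_bound; apply: filterE => j; rewrite ger0_norm//.
have h1 := step_Hbar_le hf hbeta (st j).
rewrite -scalemxAr !enorm_tau w1 mulr1 in h1.
have [h2 _] := hK j; have h3 := hG j; have h4 := zeC j.
rewrite -(ler_pM2l (tau_gt0 j)); apply: le_trans h1 _.
move: (a (zs + tau j *: w j)) (enorm (G (zs + tau j *: w j))) h2 h3 => b q h2 h3.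
have k1 : 0 <= rho + 2 * beta * L * rho by rewrite addr_ge0 ?mulr_ge0 ?ltW// mulr_gt0// mulr_gt0.
have br : 0 <= 2 * beta * rho by rewrite !mulr_ge0// ltW.
have tz : tau j * enorm (ze j) <= tau j * C by rewrite ler_pM2l.
have e1 : kappa * rho * (tau j * enorm (ze j)) * (tau j * enorm (ze j))
    <= kappa * rho * (tau j * C) * (tau j * C).
  rewrite -!(mulrA (kappa * rho)) ler_pM2l//.
  by apply: ler_pM => //; rewrite mulr_ge0.
have e2 : 2 * beta * rho * b * (tau j * enorm (ze j))
    <= 2 * beta * rho * (K * tau j ^+ 2) * (tau j * C).
  apply: (le_trans (ler_wpM2r _ (ler_wpM2l br h2))); first by rewrite mulr_ge0.
  by rewrite ler_wpM2l// mulr_ge0// mulr_ge0 ?exprn_ge0// ltW.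
have e3 : (rho + 2 * beta * L * rho) * tau j * (tau j * enorm (ze j))
    <= (rho + 2 * beta * L * rho) * tau j * (tau j * C).
  by rewrite ler_wpM2l// mulr_ge0.
rewrite [leLHS](_ : _ = q + 2 * beta * rho * b * (tau j * enorm (ze j)) +
  kappa * rho * (tau j * enorm (ze j)) * (tau j * enorm (ze j)) +
  (rho + 2 * beta * L * rho) * tau j * (tau j * enorm (ze j))); last by ring.
apply: le_trans (lerD (lerD (lerD h3 e2) e1) e3) _.
by rewrite le_eqVlt; apply/orP; left; apply/eqP; rewrite /M /M2; ring.
Qed.

(** The main terms of [step_kernel_expansion] survive the division by the square of the
    distance. *)
Lemma limit_first_order v : H zs *m v = 0 ->
  T v w0 w0 / 2 + T v z0 w0 + kappa * rho * enorm z0 * dotp v z0 = 0.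
Proof.
move=> Hv; have [K K0 hK] := kernel_small.
pose main j := T v (w j) (w j) / 2 + T v (ze j) (w j) + kappa * rho * enorm (ze j) * dotp v (ze j).
have cmain : main @ F --> T v w0 w0 / 2 + T v z0 w0 + kappa * rho * enorm z0 * dotp v z0.
  have cv : vcvg F (fun=> v) v by exact: vcvg_cst.
  apply: cvgD; first apply: cvgD.
  - by apply: cvgM; [exact: vcvg_trilinear|exact: cvg_cst].
  - exact: vcvg_trilinear.
  apply: cvgM; last exact: vcvg_dotp.
  by apply: cvgM; [exact: cvg_cst|exact: vcvg_enorm].
have cH : (fun j => enorm (H zs *m ze j)) @ F --> 0.
  have := vcvg_enorm UF (vcvg_mulmx UF cz : vcvg F (fun j => H zs *m ze j) (H zs *m z0)).
  by rewrite limit_kernel_step enorm0.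
pose M := beta * rho * K + beta * rho * (rho * C) + 2 * beta * rho * K * C.
have bound eps : 0 < eps -> \forall j \near F, `|main j|
    <= enorm v * (eps * (1 + C)) + (enorm v * (beta * rho) * enorm (H zs *m ze j)
       + enorm v * M * tau j).
  move=> e0; have [d1 d10 hd1] := hess_expansion hf zs e0.
  have [d2 d20 hd2] := grad_expansion hf gzs e0.
  have [N1 N2] := (tau_small d10, tau_small d20).
  apply: (ultraS2 N1 N2) => j t1 t2.
  have n1 : enorm (tau j *: w j) <= d1 by rewrite enorm_tauw ltW.
  have n2 : enorm (tau j *: w j) <= d2 by rewrite enorm_tauw ltW.
  have h1 := step_kernel_expansion hf hbeta (ltW e0) (st j) Hv (hd2 _ n2 v)
    (hd1 _ n1 v (tau j *: ze j)).
  rewrite !(third_scale2 hf) -!scalemxAr !enorm_tau w1 mulr1 dotpZr in h1.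
  have [h2 _] := hK j; have h4 := zeC j; have tj := tau_gt0 j.
  have tt : 0 < tau j ^+ 2 by exact: exprn_gt0.
  rewrite -(ler_pM2l tt) -{1}(gtr0_norm tt) -normrM.
  have -> : tau j ^+ 2 * main j = tau j * tau j * T v (w j) (w j) / 2 +
     tau j * tau j * T v (ze j) (w j) +
     kappa * rho * (tau j * enorm (ze j)) * (tau j * dotp v (ze j)).
    by rewrite /main; ring.
  apply: le_trans h1 _.
  rewrite [leRHS](_ : _ = enorm v * (eps * tau j ^+ 2 + eps * tau j * (tau j * C)
    + beta * rho * tau j * (K * tau j ^+ 2)
    + beta * rho * tau j * (tau j * enorm (H zs *m ze j) + rho * tau j * (tau j * C))
    + 2 * beta * rho * (K * tau j ^+ 2) * (tau j * C))); last by rewrite /M; ring.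
  have br : 0 <= beta * rho by rewrite mulr_ge0// ltW.
  have bt : 0 <= beta * rho * tau j by rewrite mulr_ge0.
  have rt : 0 <= rho * tau j by rewrite mulr_ge0// ltW.
  have et : 0 <= eps * tau j by rewrite mulr_ge0// ltW.
  have tz : tau j * enorm (ze j) <= tau j * C by rewrite ler_pM2l.
  apply: ler_wpM2l => //; apply: lerD; last first.
    have b2 : 0 <= 2 * beta * rho by rewrite -mulrA mulr_ge0.
    apply: ler_pM; [exact: mulr_ge0|exact: mulr_ge0| |exact: tz].
    by apply: ler_wpM2l.
  apply: lerD; last by apply: ler_wpM2l => //; rewrite lerD2l; apply: ler_wpM2l.
  apply: lerD; last exact: ler_wpM2l.
  by rewrite lerD2l; apply: ler_wpM2l.
have cb eps : (fun j => enorm v * (eps * (1 + C)) + (enorm v * (beta * rho) * enorm (H zs *m ze j)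
       + enorm v * M * tau j)) @ F --> enorm v * (eps * (1 + C)).
  rewrite -[X in _ --> X]addr0; apply: cvgD; first exact: cvg_cst.
  rewrite -[X in _ --> X]addr0; apply: cvgD; last exact: tau_lin_cvg0.
  rewrite -[X in _ --> X](mulr0 (enorm v * (beta * rho))).
  by apply: cvgM => //; exact: cvg_cst.
have vC : 0 < enorm v * (1 + C) + 1 by rewrite ltr_wpDl// mulr_ge0// addr_ge0.
apply/eqP; rewrite -normr_le0; apply/ler_addgt0Pl => e e0; rewrite addr0.
have e1 := divr_gt0 e0 vC.
apply: le_trans (ler_cvg_to (cvg_norm cmain) (cb _) (bound _ e1)) _.
rewrite mulrCA mulrAC ler_pdivrMr// ler_pM2l//.
by rewrite lerDl.
Qed.

Lemma limit_psd_kernel v : H zs *m v = 0 ->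
  0 <= T v v w0 + kappa * rho * enorm z0 * enorm v ^+ 2.
Proof.
move=> Hv; have [K K0 hK] := kernel_small.
pose M := enorm v ^+ 2 * (beta * rho ^+ 2 + 2 * beta * rho * K).
have bound eps : 0 < eps -> \forall j \near F, 0 <=
    T v v (w j) + kappa * rho * enorm (ze j) * enorm v ^+ 2 + enorm v ^+ 2 * eps + M * tau j.
  move=> e0; have [d1 d10 hd1] := hess_expansion hf zs e0.
  apply: (ultraS2 (tau_small d10) (tau_small d10)) => j t1 _.
  have n1 : enorm (tau j *: w j) <= d1 by rewrite enorm_tauw ltW.
  have h1 := step_kernel_psd hf hbeta (st j) Hv (hd1 _ n1 v v).
  rewrite trilinearZ !enorm_tau w1 mulr1 in h1.
  have [h2 _] := hK j; rewrite -(pmulr_rge0 _ (tau_gt0 j)).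
  apply: le_trans h1 _.
  rewrite [leRHS](_ : _ = tau j * T v v (w j) + kappa * rho * (tau j * enorm (ze j)) * enorm v ^+ 2
    + enorm v ^+ 2 * (eps * tau j + beta * rho ^+ 2 * tau j ^+ 2
    + 2 * beta * rho * (K * tau j ^+ 2))); last by rewrite /M; ring.
  rewrite lerD2l ler_wpM2l ?exprn_ge0// lerD2l ler_wpM2l// mulr_ge0 ?(ltW rho0)//.
  by rewrite mulr_ge0// ltW.
apply/ler_addgt0Pl => e e0.
have vC : 0 < enorm v ^+ 2 + 1 by rewrite ltr_wpDl// exprn_ge0.
have e1 := divr_gt0 e0 vC.
have cb : (fun j => T v v (w j) + kappa * rho * enorm (ze j) * enorm v ^+ 2
     + enorm v ^+ 2 * (e / (enorm v ^+ 2 + 1)) + M * tau j) @ F -->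
    T v v w0 + kappa * rho * enorm z0 * enorm v ^+ 2 + enorm v ^+ 2 * (e / (enorm v ^+ 2 + 1)).
  rewrite -[X in _ --> X]addr0; apply: cvgD; last exact: tau_lin_cvg0.
  apply: cvgD; last exact: cvg_cst.
  have cv : vcvg F (fun=> v) v by exact: vcvg_cst.
  apply: cvgD; first exact: vcvg_trilinear.
  apply: cvgM; last exact: cvg_cst.
  by apply: cvgM; [exact: cvg_cst|exact: vcvg_enorm].
apply: le_trans (cvgr_to_ge cb (bound _ e1)) _.
rewrite addrC lerD2r mulrA ler_pdivrMr// mulrC ler_pM2l//.
by rewrite lerDl.
Qed.

(** The Hessian annihilates the limit direction exactly, so the quadratic part of the
    value is of higher order and the growth is that of the cubic form. *)
Lemma limit_value : c <= T w0 w0 w0 / 6.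
Proof.
have [K K0 hK] := kernel_small.
pose M := beta / 2 * K ^+ 2.
have bound eps : 0 < eps -> \forall j \near F, c <=
    T (w j) (w j) (w j) / 6 + K / 2 * enorm (w j - w0) + M * tau j + eps.
  move=> e0; have [d1 d10 hd1] := f_expansion hf gzs e0.
  apply: (ultraS2 (tau_small d10) (tau_small d10)) => j t1 _.
  have n1 : enorm (tau j *: w j) <= d1 by rewrite enorm_tauw ltW.
  have h1 := le_trans (hv j) (value_expansion hf hbeta Gzs (hd1 _ n1)).
  rewrite (third_cubeZ hf) -scalemxAr dotpZl dotpZr enorm_tauw in h1.
  have [h2 h3] := hK j; have t3 : 0 < tau j ^+ 3 by exact: exprn_gt0.
  have q0 : dotp w0 (H zs *m w j) = 0.
    by rewrite (hess_sym hf) limit_kernel_dir dotp0r.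
  have q1 : dotp (w j) (H zs *m w j) <= enorm (w j - w0) * (K * tau j).
    rewrite -[leLHS]subr0 -q0 -dotpBl (le_trans (dotp_le _ _))//.
    exact: ler_wpM2l.
  have q2 : a (zs + tau j *: w j) ^+ 2 <= (K * tau j ^+ 2) ^+ 2.
    by rewrite lerXn2r// nnegrE// mulr_ge0 ?exprn_ge0// ltW.
  have b2 : 0 <= beta / 2 by rewrite divr_ge0// ltW.
  have q3 := ler_wpM2l b2 q2.
  have q4 := ler_wpM2l (mulr_ge0 (tau_ge0 j) (tau_ge0 j)) q1.
  rewrite -(ler_pM2r t3); apply: le_trans h1 _.
  move: (a (zs + tau j *: w j)) q3 => b q3; rewrite /M.
  move: (T (w j) (w j) (w j)) (enorm (w j - w0)) (dotp (w j) (H zs *m w j)) q4 => p r q q4.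
  by move: q3 q4; lra.
apply/ler_addgt0Pl => eps e0; rewrite addrC.
have cb : (fun j => T (w j) (w j) (w j) / 6 + K / 2 * enorm (w j - w0) + M * tau j + eps) @ F
    --> T w0 w0 w0 / 6 + eps.
  apply: cvgD; last exact: cvg_cst.
  rewrite -[X in _ --> X]addr0; apply: cvgD; last exact: tau_lin_cvg0.
  rewrite -[X in _ --> X]addr0; apply: cvgD.
    by apply: cvgM; [exact: vcvg_trilinear|exact: cvg_cst].
  have cd : vcvg F (fun j => w j - w0) 0.
    rewrite -(subrr w0); apply: vcvgD => //; exact: vcvg_cst.
  rewrite -[X in _ --> X](mulr0 (K / 2)) -(enorm0 (n + m)).
  by apply: cvgM; [exact: cvg_cst|exact: vcvg_enorm].
exact: cvgr_to_ge cb (bound _ e0).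
Qed.

Context (c_gt0 : 0 < c).
Let r0 := enorm (w0 + z0).

(** The limits satisfy the hypotheses of [cubic_contraction]. In the case of equality
    [z0] is a multiple of [w0], and the first order condition makes [w0] a critical
    point of the cubic form on the unit sphere of the kernel. *)
Lemma limit_comparison :
  [/\ c <= T w0 w0 w0 / 6, 2^-1 <= r0,
      T (w0 + z0) (w0 + z0) (w0 + z0) / 6 <= T w0 w0 w0 / 6 * r0 ^+ 3
    & T (w0 + z0) (w0 + z0) (w0 + z0) / 6 = T w0 w0 w0 / 6 * r0 ^+ 3 ->
      r0 < 1 /\ forall v, H zs *m v = 0 -> T w0 w0 v = T w0 w0 w0 * dotp w0 v].
Proof.
have s12 u v x : T u v x = T v u x := third_sym12 hf zs u v x.
have s23 u v x : T u v x = T u x v := third_sym23 hf zs u v x.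
have Hw := limit_kernel_dir; have Hz := limit_kernel_step.
have cP := limit_value; have nw := limit_unit.
have ww : dotp w0 w0 = 1 by rewrite -enorm_sqr nw expr1n.
set p := T w0 w0 w0 / 6; set s := enorm z0; set i := dotp w0 z0.
have p0 : 0 < p by exact: lt_le_trans cP.
have pE : T w0 w0 w0 = 6 * p by rewrite /p; field.
have s0 : 0 < s.
  rewrite lt_neqAle enorm_ge0 andbT eq_sym; apply/eqP => /enorm_eq0 z00.
  have := limit_first_order Hw; rewrite z00 dotp0r mulr0 addr0 pE.
  by rewrite s23 -(scale0r w0) trilinearZ mul0r addr0; lra.
have hA : T w0 w0 z0 + kappa * rho * s * i + 3 * p = 0.
  by have := limit_first_order Hw; rewrite pE (s23 w0 z0) -/s -/i; lra.
have hB : T w0 z0 z0 + kappa * rho * s * s ^+ 2 + T w0 w0 z0 / 2 = 0.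
  have := limit_first_order Hz; rewrite (s12 z0) (s23 w0 z0 w0) (s23 z0 z0) (s12 z0).
  by rewrite -enorm_sqr -/s; lra.
have psdq q : 0 <= q ^+ 2 * (6 * p) + 2 * q * T w0 w0 z0 + T w0 z0 z0
    + kappa * rho * s * (q ^+ 2 + 2 * q * i + s ^+ 2).
  have Hv : H zs *m (q *: w0 + z0) = 0 by rewrite mulmxDr -scalemxAr Hw scaler0 Hz addr0.
  have := limit_psd_kernel Hv; rewrite (s23 _ _ w0) (s12 _ w0) (third_sqrD hf) (third_scale2 hf) pE.
  rewrite enorm_sqrD dotpZl enormZ nw mulr1 real_normK ?num_real// -/i -/s.
  by rewrite (s23 w0 (q *: w0)) trilinearZ (s23 w0 z0); lra.
have is_ : - s <= i by have := dotp_ge w0 z0; rewrite nw mul1r.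
have pr : 6 * p <= rho.
  rewrite -pE (le_trans (ler_norm _))// (le_trans (third_bound hf zs _ _ _))//.
  by rewrite nw !mulr1.
have t3 : T z0 z0 z0 <= rho * s ^+ 3.
  by rewrite (le_trans (ler_norm _))// (le_trans (third_bound hf zs _ _ _))// -/s; lra.
have tB : T z0 z0 z0 + 2 * s * T w0 z0 z0 + s ^+ 2 * T w0 w0 z0
    <= rho * s * (2 * s ^+ 2 + 2 * s * i).
  have := le_trans (ler_norm _) (third_bound hf zs z0 (z0 + s *: w0) (z0 + s *: w0)).
  rewrite (third_sqrD hf) (third_scale2 hf) trilinearZ (s23 z0 z0) (s12 z0 w0) (s12 z0 w0).
  rewrite (s23 w0 z0 w0).
  rewrite [leRHS](_ : _ = rho * s * enorm (z0 + s *: w0) ^+ 2); last by rewrite -/s; ring.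
  rewrite enorm_sqrD dotpZr (dotpC z0) enormZ.
  by rewrite nw mulr1 real_normK ?num_real// -/i -/s; lra.
have r2 : r0 ^+ 2 = 1 + 2 * i + s ^+ 2 by rewrite /r0 enorm_sqrD nw expr1n.
have [C12 C3 C4] := cubic_contraction rho0 (kappa_gt1 hf hbeta) p0 s0 (enorm_ge0 _) r2
  hA hB psdq pr is_ t3 tB.
have cubeE : T (w0 + z0) (w0 + z0) (w0 + z0)
    = 6 * p + 3 * T w0 w0 z0 + 3 * T w0 z0 z0 + T z0 z0 z0.
  by rewrite (third_cubeD hf) pE.
rewrite cubeE; split=> // /C4 [iE r1]; split=> // v Hv.
have zE : z0 = - s *: w0.
  apply/eqP; rewrite -subr_eq0 scaleNr opprK; apply/eqP/enorm_eq0/eqP.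
  rewrite -sqrf_eq0 enorm_sqrD dotpZr dotpC enormZ nw mulr1 real_normK ?num_real//.
  by rewrite -/i -/s iE; apply/eqP; ring.
have first v1 : H zs *m v1 = 0 ->
    (2^-1 - s) * T w0 w0 v1 = kappa * rho * s ^+ 2 * dotp w0 v1.
  move=> Hv1; have := limit_first_order Hv1; rewrite -/s zE dotpZr (dotpC v1).
  rewrite (s12 v1 w0) (s23 w0 v1) (s12 v1) (s23 _ v1) (s12 (- s *: w0)).
  rewrite (s23 w0 (- s *: w0)) trilinearZ (s23 w0 v1); lra.
have e1 := first _ Hw; have e2 := first _ Hv.
have k0 : 0 < kappa * rho * s ^+ 2 by rewrite mulr_gt0// exprn_gt0.
have n0 : 2^-1 - s != 0.
  by apply/eqP => E; move: e1; rewrite E mul0r ww mulr1 => E2; rewrite -E2 ltxx in k0.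
apply: (mulfI n0); by rewrite e2 [RHS]mulrA e1 ww mulr1.
Qed.

End BlowUpLimit.

(** * Linear convergence for the exponent 2/3 *)

(** Walking back from a value above [t] to an earlier one below [t]. *)
Lemma upcrossings {R : realType} (Q : nat -> R) (t : R) :
  (forall N, exists2 k, (N <= k)%N & Q k < t) ->
  (forall N, exists2 k, (N <= k)%N & t < Q k) ->
  forall N, exists2 k, (N <= k)%N & Q k <= t < Q k.+1.
Proof.
move=> hlow hhigh N; have [k1 Nk1 low] := hlow N; have [k2 k12 high] := hhigh k1.
suff [k k1k hk] : exists2 k, (k1 <= k)%N & Q k <= t < Q k.+1.
  by exists k => //; exact: leq_trans k1k.
move: high; rewrite -(subnK k12); elim: (k2 - k1)%N => [|i IH].
  by rewrite add0n => /(lt_trans low); rewrite ltxx.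
rewrite addSn => high; have [le|gt] := leP (Q (i + k1)%N) t; last exact: IH.
by exists (i + k1)%N; rewrite ?leq_addl// le.
Qed.

Section LinearRate.
Context {R : realType} {n m : nat} (f : 'cV[R]_(n + m) -> R) (mu L rho beta : R).
Context (hf : standing_assumptions f mu L rho) (hbeta : mu^-1 < beta).
Context (z xi : nat -> 'cV[R]_(n + m)) (zs : 'cV[R]_(n + m)).
Notation H := (hess f).
Notation h := (h_reg beta f).
Notation G := (grad (h_reg beta f)).
Notation T := (trilinear (third f zs)).
Context (steps : forall k, is_step f L rho beta (z k) (xi k)).
Context (z_next : forall k, z k.+1 = z k + xi k).
Context (accum : forall e N, 0 < e -> exists2 k, (N <= k)%N & enorm (z k - zs) < e).
Notation r k := (h (z k) - h zs).
Notation eta k := (enorm (xi k)).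
Notation dist k := (enorm (z k - zs)).
Context (dist_lim : forall e, 0 < e -> exists k1, forall k, (k1 <= k)%N -> dist k < e).
Context (Cr : R) (Cr_gt0 : 0 < Cr) (kr : nat).
Context (dist_cbrt : forall k, (kr <= k)%N -> dist k <= Cr * r k `^ 3^-1).

Let Gzs := limit_critical hf hbeta steps z_next accum.

(** The value of the cubic form in the direction of the current iterate; it is, up to
    [o(1)], the ratio of [f (z k) - f zs] to the cube of the distance. *)
Definition cubic_ratio k := T (z k - zs) (z k - zs) (z k - zs) / 6 / dist k ^+ 3.
Notation Q := cubic_ratio.

Section Positive.
Context (dist_gt0 : forall k, 0 < dist k).

(** The condition on [dist] makes the gradient at the points [z (k j).+1], which is of
    order [eta (k j) ^+ 2], of second order in their distance to [zs]; the
    hypothesis [dist_cbrt] gives cubic growth of the values there. The limit directions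
    are then those of [limit_comparison], with the same ultrafilter for all choices of
    indices. *)
Lemma blow_up : exists (F : set_system nat) (N0 : nat), [/\ UltraFilter F, \oo `<=` F &
  forall k : nat -> nat, (forall j, (j + N0 <= k j)%N) ->
    (forall j, dist (k j) <= 3 * dist (k j).+1) ->
  exists p p' rr : R,
    [/\ 2^-1 <= rr /\ p' <= p,
      (fun j => Q (k j).+1) @ F --> p, (fun j => Q (k j).+2) @ F --> p',
      (fun j => dist (k j).+2 / dist (k j).+1) @ F --> rr
    & p' = p -> rr < 1 /\ exists w, [/\ dotp w w = 1, H zs *m w = 0, T w w w = 6 * p
        & forall v, H zs *m v = 0 -> T w w v = 6 * p * dotp w v] ]].
Proof.
have [C1 [C2 [k1 [C10 _ hk1]]]] := iter_grad hf hbeta steps z_next accum.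
have [C C0 hC] := iter_step_le_dist hf hbeta steps z_next accum.
have [F [UF Foo]] := @ultraFilterLemma nat \oo _.
exists F, (maxn k1 kr); split=> // k kN reg.
pose tau j := dist (k j).+1.
pose w j := (tau j)^-1 *: (z (k j).+1 - zs).
pose ze j := (tau j)^-1 *: xi (k j).+1.
have tau0 j : 0 < tau j by exact: dist_gt0.
have tau_cvg : tau @ F --> 0.
  apply/cvgr0Pnorm_le => e e0; have [N hN] := dist_lim e0.
  apply: Foo; exists N => // j /= Nj; rewrite ger0_norm ?ltW//; apply: hN.
  by apply: leqW; apply: leq_trans (kN j); exact: leq_trans (leq_addr _ _).
have w1 j : enorm (w j) = 1.
  by rewrite /w enormZ ger0_norm ?invr_ge0 ?ltW// mulVf// gt_eqF.
have tw j : tau j *: w j = z (k j).+1 - zs.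
  by rewrite /w scalerA mulfV ?scale1r// gt_eqF.
have tz j : tau j *: ze j = xi (k j).+1.
  by rewrite /ze scalerA mulfV ?scale1r// gt_eqF.
have zE j : zs + tau j *: w j = z (k j).+1 by rewrite tw addrC subrK.
have zeC j : enorm (ze j) <= C.
  by rewrite /ze enormZ ger0_norm ?invr_ge0 ?(ltW (tau0 j))// mulrC ler_pdivrMr//; exact: hC.
have w_le1 j : enorm (w j) <= 1 by rewrite w1.
have [w0 cw] := vcvg_bounded UF w_le1.
have [z0 cz] := vcvg_bounded UF zeC.
have st j : is_step f L rho beta (zs + tau j *: w j) (tau j *: ze j).
  by rewrite zE tz; exact: steps.
have hG j : enorm (G (zs + tau j *: w j)) <= C1 * (3 * C) ^+ 2 * tau j ^+ 2.
  rewrite zE; have k1k : (k1 <= k j)%N.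
    apply: leq_trans (kN j); apply: leq_trans (leq_addl _ _); exact: leq_maxl.
  apply: le_trans (hk1 _ k1k).2 _; rewrite -mulrA -exprMn ler_pM2l//.
  rewrite lerXn2r ?nnegrE// ?mulr_ge0 ?(ltW C0) ?(ltW (tau0 j))//.
  by have := hC (k j); have := ler_wpM2l (ltW C0) (reg j); rewrite /tau; lra.
have Cr3 : 0 < Cr ^+ 3 by exact: exprn_gt0.
have hv j : (Cr ^+ 3)^-1 * tau j ^+ 3 <= h (zs + tau j *: w j) - h zs.
  rewrite zE mulrC ler_pdivrMr//; have krk : (kr <= (k j).+1)%N.
    apply: leqW; apply: leq_trans (kN j); apply: leq_trans (leq_addl _ _); exact: leq_maxr.
  have r0 := gap_ge0 hf hbeta steps z_next accum (k j).+1.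
  have -> : r (k j).+1 = (r (k j).+1 `^ 3^-1) ^+ 3.
    by rewrite -powR_mulrn ?powR_ge0// -powRrM mulVf ?pnatr_eq0// powRr1.
  rewrite mulrC -exprMn; apply: lerXn2r; last exact: dist_cbrt.
    by rewrite nnegrE ltW.
  by rewrite nnegrE mulr_ge0 ?powR_ge0// ltW.
have ci : 0 < (Cr ^+ 3)^-1 by rewrite invr_gt0.
have [L1 L2 L3 L4] := limit_comparison hf hbeta Gzs UF tau0 tau_cvg w1 zeC st hG hv cw cz ci.
have rr0 : 0 < enorm (w0 + z0) by apply: lt_le_trans L2; rewrite invr_gt0.
have rr3 : 0 < enorm (w0 + z0) ^+ 3 by exact: exprn_gt0.
have zE2 j : z (k j).+2 - zs = tau j *: (w j + ze j).
  by rewrite z_next addrAC scalerDr tw tz.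
have cwz := vcvgD UF cw cz.
exists (T w0 w0 w0 / 6), (T (w0 + z0) (w0 + z0) (w0 + z0) / 6 / enorm (w0 + z0) ^+ 3),
  (enorm (w0 + z0)); split.
- by split=> //; rewrite ler_pdivrMr.
- rewrite (_ : (fun j => _) = (fun j => T (w j) (w j) (w j) / 6)).
    by apply: cvgM; [exact: vcvg_trilinear|exact: cvg_cst].
  apply/funext => j; rewrite /Q -!tw (third_cubeZ hf) enormZ w1 gtr0_norm// mulr1.
  by field; rewrite gt_eqF.
- rewrite (_ : (fun j => _) = (fun j => T (w j + ze j) (w j + ze j) (w j + ze j) / 6
      * (enorm (w j + ze j) ^+ 3)^-1)).
    apply: cvgM; first by apply: cvgM; [exact: vcvg_trilinear|exact: cvg_cst].
    apply: cvgV; first by rewrite gt_eqF.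
    have ce := vcvg_enorm UF cwz.
    rewrite !exprS expr0 mulr1; under eq_fun do rewrite !exprS expr0 mulr1.
    exact: cvgM ce (cvgM ce ce).
  apply/funext => j; rewrite /Q !zE2 (third_cubeZ hf) enormZ gtr0_norm//.
  rewrite exprMn invfM; move: (enorm (w j + ze j) ^+ 3)^-1 => b.
  by field; rewrite gt_eqF.
- rewrite (_ : (fun j => _) = (fun j => enorm (w j + ze j))); first exact: vcvg_enorm.
  apply/funext => j; rewrite zE2 enormZ gtr0_norm// -/(tau j) mulrC mulrA mulVf ?mul1r//.
  by rewrite gt_eqF.
move=> E; have [|r1 crit] := L4; first by rewrite -E divfK// gt_eqF.
split=> //; exists w0; have ww : enorm w0 = 1.
  exact: (limit_unit UF w1 cw).
have pE : 6 * (T w0 w0 w0 / 6) = T w0 w0 w0 by field.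
rewrite pE; split=> //; first by rewrite -enorm_sqr ww expr1n.
exact: (limit_kernel_dir hf hbeta Gzs UF tau0 tau_cvg w1 hG cw).
Qed.

(** If the ratios were not eventually bounded away from [1], then by [blow_up] the cubic
    ratio would have a definite drop infinitely often, hence infinitely many
    upcrossings of every level in some interval; at a limit of upcrossings of [t] the
    cubic form has the critical value [t], against the choice of [t]. *)
Lemma linear_rate_positive : exists2 q : R, 0 < q < 1 &
  exists k1, forall k, (k1 <= k)%N -> dist k.+1 <= q * dist k.
Proof.
have [F [N0 [UF Foo blow]]] := blow_up.
pose reg k := dist k <= 3 * dist k.+1.
have [N hN] : exists N, forall k, (N <= k)%N -> reg k -> reg k.+1.
  apply: contrapT => /forallNP hn.
  have /choice [k hk] : forall j, exists k,
      (j + N0 <= k)%N /\ reg k /\ 3 * dist k.+2 < dist k.+1.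
    move=> j; have /existsNP [k] := hn (j + N0)%N.
    by move=> /not_implyP [jk] /not_implyP [r1 /negP]; rewrite -ltNge => r2; exists k.
  (* the limit of the ratios after such a step is at least [1 / 2] *)
  have [p [p' [rr [[r12 _] _ _ crr _]]]] := blow k (fun j => (hk j).1) (fun j => (hk j).2.1).
  have : rr <= 3^-1.
    apply: cvgr_to_le crr _; apply: filterE => j; rewrite ler_pdivrMr//.
    by have := (hk j).2.2; lra.
  by lra.
have [[k0 Nk0 reg0]|noreg] := pselect (exists2 k, (N <= k)%N & reg k); last first.
  exists 3^-1; first by rewrite invr_gt0 invf_lt1//; apply/andP; split=> //; lra.
  exists N => k Nk; have : ~ reg k by move=> rk; apply: noreg; exists k.
  by move/negP; rewrite -ltNge; lra.
have regs k : (k0 <= k)%N -> reg k.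
  move=> /subnK <-; elim: (k - k0)%N => [//|i IH]; rewrite addSn; apply: hN IH.
  by rewrite (leq_trans Nk0)// leq_addl.
(* a property holding infinitely often provides indices to which [blow] applies *)
have at_level (A : nat -> nat -> Prop) :
    (forall j N1, exists2 k, (N1 <= k)%N & A j k) ->
    exists k : nat -> nat, [/\ forall j, (j + N0 <= k j)%N, forall j, (j <= k j)%N,
      forall j, reg (k j) & forall j, A j (k j).+1].
  move=> hA; have /choice [k hk] : forall j, exists k, (j + N0 + k0 <= k)%N /\ A j k.+1.
    move=> j; have [[//|k]] := hA j (j + N0 + k0).+1; rewrite ltnS => jk Ak.
    by exists k.
  exists k; split=> j; have [h1 h2] := hk j => //.
  - exact: leq_trans (leq_addr _ _) h1.
  - by apply: leq_trans h1; rewrite -addnA leq_addr.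
  - by apply: regs; apply: leq_trans (leq_addl _ _) h1.
apply: contrapT => bad.
have hbad q N1 : 0 < q < 1 -> exists2 k, (N1 <= k)%N & q * dist k < dist k.+1.
  move=> q01; apply: contrapT => nb; apply: bad; exists q => //; exists N1 => k Nk.
  by rewrite leNgt; apply/negP => lt; apply: nb; exists k.
(* ratios above [qs j], with [qs] tending to [1], force a limit ratio of at least [1] *)
pose qs j : R := 1 - j.+2%:R^-1.
have qs01 j : 0 < qs j < 1.
  by rewrite subr_gt0 invf_lt1// ltr1n /= ltrBlDr ltrDl invr_gt0.
have [k [k_N0 k_ge k_reg k_bad]] := at_level (fun j k => qs j * dist k < dist k.+1)
  (fun j N1 => hbad (qs j) N1 (qs01 j)).
have [p [p' [rr [[r12 p'p] cp cp' crr crit]]]] := blow k k_N0 k_reg.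
have rr1 : 1 <= rr.
  have cq : qs @ F --> (1 : R).
    rewrite -[X in _ --> X]subr0; apply: cvgB; first exact: cvg_cst.
    apply: cvg_trans (_ : (fun j => (j.+2%:R : R)^-1) @ \oo --> 0).
      by move=> A; apply: Foo.
    by rewrite (cvg_shiftS (@harmonic R)); exact: cvg_harmonic.
  apply: ler_cvg_to cq crr _; apply: filterE => j.
  by rewrite ler_pdivlMr// ltW.
have p'_lt : p' < p.
  rewrite lt_neqAle p'p andbT; apply/eqP => /crit [lt _].
  by move: rr1; rewrite leNgt lt.
have [t /andP[p't tp] noncrit] := exists_noncritical_value (H zs) p'_lt
  (third_sym12 hf zs) (third_sym23 hf zs).
have far (A : nat -> Prop) N1 : F A -> exists2 j, (N1 <= j)%N & A j.
  move=> FA; have : F (A `&` [set j | (N1 <= j)%N])%classic.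
    by apply: filterI => //; apply: Foo; exists N1.
  by move=> /filter_ex [j [Aj Nj]]; exists j.
have below N1 : exists2 i, (N1 <= i)%N & Q i < t.
  have [j Nj hj] := far _ N1 (cvgr_lt _ cp' _ p't); exists (k j).+2 => //.
  by apply: leqW; apply: leqW; exact: leq_trans (k_ge j).
have above N1 : exists2 i, (N1 <= i)%N & t < Q i.
  have [j Nj hj] := far _ N1 (cvgr_gt _ cp _ tp); exists (k j).+1 => //.
  by apply: leqW; exact: leq_trans (k_ge j).
have [k' [k'_N0 _ k'_reg k'_up]] := at_level (fun _ i => Q i <= t < Q i.+1)
  (fun _ => upcrossings below above).
have [p2 [p2' [rr2 [[_ le2] cp2 cp2' _ crit2]]]] := blow k' k'_N0 k'_reg.
have p2t : p2 <= t.
  by apply: cvgr_to_le cp2 _; apply: filterE => j; case/andP: (k'_up j).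
have tp2 : t <= p2'.
  by apply: cvgr_to_ge cp2' _; apply: filterE => j; case/andP: (k'_up j) => _ /ltW.
have [|_ [w [ww Hw Tw crit_w]]] := crit2 _.
  by apply: le_anti; rewrite le2 (le_trans p2t).
have p2E : p2 = t by apply: le_anti; rewrite p2t (le_trans tp2).
by rewrite p2E in Tw crit_w; exact: noncrit ww Hw Tw crit_w.
Qed.

End Positive.

Lemma linear_rate : exists2 q : R, 0 < q < 1 &
  exists k1, forall k, (k1 <= k)%N -> dist k.+1 <= q * dist k.
Proof.
have [pos|] := pselect (forall k, 0 < dist k); first exact: linear_rate_positive.
move=> /existsNP [k0 /negP]; rewrite -leNgt => dk0.
have [C C0 hC] := iter_step_le_dist hf hbeta steps z_next accum.
exists 2^-1; first by rewrite invr_gt0 invf_lt1//; apply/andP; split=> //; lra.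
exists k0; have zero i : dist (i + k0)%N = 0.
  elim: i => [|i IH]; first by apply: le_anti; rewrite dk0 enorm_ge0.
  apply: le_anti; rewrite enorm_ge0 andbT addSn.
  apply: le_trans (dist_next_le zs z_next _) _.
  by rewrite IH add0r; have := hC (i + k0)%N; rewrite IH mulr0.
move=> k /subnK <-; rewrite -addSn !zero mulr0//.
Qed.

End LinearRate.

(** * Rates of the iterates *)

Section Eventually.
Context {R : realType}.
Implicit Types (u : nat -> R).

Lemma eventually_cvg0 u : (forall k, 0 <= u k) ->
  (forall e, 0 < e -> exists k1, forall k, (k1 <= k)%N -> u k < e) -> u @ \oo --> (0 : R).
Proof.
move=> u0 h; apply/cvgr0Pnorm_le => e e0; have [k1 hk] := h e e0.
by exists k1 => // k /= kk; rewrite ger0_norm// ltW// hk.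
Qed.

Lemma powR_succ (x p : R) : 0 <= x -> p != 0 -> x `^ p = x * x `^ (p - 1).
Proof.
move=> x0 p0; rewrite -[X in X * _](powRr1 x0) -powRD; first by rewrite addrC subrK.
by rewrite addrC subrK (negbTE p0).
Qed.

End Eventually.

Section MethodRates.
Context {R : realType} {n m : nat} (f : 'cV[R]_(n + m) -> R) (mu L rho beta : R).
Context (hf : standing_assumptions f mu L rho) (hbeta : mu^-1 < beta).
Context (z xi : nat -> 'cV[R]_(n + m)) (zs : 'cV[R]_(n + m)).
Notation h := (h_reg beta f).
Notation kappa := (3 * beta * L + 1).
Context (steps : forall k, is_step f L rho beta (z k) (xi k)).
Context (z_next : forall k, z k.+1 = z k + xi k).
Context (accum : forall e N, 0 < e -> exists2 k, (N <= k)%N & enorm (z k - zs) < e).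
Notation r := (fun k : nat => h (z k) - h zs).
Notation eta := (fun k : nat => enorm (xi k)).
Notation dist := (fun k : nat => enorm (z k - zs)).

Let c0 : 0 < kappa * rho / 6. Proof. by rewrite divr_gt0// (kr0 hf hbeta). Qed.
Let r_ge0 : forall k, 0 <= r k := gap_ge0 hf hbeta steps z_next accum.
Let eta_ge0 k : 0 <= eta k. Proof. exact: enorm_ge0. Qed.
Let dist_ge0 k : 0 <= dist k. Proof. exact: enorm_ge0. Qed.
Let decrease : forall k, r k.+1 + kappa * rho / 6 * eta k ^+ 3 <= r k :=
  iter_decrease hf hbeta zs steps z_next.
Let up : forall k, dist k.+1 <= dist k + eta k := dist_next_le zs z_next.
Let down : forall k, dist k <= dist k.+1 + eta k := dist_le_next zs z_next.
Let acc := accum_gap' hf hbeta accum.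

Section KL.
Context (theta : R) (hKL : KL_at h theta zs).

Let theta01 : 0 < theta < 1.
Proof. by case: hKL => /andP[h1 ->] _; rewrite andbT (lt_le_trans _ h1)// invr_gt0. Qed.

Lemma KL_dist_to0 e : 0 < e -> exists k1, forall k, (k1 <= k)%N -> dist k < e.
Proof.
have [K [del [k0 [K0 d0 kl]]]] := KL_iterates hf hbeta steps z_next accum hKL.
exact: (dist_to0 theta01 c0 K0 d0 r_ge0 eta_ge0 decrease up kl acc).
Qed.

Lemma KL_dist_cvg0 : dist @ \oo --> (0 : R).
Proof. exact: eventually_cvg0 dist_ge0 KL_dist_to0. Qed.

Lemma KL_order : theta <= 2 / 3 -> Q_order (2 / (3 * theta)) dist.
Proof.
move=> th; split; first exact: KL_dist_cvg0.
have [K [del [k0 [K0 d0 kl]]]] := KL_iterates hf hbeta steps z_next accum hKL.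
have [C3 C30 hC3] := iter_step_le_dist hf hbeta steps z_next accum.
have [C C0 [k1 hk1]] := dist_le_order theta01 c0 K0 d0 r_ge0 eta_ge0 dist_ge0 decrease
  up down kl acc th C30 hC3.
by exists C => //; exists k1.
Qed.

Lemma KL_superlinear : theta < 2 / 3 -> Q_superlinear dist.
Proof.
move=> th; have [to0 [C C0 [k1 _ hC]]] := KL_order (ltW th).
split=> // e e0; set p := 2 / (3 * theta) in hC.
have t0 : 0 < theta by case/andP: theta01.
have p1 : 0 < p - 1 by rewrite subr_gt0 ltr_pdivlMr ?mulr_gt0// mul1r; lra.
have [d d0 hd] := powR_small p1 (divr_gt0 e0 C0).
have [k2 hk2] := KL_dist_to0 d0.
exists (maxn k1 k2) => // k /=; rewrite geq_max => /andP[kk1 kk2].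
apply: le_trans (hC k kk1) _; rewrite powR_succ//; last by rewrite gt_eqF//; lra.
rewrite mulrCA [leRHS]mulrC ler_wpM2l// mulrC -ler_pdivlMr// ltW// hd//.
by rewrite dist_ge0 hk2.
Qed.

Lemma KL_linear : theta = 2 / 3 -> Q_linear dist.
Proof.
move=> th; split; first exact: KL_dist_cvg0.
have [K [del [k0 [K0 d0 kl]]]] := KL_iterates hf hbeta steps z_next accum hKL.
have th' : theta <= 2 / 3 by rewrite th.
have [Cr Cr0 [kr hkr]] := dist_le_cbrt theta01 c0 K0 d0 r_ge0 eta_ge0 decrease
  up down kl acc th'.
have [q q01 [k1 hk1]] := linear_rate hf hbeta steps z_next accum KL_dist_to0 Cr0 hkr.
by exists q => //; exists k1.
Qed.

(** Eliminating the step length from the two inequalities of the method gives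
    [r k.+1 `^ (3 * theta / 2) <= B * (r k - r k.+1)]. *)
Lemma KL_sublinear : 2 / 3 < theta -> dist =O_\oo (fun k : nat =>
  k%:R `^ (- (2 * (1 - theta)) / (3 * theta - 2))).
Proof.
move=> th; have [K [del [k0 [K0 d0 kl]]]] := KL_iterates hf hbeta steps z_next accum hKL.
have [k1 k01 hk1] := kl_eventually theta01 c0 K0 d0 r_ge0 eta_ge0 decrease up down kl acc.
have /andP[t0 t1] := theta01.
pose gam := 3 * theta / 2; pose q := 2 / (3 * theta - 2).
have den : 0 < 3 * theta - 2 by lra.
have gam1 : 1 < gam by rewrite /gam; lra.
have qg : q * (gam - 1) = 1 by rewrite /q /gam; field; rewrite gt_eqF.
have q0 : 0 < q by rewrite divr_gt0.
pose c := kappa * rho / 6; pose B := K `^ (3 / 2) / c.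
have dec k : r k.+1 + c * eta k ^+ 3 <= r k by exact: decrease.
have B0 : 0 < B by rewrite divr_gt0// powR_gt0.
have rec k : (k1 <= k)%N -> r k.+1 `^ gam <= B * (r k - r k.+1).
  move=> kk; have [h1 _] := hk1 _ kk.
  have -> : gam = theta * (3 / 2) by rewrite /gam mulrA [theta * 3]mulrC.
  rewrite powRrM; apply: le_trans (le_powR _ (powR_ge0 _ _) h1) _; first by rewrite divr_ge0.
  rewrite powRM ?exprn_ge0 ?(ltW K0)// -powR_mulrn// -powRrM mulrCA mulfV ?pnatr_eq0// mulr1.
  rewrite powR_mulrn// /B -mulrA ler_wpM2l ?powR_ge0// mulrC ler_pdivlMr// mulrC.
  rewrite lerBrDl; exact (dec k).
have [A A0 [k2 hk2]] := sublinear_decay gam1 qg B0 r_ge0 rec.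
have [C C0 [k3 hk3]] := dist_le_power theta01 c0 K0 d0 r_ge0 eta_ge0 decrease up down kl
  acc (ltW th).
apply/eqO_exP; exists (C * A `^ (1 - theta)); first by rewrite mulr_gt0// powR_gt0.
exists (maxn k2 k3) => // k /=; rewrite geq_max => /andP[kk2 kk3].
rewrite ger0_norm// ger0_norm ?powR_ge0//; apply: le_trans (hk3 _ kk3) _.
rewrite -mulrA ler_pM2l//.
have -> : - (2 * (1 - theta)) / (3 * theta - 2) = - q * (1 - theta) by rewrite /q; field; rewrite gt_eqF.
rewrite powRrM -powRM ?(ltW A0) ?powR_ge0//; apply: le_powR => //; last exact: hk2.
by rewrite subr_ge0 ltW.
Qed.

End KL.

(** At a point satisfying the second order condition the gradient of [h] grows linearly,
    whereas after a step it is at most quadratic in the distance. *)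
Lemma SOSC_quadratic : SOSC f zs -> Q_quadratic dist.
Proof.
move=> sosc; have hKL := sosc_KL hf hbeta sosc.
split; first exact: KL_dist_cvg0 hKL.
have [c [del [c_gt0 d0 hG]]] := sosc_growth hf hbeta sosc.
have [C1 [C2 [k1 [C10 _ hk1]]]] := iter_grad hf hbeta steps z_next accum.
have [C C_gt0 hC] := iter_step_le_dist hf hbeta steps z_next accum.
have [k2 hk2] := KL_dist_to0 hKL d0.
exists (C1 * C ^+ 2 / c); first by rewrite divr_gt0// mulr_gt0// exprn_gt0.
exists (maxn k1 k2) => // k /=; rewrite geq_max => /andP[kk1 kk2].
have h1 := hG _ (ltW (hk2 k.+1 (leqW kk2))).
rewrite powR_mulrn// mulrAC ler_pdivlMr// mulrC -mulrA -exprMn.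
rewrite (_ : zs + (z k.+1 - zs) = z k.+1) in h1; last by rewrite addrC subrK.
apply: le_trans h1 (le_trans (hk1 _ kk1).2 _); rewrite ler_pM2l//.
by rewrite lerXn2r ?nnegrE// mulr_ge0// ltW.
Qed.

End MethodRates.

Theorem theorem3p12 (R : realType) (n m : nat) (f : 'cV[R]_(n + m) -> R)
    (mu L rho beta : R)
    (hf : standing_assumptions f mu L rho)
    (hbeta : mu^-1 < beta)
    (hKL : forall x, crit (h_reg beta f) x ->
             exists theta : R, KL_at (h_reg beta f) theta x)
    (z : nat -> 'cV[R]_(n + m))
    (hz : acqrn_sequence beta (2 * beta * rho) (2 * (3 * beta * L + 1) * rho) f z)
    (zstar : 'cV[R]_(n + m))
    (hacc : cluster (z @ \oo) zstar) :
  let dist := fun k : nat => enorm (z k - zstar) in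
  (SOSC f zstar -> Q_quadratic dist) /\
  (forall theta : R, KL_at (h_reg beta f) theta zstar ->
    [/\ 2^-1 <= theta < 2 / 3 ->
          Q_superlinear dist /\ Q_order (2 / (3 * theta)) dist,
        theta = 2 / 3 -> Q_linear dist
      & 2 / 3 < theta < 1 ->
          dist =O_\oo (fun k : nat =>
            k%:R `^ (- (2 * (1 - theta)) / (3 * theta - 2)))]).
Proof.
move=> dist; have [xi hxi] := hz.
have steps k : is_step f L rho beta (z k) (xi k) := (hxi k).1.
have z_next k : z k.+1 = z k + xi k := (hxi k).2.
have accum e N : 0 < e -> exists2 k, (N <= k)%N & enorm (z k - zstar) < e.
  move=> e0; have tail : (z @ \oo) [set z k | k in [set k | (N <= k)%N]].
    by exists N => // k /= Nk; exists k.
  have ball : nbhs zstar [set y | enorm (y - zstar) < e].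
    by apply/nbhs_enormP; exists e.
  by have [_ [[k Nk <-] hk]] := hacc _ _ tail ball; exists k.
split; first exact: (SOSC_quadratic hf hbeta steps z_next accum).
move=> theta kl; split=> [/andP[_ th]|th|/andP[th _]].
- split; first exact: (KL_superlinear hf hbeta steps z_next accum kl th).
  exact: (KL_order hf hbeta steps z_next accum kl (ltW th)).
- exact: (KL_linear hf hbeta steps z_next accum kl th).
exact: (KL_sublinear hf hbeta steps z_next accum kl th).
Qed.
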